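(* Let $l\in(1,2]$ and for each $n\ge1$ let $\mu_{n,1},\dots,\mu_{n,n}$ be probability distributions on $\mathbb{R}$. For each $n$ and each dimension $p$, let $X_1,\dots,X_n$ be independent random vectors in $\mathbb{R}^p$ (the dependence on $n$ and $p$ is suppressed), with $j$th component of $X_i$ denoted $X_{ij}$, such that: (A.1) for each $i\in\{1,\dots,n\}$ the components $X_{i1},\dots,X_{ip}$ are independent and identically distributed, with common distribution $\mu_{n,i}$. Let $s_n^2=\sum_{i=1}^n \mathrm{Var}(X_{i1})$ and assume: (A.2) $\mathbf{E}X_{i1}^{2m-1}=0$ for all integers $m\ge 1$ and all $i\in\{1,\dots,n\}$; (A.3) $0<\inf_{n\ge 1} n^{-1}s_n^2\le \sup_{n\ge 1} n^{-1}s_n^2<\infty$; (A.4) for all integers $m\ge 1$, $$\sup_{n\ge 1}\Big[n^{m-1}\sum_{i=1}^n \mathbf{E}\Big(\frac{X_{i1}}{s_n}\Big)^{2m}\Big]\le \frac{l^{-m}(2m)!}{m!}.$$ Then there exists a constant $c$ with $0<c\le (1-l^{-1})^3$ such that, for every $\epsilon$ with $0<\epsilon<c$, if $p=p_n=\lfloor \exp(\epsilon n^{1/2})\rfloor$ for every $n$, then $$\limsup_{n\to\infty}\rho_{n,\mathcal{A}^{re}}<\epsilon.$$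
   Context: $\mathcal{A}^{re}=\big\{\prod_{j=1}^p([a_j,b_j]\cap\mathbb{R}): -\infty\le a_j\le b_j\le\infty,\ j=1,\dots,p\big\}$ is the class of hyper-rectangles in $\mathbb{R}^p$. Put $T_n=\big(\sum_{i=1}^n \mathbf{E}X_iX_i'\big)^{-1/2}\sum_{i=1}^n X_i$, which under (A.1) and mean zero equals $s_n^{-1}\sum_{i=1}^n X_i$. Let $Z$ be a Gaussian random vector in $\mathbb{R}^p$ with mean $0$ and identity covariance matrix. Define $$\rho_{n,\mathcal{A}^{re}}=\sup_{A\in\mathcal{A}^{re}}\big|\mathbf{P}(T_n\in A)-\mathbf{P}(Z\in A)\big|.$$ *)

(* Defs.v *)
From HB Require Import structures.
From mathcomp Require Import all_boot all_order all_algebra.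
From mathcomp Require Import all_classical all_reals all_analysis.
Set Implicit Arguments.
Unset Strict Implicit.
Unset Printing Implicit Defensive.
Import Order.TTheory GRing.Theory Num.Theory.
Local Open Scope classical_set_scope.
Local Open Scope ring_scope.

(* This development uses MathComp and MathComp-Analysis.  A random vector of
   R^p is valued in p.-tuple (measurableTypeR R), whose sigma-algebra is the
   product (hence the Borel) one. *)

Section Vectors.
Context {R : realType}.

Definition colv p (t : p.-tuple (measurableTypeR R)) : 'cV[R]_p :=
  \col_j tnth t j.

Definition qform p (B : 'M[R]_p) (v : 'cV[R]_p) : R := (v^T *m B *m v) 0 0.

Definition possemidef p (B : 'M[R]_p) : Prop :=
  B^T = B /\ forall v, 0 <= qform B v.

Definition posdef p (B : 'M[R]_p) : Prop :=
  B^T = B /\ forall v, v != 0 -> 0 < qform B v.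

(* The (unique) positive semidefinite square root; it is 0 when there is none,
   i.e. when S is not positive semidefinite. *)
Definition sqrtmx p (S : 'M[R]_p) : 'M[R]_p :=
  xget 0 [set B | possemidef B /\ B *m B = S].

Definition invsqrtmx p (S : 'M[R]_p) : 'M[R]_p := invmx (sqrtmx S).

Definition hyper_rectangles p : set (set 'cV[R]_p) :=
  [set A | exists a b : 'I_p -> \bar R, (forall j, a j <= b j)%E /\
     A = [set x : 'cV[R]_p | forall j, (a j <= (x j 0)%:E <= b j)%E]].

End Vectors.

Section Probability.
Context {R : realType}.

(* For a finite family the product rule over all of I, for arbitrary measurable
   B i, contains the rule for each subfamily (take B i := setT). *)
Definition mutually_independent d (T : measurableType d) (P : probability T R)
    (I : finType) d' (T' : measurableType d') (Y : I -> T -> T') : Prop :=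
  forall B : I -> set T', (forall i, measurable (B i)) ->
    P [set w | forall i, B i (Y i w)] = (\prod_i P (Y i @^-1` B i))%E.

Definition has_distribution d (T : measurableType d) (P : probability T R)
    (Y : T -> R) (mu : probability (measurableTypeR R) R) : Prop :=
  forall B : set (measurableTypeR R), measurable B -> P (Y @^-1` B) = mu B.

(* Integral over R^p with respect to Lebesgue measure, for a nonnegative
   measurable f, as an iterated integral (Tonelli). *)
Fixpoint lebesgue_integral_tuple p :
    (p.-tuple (measurableTypeR R) -> \bar R) -> \bar R :=
  match p with
  | 0%N => fun f => f [tuple]
  | q.+1 => fun f => (\int[@lebesgue_measure R]_x
      lebesgue_integral_tuple (fun t => f [tuple of x :: t]))%E
  end.

Definition gaussian_pdf p (m : 'cV[R]_p) (S : 'M[R]_p) (x : 'cV[R]_p) : R :=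
  (Num.sqrt ((2 * pi) ^+ p * \det S))^-1
    * expR (- (qform (invmx S) (x - m) / 2)).

(* Z has the nondegenerate normal law N(m, S) on R^p. *)
Definition gaussian_vector d (T : measurableType d) (P : probability T R) p
    (Z : {RV P >-> p.-tuple (measurableTypeR R)})
    (m : 'cV[R]_p) (S : 'M[R]_p) : Prop :=
  posdef S /\
  forall A : set (p.-tuple (measurableTypeR R)), measurable A ->
    P (Z @^-1` A) = lebesgue_integral_tuple
      (fun t => (\1_A t * gaussian_pdf m S (colv t))%:E).

(* \sum_i E X_i X_i', with the expectation taken entrywise. *)
Definition sum_second_moment d (T : measurableType d) (P : probability T R) n p
    (X : 'I_n -> {RV P >-> p.-tuple (measurableTypeR R)}) : 'M[R]_p :=
  \sum_(i < n) \matrix_(j, k)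
    fine ('E_P[fun w => (tnth (X i w) j * tnth (X i w) k : R)%R])%E.

Definition normalized_sum d (T : measurableType d) (P : probability T R) n p
    (X : 'I_n -> {RV P >-> p.-tuple (measurableTypeR R)}) (w : T) : 'cV[R]_p :=
  invsqrtmx (sum_second_moment X) *m \sum_(i < n) colv (X i w).

Definition rho d (T : measurableType d) (P : probability T R)
    d' (T' : measurableType d') (Q : probability T' R) n p
    (X : 'I_n -> {RV P >-> p.-tuple (measurableTypeR R)})
    (Z : {RV Q >-> p.-tuple (measurableTypeR R)}) : \bar R :=
  ereal_sup [set `| P [set w | A (normalized_sum X w)]
                  - Q [set w | A (colv (Z w))] |%E | A in @hyper_rectangles R p].

Definition sum_variance n (mu : 'I_n -> probability (measurableTypeR R) R) :
    \bar R := (\sum_(i < n) 'V_(mu i)[idfun])%E.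

End Probability.

(* Main.v *)
Require Import Defs.
From HB Require Import structures.
From mathcomp Require Import all_boot all_order all_algebra.
From mathcomp Require Import all_classical all_reals all_analysis.
From mathcomp Require Import measurable_realfun ring lra zify.
Import Order.TTheory GRing.Theory Num.Theory.
Import numFieldNormedType.Exports.
Local Open Scope classical_set_scope.
Local Open Scope ring_scope.
Set Implicit Arguments.
Unset Strict Implicit.
Unset Printing Implicit Defensive.

(** Why a dimension as large as exp(eps sqrt n) is harmless.

By hypotheses A1 and A2 the matrix that normalizes the sum is a scalar one, so
that the coordinates of T_n are independent copies of one normalized sum S of n
independent variables (normalized_sum_box), and the probability of a rectangle
is a product of p interval probabilities, to be compared with the same product
for the normal variable N. A product of probabilities near 1 is compared best
through complements: if |u_j - w_j| <= dlt (1 - w_j) + z for all j, then the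
products of the u_j and of the w_j differ by O(dlt + p z), whatever p, as
long as dlt and p z are at most 1/2 (prod_compare). It is enough, therefore, to know the tails of S up to a small
relative error, in the range where they are not below 1/p: the theorem reduces to
the moderate deviation estimate P(S > t) = (1 + O(eps^2)) P(N > t) for
0 <= t <= X with X = 2 sqrt eps n^(1/4), since then
p P(N > X) <= exp(eps sqrt n - 2 eps sqrt n) tends to 0. Reflecting the
variables gives the lower tails, and the distance on rectangles is O(eps^2) for
large n, which is below eps/2 when eps is small.

The estimate (moderate_deviation) holds because the third moments vanish. The
first correction to the normal tail is then of relative order t^4/n, that is
O(eps^2) in this range. It is proved by Lindeberg's replacement. Let
heat t v x = P(x + sqrt v N > t). Replacing a step x of variance s by heat flow
for a time s costs, after the cancellation of the first three moments, a fourth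
moment of x times the fourth derivative of the heat flow (heat_swap). That
derivative is bounded with an exponential weight e^{h(w - t)} in the position w
of the walk; the mean of e^{hw} over the walk is about e^{h^2/2}, and for h = t
the total weight is e^{-t^2/2}, the size of the normal tail up to a factor
1 + t (convn_heat_bound, expR_le_gtail). The sum over the steps of the remaining
factors is small because it telescopes along the variance still to be replaced
(heat4_weight_sum). There the fourth moments are interpolated between the
variances and the eighth moments under the weight e^{3h|x|}, and only the sum of
the latter is needed, of order n^(-3). The smoothing needed to start the heat
flow is removed at the end (relative_tail_error).

Hypothesis A4 bounds the even moments by Gaussian ones up to a geometric factor;
their generating series bounds the weighted eighth moments for h up to the
order of sqrt n (sum_exp_moment), beyond the n^(1/4) that is used. *)

(** * Derivatives along the real line *)

Section Calculus.
Context {R : realType}.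
Implicit Types (f g df : R -> R) (a b x : R).

Lemma mvt f df a b : a <= b ->
  (forall x, a <= x <= b -> is_derive x 1 f (df x)) ->
  exists2 c, a <= c <= b & f b - f a = df c * (b - a).
Proof.
move=> ab fdf; have [] := @MVT_segment R f df a b ab.
- by move=> x; rewrite in_itv/= => /andP[ax xb]; apply: fdf; rewrite !ltW.
- by apply: derivable_within_continuous => y; rewrite in_itv/= => /fdf h; exact: ex_derive.
- by move=> c; rewrite in_itv/= => hc ->; exists c.
Qed.

Lemma nincr_of_derive f df a b : a <= b ->
  (forall x, a <= x <= b -> is_derive x 1 f (df x)) ->
  (forall x, a <= x <= b -> df x <= 0) -> f b <= f a.
Proof.
move=> ab fdf df0; have [c hc h] := mvt ab fdf.
by rewrite -subr_le0 h mulr_le0_ge0 ?df0// subr_ge0.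
Qed.

(** The library states the rules of differentiation for pointwise operations on
functions; these versions, on explicit abstractions, can be selected by the
syntax of the function, which the tactic [isd] below does. *)
Lemma isd_cst (k x : R) : is_derive x 1 (fun _ => k) 0.
Proof. exact: is_derive_cst. Qed.

Lemma isd_id x : is_derive x 1 (fun y : R => y) 1.
Proof. exact: is_derive_id. Qed.

Lemma isd_add f g x (u v : R) : is_derive x 1 f u -> is_derive x 1 g v ->
  is_derive x 1 (fun y => f y + g y) (u + v).
Proof. exact: is_deriveD. Qed.

Lemma isd_opp f x (u : R) : is_derive x 1 f u -> is_derive x 1 (fun y => - f y) (- u).
Proof. exact: is_deriveN. Qed.

Lemma isd_mul f g x (u v : R) : is_derive x 1 f u -> is_derive x 1 g v ->
  is_derive x 1 (fun y => f y * g y) (f x * v + g x * u).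
Proof. exact: is_deriveM. Qed.

Lemma isd_comp f g x (u v : R) : is_derive (g x) 1 f u -> is_derive x 1 g v ->
  is_derive x 1 (fun y => f (g y)) (u * v).
Proof. exact: is_derive1_comp. Qed.

Lemma isd_exp n f x (u : R) : is_derive x 1 f u ->
  is_derive x 1 (fun y => f y ^+ n) (n%:R * f x ^+ n.-1 * u).
Proof. by move=> fu; rewrite -exprfctE; exact: is_deriveX. Qed.

Lemma isd_inv f x (u : R) : f x != 0 -> is_derive x 1 f u ->
  is_derive x 1 (fun y => (f y)^-1) (- (f x) ^- 2 * u).
Proof. exact: is_deriveV. Qed.

Lemma isd_expR f x (u : R) : is_derive x 1 f u ->
  is_derive x 1 (fun y => expR (f y)) (expR (f x) * u).
Proof. exact: isd_comp. Qed.

End Calculus.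

Ltac isd := lazymatch goal with
  | |- is_derive _ _ (fun _ => ?k) _ => exact: (isd_cst k)
  | |- is_derive _ _ (fun y => y) _ => exact: isd_id
  | |- is_derive _ _ (fun y => @?f y + @?g y) _ => eapply (@isd_add _ f g); [isd|isd]
  | |- is_derive _ _ (fun y => - (@?f y)) _ => eapply (@isd_opp _ f); isd
  | |- is_derive _ _ (fun y => @?f y * @?g y) _ => eapply (@isd_mul _ f g); [isd|isd]
  | |- is_derive _ _ (fun y => (@?f y)^-1) _ => eapply (@isd_inv _ f); [idtac|isd]
  | |- is_derive _ _ (fun y => (@?f y) ^+ ?n) _ => eapply (@isd_exp _ n f); isd
  | |- is_derive _ _ (fun y => expR (@?f y)) _ => eapply (@isd_expR _ f); isd
  | |- _ => try eassumption
  end.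

(** * The tail of the standard normal law *)

Section GaussTail.
Context {R : realType}.
Implicit Types x t m s z : R.

Definition gpdf x : R := normal_pdf 0 1 x.
Definition gtail x : R := fine (normal_prob (0 : R) 1 `]x, +oo[).

Local Notation N01 := (normal_prob (0 : R) 1).

Lemma gpdfE x : gpdf x = normal_peak 1 * expR (- (x ^+ 2 / 2)).
Proof.
rewrite /gpdf normal_pdfE ?oner_neq0// /normal_fun; congr (_ * expR _).
by rewrite subr0 mulNr expr1n.
Qed.

Lemma gpdf_ge0 x : 0 <= gpdf x. Proof. exact: normal_pdf_ge0. Qed.

Lemma gpdfN x : gpdf (- x) = gpdf x.
Proof. by rewrite !gpdfE sqrrN. Qed.

Lemma continuous_gpdf : continuous gpdf.
Proof. by apply: continuous_normal_pdf; rewrite oner_neq0. Qed.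

Lemma N01_itv x : N01 `]x, +oo[ = (gtail x)%:E.
Proof. by rewrite /gtail fineK// fin_num_measure. Qed.

Lemma measurable_gpdf (D : set R) : measurable_fun D (EFin \o gpdf).
Proof. by apply/measurable_EFinP; apply: measurable_funTS; exact: measurable_normal_pdf. Qed.

Lemma N01_itvc x : N01 `[x, +oo[ = (gtail x)%:E.
Proof. by rewrite -N01_itv /normal_prob integral_itv_obnd_cbnd//; exact: measurable_gpdf. Qed.

Lemma N01_Ny x : N01 `]-oo, x] = (1 - gtail x)%:E.
Proof.
by rewrite EFinB -N01_itv -setCitvr probability_setC// setCK.
Qed.

Lemma N01_Nyo x : N01 `]-oo, x[ = (1 - gtail x)%:E.
Proof. by rewrite -N01_Ny /normal_prob integral_itv_bndo_bndc//; exact: measurable_gpdf. Qed.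

Lemma gtail_ge0 x : 0 <= gtail x. Proof. exact: fine_ge0. Qed.

Lemma gtail_le1 x : gtail x <= 1.
Proof. by rewrite -lee_fin -N01_itv probability_le1. Qed.

Let cdf x := \int[lebesgue_measure]_(t in `]-oo, x]) (gpdf t).

Lemma gtailE x : gtail x = 1 - cdf x.
Proof.
apply/eqP; rewrite eq_sym subr_eq addrC -subr_eq; apply/eqP.
by rewrite /cdf /Rintegral -[LHS]/(fine (1 - gtail x)%:E) -N01_Ny.
Qed.

Global Instance is_derive_gtail x : is_derive x 1 gtail (- gpdf x).
Proof.
have [d1 d2] : derivable cdf x 1 /\ cdf^`()%classic x = gpdf x.
  apply: (@continuous_FTC1 R gpdf -oo%O x (x + 1)) => //.
  - by rewrite ltrDl.
  - apply: integrableS (integrable_normal_pdf 0 1) => //.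
  - by rewrite ltNyr.
  - exact: continuous_gpdf.
rewrite (_ : gtail = cst 1 - cdf); last by apply/funext => y; rewrite gtailE.
have h : is_derive x 1 cdf (gpdf x).
  by rewrite -d2 derive1E; exact: derivableP.
by apply: is_derive_eq; rewrite sub0r.
Qed.

Lemma gtail_nincr x y : x <= y -> gtail y <= gtail x.
Proof.
move=> xy; apply: (@nincr_of_derive R gtail (fun x => - gpdf x)) => //.
by move=> z _; rewrite oppr_le0 gpdf_ge0.
Qed.

Lemma gtailN x : gtail (- x) = 1 - gtail x.
Proof.
apply/eqP; rewrite eq_sym subr_eq addrC -subr_eq eq_sym; apply/eqP.
apply/EFin_inj; rewrite -N01_Ny -N01_itvc /normal_prob.
rewrite ge0_integration_by_substitutionNy.
- by apply: eq_integral => y _; rewrite /= -!/(gpdf _) gpdfN.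
- by apply: continuous_subspaceT; exact: continuous_gpdf.
- by move=> ? _; exact: gpdf_ge0.
Qed.

Lemma gtail0 : gtail 0 = 1 / 2.
Proof. by have := gtailN 0; rewrite oppr0 => h; lra. Qed.

Let idTR : measurableTypeR R -> R := idfun.

#[local] HB.instance Definition _ :=
  @isMeasurableFun.Build _ _ _ _ idTR (@measurable_id _ _ setT).

Lemma gtail_small e : 0 < e -> exists M, forall x, M <= x -> gtail x <= e.
Proof.
move=> e0.
have /fine_cvgP[_ /cvgrPdist_le/(_ e e0)] := cvg_cdfy1 (idTR : {RV N01 >-> R}).
move=> [M [_ hM]]; exists (M + 1) => x Mx.
have /hM : M < x by lra.
rewrite /= /cdf /distribution/= /pushforward preimage_id N01_Ny/=.
by rewrite opprB addrC subrK ger0_norm ?gtail_ge0.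
Qed.

Lemma normal_peak1_bounds : 1 / 3 <= normal_peak (1 : R) <= 1.
Proof.
have [h1 h2] : 2 <= pi :> R /\ pi <= 4 :> R.
  have /andP[] := @pihalf_02 R; have := @pi_ge2 R; split; lra.
have p2 : 0 < Num.sqrt (pi *+ 2) :> R by rewrite sqrtr_gt0 mulr2n; lra.
have s2 : Num.sqrt (pi *+ 2) ^+ 2 = pi *+ 2 :> R by rewrite sqr_sqrtr// mulr2n; lra.
rewrite div1r /normal_peak expr1n mul1r; apply/andP; split.
  rewrite lef_pV2 ?posrE//; rewrite mulr2n in s2 p2 *; nra.
rewrite invf_le1//; rewrite mulr2n in s2 p2 *; nra.
Qed.

Lemma gpdf_le_expR t : gpdf t <= expR (- (t ^+ 2 / 2)).
Proof.
have /andP[h1 h2] := normal_peak1_bounds.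
by rewrite gpdfE ler_piMl// expR_ge0.
Qed.

Lemma expR_le_gpdf t : expR (- (t ^+ 2 / 2)) <= 3 * gpdf t.
Proof.
have /andP[h1 h2] := normal_peak1_bounds.
have := expR_ge0 (- (t ^+ 2 / 2)); rewrite gpdfE; nra.
Qed.

Lemma gpdf_shift t s : gpdf (t + s) = expR (- (s ^+ 2 / 2) - t * s) * gpdf t.
Proof.
rewrite !gpdfE mulrCA -expRD; by congr (_ * expR _); field.
Qed.

Lemma gpdf_anti x y : 0 <= x -> x <= y -> gpdf y <= gpdf x.
Proof.
move=> x0 xy; have /andP[h1 h2] := normal_peak1_bounds.
rewrite !gpdfE ler_wpM2l//; first by lra.
rewrite ler_expR; nra.
Qed.

Lemma isd_gtail (f : R -> R) x (u : R) : is_derive x 1 f u ->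
  is_derive x 1 (fun y => gtail (f y)) (- gpdf (f x) * u).
Proof. by move=> fu; apply: (isd_comp (is_derive_gtail (f x))). Qed.

Lemma isd_gpdf (f : R -> R) x (u : R) : is_derive x 1 f u ->
  is_derive x 1 (fun y => gpdf (f y)) (- (f x * gpdf (f x)) * u).
Proof.
move=> fu; apply: isd_comp fu.
rewrite (_ : gpdf = fun x => normal_peak 1 * expR (- (x ^+ 2 / 2))); last first.
  by apply/funext => y; rewrite gpdfE.
eapply is_derive_eq; first isd.
by rewrite /= expr1; set e := expR _; field.
Qed.

End GaussTail.

(** Extended now that the derivative of the density, found with the tactic itself,
is available. *)
Ltac isd ::= lazymatch goal with
  | |- is_derive _ _ (fun _ => ?k) _ => exact: (isd_cst k)
  | |- is_derive _ _ (fun y => y) _ => exact: isd_id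
  | |- is_derive _ _ (fun y => @?f y + @?g y) _ => eapply (@isd_add _ f g); [isd|isd]
  | |- is_derive _ _ (fun y => - (@?f y)) _ => eapply (@isd_opp _ f); isd
  | |- is_derive _ _ (fun y => @?f y * @?g y) _ => eapply (@isd_mul _ f g); [isd|isd]
  | |- is_derive _ _ (fun y => (@?f y)^-1) _ => eapply (@isd_inv _ f); [idtac|isd]
  | |- is_derive _ _ (fun y => (@?f y) ^+ ?n) _ => eapply (@isd_exp _ n f); isd
  | |- is_derive _ _ (fun y => expR (@?f y)) _ => eapply (@isd_expR _ f); isd
  | |- is_derive _ _ (fun y => gtail (@?f y)) _ => eapply (@isd_gtail _ f); isd
  | |- is_derive _ _ (fun y => gpdf (@?f y)) _ => eapply (@isd_gpdf _ f); isd
  | |- _ => try eassumption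
  end.

Section GaussTailBounds.
Context {R : realType}.
Implicit Types x t m s z : R.

(** With k = e^{-m^2/2}, the difference k P(N > x) - P(N > x + m) is nonincreasing
in x >= 0, because the density at x + m is k e^{-mx} times the density at x, and
it vanishes at infinity. *)
Lemma gtail_shift m z : 0 <= m -> 0 <= z ->
  gtail (z + m) <= expR (- (m ^+ 2 / 2)) * gtail z.
Proof.
move=> m0 z0; set k := expR _; apply/ler_addgt0Pr => e e0.
(* Both tails are negligible far out, at y below. *)
have [M hM] := gtail_small e0.
pose y := Num.max z M.
have zy : z <= y by rewrite le_max lexx.
have /hM hy : M <= y + m by rewrite (@le_trans _ _ y)// ?le_max ?lexx ?orbT// lerDl.
have h : k * gtail y - gtail (y + m) <= k * gtail z - gtail (z + m).
  pose D x := k * gtail x - gtail (x + m).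
  apply: (@nincr_of_derive R D (fun x => - (k * gpdf x) + gpdf (x + m))) => //.
    move=> x _; rewrite /D.
    eapply is_derive_eq.
      isd.
    by rewrite /= !(mulr0, mul0r, addr0, mulr1, mulrN, mulNr, opprK).
  move=> x /andP[zx _]; rewrite gpdf_shift -/k addrC subr_le0.
  rewrite /k ler_wpM2r ?gpdf_ge0// ler_expR; nra.
have := mulr_ge0 (expR_ge0 (- (m ^+ 2 / 2))) (gtail_ge0 y); rewrite -/k; lra.
Qed.

Lemma gtail_le_expR m : 0 <= m -> gtail m <= expR (- (m ^+ 2 / 2)).
Proof.
move=> m0; have := gtail_shift m0 (lexx 0); rewrite add0r => /le_trans; apply.
by rewrite ler_piMr ?expR_ge0// gtail_le1.
Qed.

Lemma gtail_increment x y : x <= y ->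
  exists2 c, x <= c <= y & gtail x - gtail y = gpdf c * (y - x).
Proof.
move=> xy; have [c hc h] := mvt xy (fun z _ => is_derive_gtail z).
by exists c => //; rewrite -opprB h mulNr opprK.
Qed.

(** On [t - s, t] the density is at most e^{ts} times its value at t. The factor is
harmless as long as ts is bounded, which limits the shifts at level t to the
scale 1/t. *)
Lemma gtail_sub t s : 0 <= t -> 0 <= s ->
  gtail (t - s) <= gtail t + s * expR (t * s) * gpdf t.
Proof.
move=> t0 s0; have [|c /andP[c1 c2] h] := @gtail_increment (t - s) t; first by lra.
suff : gpdf c <= expR (t * s) * gpdf t by move=> ?; nra.
rewrite -{1}(subrK t c) addrC gpdf_shift ler_wpM2r ?gpdf_ge0// ler_expR; nra.
Qed.

Lemma gtail_add t s : 0 <= t -> 0 <= s -> gtail t - s * gpdf t <= gtail (t + s).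
Proof.
move=> t0 s0; have [|c /andP[c1 c2] h] := @gtail_increment t (t + s); first by lra.
have := gpdf_anti t0 c1; nra.
Qed.

(** Mills' ratio: the increment of the tail over a step 1/(2(1+t)), on which the
density keeps a fixed proportion of its value. *)
Lemma gpdf_le_gtail t : 0 <= t -> gpdf t <= 6 * (1 + t) * gtail t.
Proof.
move=> t0; pose s := (2 * (1 + t))^-1.
have s0 : 0 < s by rewrite invr_gt0; lra.
have st : s * (2 * (1 + t)) = 1 by rewrite mulVf//; lra.
have [|c /andP[c1 c2] h] := @gtail_increment t (t + s); first by lra.
have h1 : 3 / 8 * gpdf t <= gpdf c.
  apply: le_trans (gpdf_anti (le_trans t0 c1) c2).
  rewrite gpdf_shift ler_wpM2r ?gpdf_ge0//; apply: le_trans (expR_ge1Dx _); nra.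
have h2 : s * (3 / 8 * gpdf t) <= gtail t by have := gtail_ge0 (t + s); nra.
have : 2 * (1 + t) * (s * (3 / 8 * gpdf t)) <= 2 * (1 + t) * gtail t.
  by rewrite ler_wpM2l//; lra.
rewrite (mulrA _ s) (mulrC _ s) st mul1r; have := gtail_ge0 t; nra.
Qed.

Lemma expR_le_gtail t : 0 <= t -> expR (- (t ^+ 2 / 2)) <= 18 * (1 + t) * gtail t.
Proof. by move=> t0; have := expR_le_gpdf t; have := gpdf_le_gtail t0; lra. Qed.

End GaussTailBounds.

(** * The heat flow issued from a half-line *)

Section Heat.
Context {R : realType}.
Implicit Types t v x y z w s h b K a : R.

(** A function vanishing at 0 is bounded on [-a, a] by a times a bound of its
derivative; iterating this yields Taylor's formula. *)
Lemma increment_bound (f df : R -> R) K a :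
  (forall y, `|y| <= a -> is_derive y 1 f (df y)) ->
  (forall y, `|y| <= a -> `|df y| <= K) -> f 0 = 0 ->
  forall y, `|y| <= a -> `|f y| <= K * a.
Proof.
move=> fdf dfK f0 y ya.
have [h|h] := leP 0 y.
  rewrite ger0_norm// in ya.
  have [|c /andP[c1 c2] e] := @mvt R f df 0 y h.
    by move=> x /andP[x0 xy]; apply: fdf; rewrite ger0_norm//; lra.
  move: e; rewrite f0 !subr0 => ->; rewrite normrM (ger0_norm h).
  have /dfK : `|c| <= a by rewrite ger0_norm//; lra.
  by have := normr_ge0 (df c); nra.
rewrite ltr0_norm// in ya.
have [|c /andP[c1 c2] e] := @mvt R f df y 0 (ltW h).
  by move=> x /andP[x0 xy]; apply: fdf; rewrite ler0_norm//; lra.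
move: e; rewrite f0 sub0r sub0r => e.
rewrite -normrN e normrM (@ger0_norm _ (- y)); last by lra.
have /dfK : `|c| <= a by rewrite ler0_norm//; lra.
by have := normr_ge0 (df c); nra.
Qed.

(** The constant 1 in place of 1/24 is what iterated increments give, and
suffices. *)
Lemma taylor4_bound (f0 f1 f2 f3 f4 : R -> R) w x K :
  (forall y, is_derive y 1 f0 (f1 y)) -> (forall y, is_derive y 1 f1 (f2 y)) ->
  (forall y, is_derive y 1 f2 (f3 y)) -> (forall y, is_derive y 1 f3 (f4 y)) ->
  (forall y, `|y| <= `|x| -> `|f4 (w + y)| <= K) ->
  `|f0 (w + x) - (f0 w + f1 w * x + f2 w * (x ^+ 2 / 2) + f3 w * (x ^+ 3 / 6))|
    <= K * x ^+ 4.
Proof.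
move=> d0 d1 d2 d3 b4.
have sh (f df : R -> R) y : (forall y, is_derive y 1 f (df y)) ->
    is_derive y 1 (fun y => f (w + y)) (df (w + y)).
  move=> fdf; have h := fdf (w + y).
  by eapply is_derive_eq; [apply: (isd_comp h); isd|rewrite add0r mulr1].
pose a := `|x|.
have b3 : forall y, `|y| <= a -> `|f3 (w + y) - f3 w| <= K * a.
  apply: (@increment_bound _ (fun y => f4 (w + y))) => //; last by rewrite addr0 subrr.
  move=> y _; have := sh _ _ y d3 => h.
  by eapply is_derive_eq; [isd|rewrite addr0].
have b2 : forall y, `|y| <= a -> `|f2 (w + y) - f2 w - f3 w * y| <= K * a * a.
  apply: (@increment_bound _ (fun y => f3 (w + y) - f3 w));
    [|exact: b3|by rewrite addr0 mulr0 subr0 subrr].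
  move=> y _; have h := sh _ _ y d2.
  by eapply is_derive_eq; [isd|rewrite /=; ring].
have b1 : forall y, `|y| <= a -> `|f1 (w + y) - f1 w - f2 w * y - f3 w * (y ^+ 2 / 2)| <= K * a * a * a.
  apply: (@increment_bound _ (fun y => f2 (w + y) - f2 w - f3 w * y));
    [|exact: b2|by rewrite /= addr0; field].
  move=> y _; have h := sh _ _ y d1.
  by eapply is_derive_eq; [isd|rewrite /=; field].
have b0 : forall y, `|y| <= a -> `|f0 (w + y) - f0 w - f1 w * y - f2 w * (y ^+ 2 / 2) - f3 w * (y ^+ 3 / 6)| <= K * a * a * a * a.
  apply: (@increment_bound _ (fun y => f1 (w + y) - f1 w - f2 w * y - f3 w * (y ^+ 2 / 2)));
    [|exact: b1|by rewrite /= addr0; field].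
  move=> y _; have h := sh _ _ y d0.
  by eapply is_derive_eq; [isd|rewrite /=; field].
have := b0 x (lexx _).
rewrite !opprD !addrA => /le_trans; apply.
have e : a ^+ 4 = x ^+ 4 by rewrite /a -normrX ger0_norm// exprn_even_ge0.
by rewrite -!mulrA -e !exprS expr0 mulr1.
Qed.

(** The tail P(x + sqrt v N > t): the solution at time v of the heat equation
u_v = u_xx/2 issued from the indicator of the half-line above t. The functions
heat1 to heat4 are its successive derivatives in x. *)
Definition heat t v x := gtail ((t - x) / Num.sqrt v).
Definition heat1 t v x := gpdf ((t - x) / Num.sqrt v) / Num.sqrt v.
Definition heat2 t v x :=
  let z := (t - x) / Num.sqrt v in z * gpdf z / v.
Definition heat3 t v x :=
  let z := (t - x) / Num.sqrt v in (z ^+ 2 - 1) * gpdf z / (v * Num.sqrt v).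
Definition heat4 t v x :=
  let z := (t - x) / Num.sqrt v in (z ^+ 3 - 3 * z) * gpdf z / v ^+ 2.

Lemma is_derive_heat t v x : 0 < v -> is_derive x 1 (heat t v) (heat1 t v x).
Proof.
move=> v0; rewrite /heat /heat1; set r := Num.sqrt v.
have r0 : r != 0 by rewrite gt_eqF// sqrtr_gt0.
by eapply is_derive_eq; [isd|rewrite /=; field].
Qed.

Lemma is_derive_heat1 t v x : 0 < v -> is_derive x 1 (heat1 t v) (heat2 t v x).
Proof.
move=> v0; rewrite /heat1 /heat2; set r := Num.sqrt v.
have r0 : r != 0 by rewrite gt_eqF// sqrtr_gt0.
have -> : v = r ^+ 2 by rewrite sqr_sqrtr// ltW.
by eapply is_derive_eq; [isd|rewrite /=; set g := gpdf _; field].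
Qed.

Lemma is_derive_heat2 t v x : 0 < v -> is_derive x 1 (heat2 t v) (heat3 t v x).
Proof.
move=> v0; rewrite /heat2 /heat3; set r := Num.sqrt v.
have r0 : r != 0 by rewrite gt_eqF// sqrtr_gt0.
have -> : v = r ^+ 2 by rewrite sqr_sqrtr// ltW.
by eapply is_derive_eq; [isd|rewrite /=; set g := gpdf _; field].
Qed.

Lemma is_derive_heat3 t v x : 0 < v -> is_derive x 1 (heat3 t v) (heat4 t v x).
Proof.
move=> v0; rewrite /heat3 /heat4; set r := Num.sqrt v.
have r0 : r != 0 by rewrite gt_eqF// sqrtr_gt0.
have -> : v = r ^+ 2 by rewrite sqr_sqrtr// ltW.
by eapply is_derive_eq; [isd|rewrite /=; set g := gpdf _; field].
Qed.

(** The heat equation; the next lemma is its second derivative in x. Together they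
turn the variance s of an increment into a time s in heat_swap. *)
Lemma is_derive_heat_v t v x : 0 < v ->
  is_derive v 1 (fun v => heat t v x) (heat2 t v x / 2).
Proof.
move=> v0; rewrite /heat /heat2.
have h := is_derive1_sqrt v0.
have r0 : Num.sqrt v != 0 by rewrite gt_eqF// sqrtr_gt0.
eapply is_derive_eq; first (isd; exact: r0).
rewrite /=; set g := gpdf _; move: r0; set r := Num.sqrt v => r0.
have -> : v = r ^+ 2 by rewrite sqr_sqrtr// ltW.
by field.
Qed.

Lemma is_derive_heat2_v t v x : 0 < v ->
  is_derive v 1 (fun v => heat2 t v x) (heat4 t v x / 2).
Proof.
move=> v0; rewrite /heat2 /heat4.
have h := is_derive1_sqrt v0.
have r0 : Num.sqrt v != 0 by rewrite gt_eqF// sqrtr_gt0.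
have v0' : v != 0 by rewrite gt_eqF.
eapply is_derive_eq; first (isd; by []).
rewrite /=; set g := gpdf _; move: r0; set r := Num.sqrt v => r0.
have -> : v = r ^+ 2 by rewrite sqr_sqrtr// ltW.
by field.
Qed.

Lemma expR_ge_quadratic y : 0 <= y -> 1 + y + y ^+ 2 / 4 <= expR y.
Proof.
move=> y0; have -> : expR y = expR (y / 2) ^+ 2.
  by rewrite -expRM_natl; congr expR; field.
have := expR_ge1Dx (y / 2); nra.
Qed.

(** Completing the square: b^2/2 - bz + z^2/2 = (z - b)^2/2, and the cubic
polynomial is absorbed by e^{(z-b)^2/2}. The free parameter b is the tilt; it
will be of the order of the level, so that the exponential on the right
integrates to the right order of magnitude for the tail. *)
Lemma cubic_gauss_bound z b : 0 <= b ->
  `|z ^+ 3 - 3 * z| * gpdf z <= 40 * (1 + b ^+ 3) * expR (b ^+ 2 / 2 - b * z).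
Proof.
move=> b0; set y := z - b.
have -> : expR (b ^+ 2 / 2 - b * z) = expR (y ^+ 2 / 2) * expR (- (z ^+ 2 / 2)).
  by rewrite -expRD; congr expR; rewrite /y; field.
rewrite mulrA; apply: ler_pM => //; [exact: gpdf_ge0| |exact: gpdf_le_expR].
have h : 1 + `|y| ^+ 2 / 2 + (`|y| ^+ 2 / 2) ^+ 2 / 4 <= expR (y ^+ 2 / 2).
  by rewrite -normrX ger0_norm ?sqr_ge0//; apply: expR_ge_quadratic; rewrite divr_ge0 ?sqr_ge0.
apply: (@le_trans _ _ (40 * (1 + b ^+ 3) * (1 + `|y| ^+ 2 / 2 + (`|y| ^+ 2 / 2) ^+ 2 / 4))); last first.
  by apply: ler_wpM2l => //; have := exprn_ge0 3 b0; lra.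
have zb : `|z| <= `|y| + b by rewrite -{1}(subrK b z) (le_trans (ler_normD _ _))// (ger0_norm b0).
apply: (@le_trans _ _ ((`|y| + b) ^+ 3 + 3 * (`|y| + b))).
  apply: le_trans (ler_normB _ _) _; rewrite normrX normrM (ger0_norm (ler0n _ 3)).
  apply: lerD; last lra.
  by apply: lerXn2r; rewrite ?nnegrE ?addr_ge0.
have := b0; have := normr_ge0 y; move: `|y| => a a0 {}b0.
have h1 : (a + b) ^+ 3 <= 4 * (a ^+ 3 + b ^+ 3).
  have : 0 <= (a + b) * (a - b) ^+ 2 by rewrite mulr_ge0 ?sqr_ge0 ?addr_ge0.
  rewrite !exprS expr0; nra.
have h2 : b <= 1 + b ^+ 3.
  have := sqr_ge0 (b - 1); have := sqr_ge0 (b + 1); rewrite !exprS !expr0; nra.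
have h3 : 4 * a ^+ 3 + 3 * a <= 20 * (1 + a ^+ 2 / 2 + (a ^+ 2 / 2) ^+ 2 / 4).
  have := sqr_ge0 (a ^+ 2 - 2 * a); have := sqr_ge0 (a - 1); rewrite !exprS !expr0; nra.
have h4 : 1 <= 1 + a ^+ 2 / 2 + (a ^+ 2 / 2) ^+ 2 / 4.
  have := sqr_ge0 a; have := sqr_ge0 (a ^+ 2); lra.
have b3 := exprn_ge0 3 b0.
move: h1 h2 h3 h4 b3.
move: (_ + _ + _) => q; move: (b ^+ 3) (a ^+ 3) ((a + b) ^+ 3) => B A AB; nra.
Qed.

(** The size of |z^3 - 3z|/v^2 when z is of the order of h sqrt v, the place
where the tilt by h puts the mass. *)
Definition heat4_bound h v := v ^- 2 + h ^+ 3 / Num.sqrt v.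

Lemma heat4_bound_ge0 h v : 0 < v -> 0 <= h -> 0 <= heat4_bound h v.
Proof.
rewrite /heat4_bound => v0 h0; apply: addr_ge0.
  by rewrite invr_ge0 exprn_ge0 ?ltW.
by rewrite divr_ge0 ?exprn_ge0 ?sqrtr_ge0.
Qed.

Lemma heat4_bound_anti h v v' : 0 < v -> 0 <= h -> v <= v' ->
  heat4_bound h v' <= heat4_bound h v.
Proof.
move=> v0 h0 vv'; have v'0 : 0 < v' by lra.
apply: lerD.
  by rewrite lef_pV2 ?posrE ?exprn_gt0//; nra.
rewrite ler_wpM2l ?exprn_ge0// lef_pV2 ?posrE ?sqrtr_gt0//.
exact: ler_wsqrtr.
Qed.

Lemma heat4_le t h v x : 0 < v -> 0 <= h ->
  `|heat4 t v x| <= 40 * expR (h * (x - t) + h ^+ 2 * v / 2) * heat4_bound h v.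
Proof.
move=> v0 h0; rewrite /heat4 /heat4_bound; set r := Num.sqrt v; set z := _ / r.
have r0 : 0 < r by rewrite sqrtr_gt0.
have ve : v = r ^+ 2 by rewrite sqr_sqrtr// ltW.
have := @cubic_gauss_bound z (h * r) (mulr_ge0 h0 (ltW r0)).
rewrite (_ : (h * r) ^+ 2 / 2 - h * r * z = h * (x - t) + h ^+ 2 * v / 2); last first.
  by rewrite ve /z; field; rewrite gt_eqF.
set E := expR _ => hz.
rewrite normrM normfV (@ger0_norm _ (v ^+ 2)) ?sqr_ge0//.
rewrite normrM (@ger0_norm _ (gpdf z)) ?gpdf_ge0//.
rewrite ler_pdivrMr ?exprn_gt0//; apply: le_trans hz _.
rewrite ve le_eqVlt; apply/orP; left; apply/eqP.
by field; rewrite gt_eqF.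
Qed.

(** Replacing an increment x of variance s by heat flow for a time s. The bracket
subtracted on the left integrates to 0 when x has mean 0, variance s and third
moment 0; hence the vanishing of the third moments. *)
Lemma heat_swap t h v s w x : 0 < v -> 0 <= h -> 0 <= s ->
  `|heat t v (w + x) - heat t (v + s) w -
     (heat1 t v w * x + heat2 t v w * ((x ^+ 2 - s) / 2)
      + heat3 t v w * (x ^+ 3 / 6))|
  <= 40 * expR (h * (w - t) + h ^+ 2 * (v + s) / 2) * heat4_bound h v
     * (x ^+ 4 * expR (h * `|x|) + s ^+ 2).
Proof.
move=> v0 h0 s0; set E := expR (h * (w - t) + _); set B := heat4_bound h v.
have B0 : 0 <= B by exact: heat4_bound_ge0.
have E0 : 0 <= E by exact: expR_ge0.
have T1 : `|heat t v (w + x) - (heat t v w + heat1 t v w * x + heat2 t v w * (x ^+ 2 / 2)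
     + heat3 t v w * (x ^+ 3 / 6))| <= 40 * (expR (h * `|x|) * E) * B * x ^+ 4.
  refine (@taylor4_bound (heat t v) _ _ _ _ w x _ (fun y => is_derive_heat t y v0)
    (fun y => is_derive_heat1 t y v0) (fun y => is_derive_heat2 t y v0)
    (fun y => is_derive_heat3 t y v0) _).
  move=> y yx; apply: le_trans (heat4_le _ _ v0 h0) _.
  rewrite ler_wpM2r// ler_wpM2l// /E -expRD ler_expR.
  have : y <= `|x| by rewrite (le_trans _ yx) ?ler_norm.
  have : 0 <= h ^+ 2 * s by rewrite mulr_ge0 ?sqr_ge0.
  nra.
have T2 : `|heat t (v + s) w - heat t v w - heat2 t v w * (s / 2)| <= 40 * E * B * s ^+ 2.
  have D0 y : v <= y <= v + s -> is_derive y 1 (fun v => heat t v w) (heat2 t y w / 2).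
    by move=> /andP[vy _]; apply: is_derive_heat_v; lra.
  have vs : v <= v + s by rewrite lerDl.
  have [c /andP[c1 c2] e] := mvt vs D0.
  have D2 y : v <= y <= c -> is_derive y 1 (fun v => heat2 t v w) (heat4 t y w / 2).
    by move=> /andP[vy _]; apply: is_derive_heat2_v; lra.
  have [c' /andP[c1' c2'] e'] := mvt c1 D2.
  rewrite e (_ : _ - _ = heat4 t c' w * ((c - v) * s / 4)); last first.
    by move/(canRL (subrK _)): e' => ->; field.
  have c'0 : 0 < c' by lra.
  have h4 : `|heat4 t c' w| <= 40 * E * B.
    apply: le_trans (heat4_le _ _ c'0 h0) _; apply: ler_pM => //.
    - exact: heat4_bound_ge0.
    - rewrite ler_wpM2l// ler_expR; have := sqr_ge0 h; nra.
    - exact: heat4_bound_anti.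
  rewrite normrM (@ger0_norm _ (_ / 4)); last by rewrite !mulr_ge0//; lra.
  apply: ler_pM => //; first by rewrite !mulr_ge0//; lra.
  nra.
have -> : heat t v (w + x) - heat t (v + s) w -
     (heat1 t v w * x + heat2 t v w * ((x ^+ 2 - s) / 2)
      + heat3 t v w * (x ^+ 3 / 6)) =
  (heat t v (w + x) - (heat t v w + heat1 t v w * x + heat2 t v w * (x ^+ 2 / 2)
     + heat3 t v w * (x ^+ 3 / 6)))
  - (heat t (v + s) w - heat t v w - heat2 t v w * (s / 2)) by field.
apply: le_trans (ler_normB _ _) _; apply: le_trans (lerD T1 T2) _.
by rewrite le_eqVlt; apply/orP; left; apply/eqP; ring.
Qed.

(** Used for the moment generating function of a step, with the third order term
kept because it integrates to 0. *)
Lemma expR_taylor4 y :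
  expR y <= 1 + y + y ^+ 2 / 2 + y ^+ 3 / 6 + y ^+ 4 * expR `|y|.
Proof.
have d x : is_derive x 1 (@expR R) (expR x) by exact: is_derive_expR.
have : `|expR (0 + y) - (expR 0 + expR 0 * y + expR 0 * (y ^+ 2 / 2) + expR 0 * (y ^+ 3 / 6))|
    <= expR `|y| * y ^+ 4.
  refine (@taylor4_bound _ _ _ _ _ 0 y _ d d d d _) => x xy.
  by rewrite add0r ger0_norm ?expR_ge0// ler_expR (le_trans _ xy)// ler_norm.
by rewrite add0r expR0 !mul1r => /(le_trans (ler_norm _)); lra.
Qed.

End Heat.

(** * Convolutions and one replacement step *)

Section Convolution.
Context {R : realType}.
Local Notation M := (measurableTypeR R).
Implicit Types (mu nu L : probability M R) (f g : R -> R) (t v x w h K : R).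

Definition sum_pair (z : M * M) : M := (z.1 + z.2)%R.

Lemma measurable_sum_pair : measurable_fun [set: M * M] sum_pair.
Proof. by apply: measurable_funD; [exact: measurable_fst|exact: measurable_snd]. Qed.

HB.instance Definition _ :=
  @isMeasurableFun.Build _ _ _ _ sum_pair measurable_sum_pair.

Definition convolve mu nu : probability M R := distribution (mu \x nu)%E sum_pair.

Fixpoint convn (nu : nat -> probability M R) n : probability M R :=
  if n is k.+1 then convolve (convn nu k) (nu k) else \d_(0 : M).

Lemma ge0_integral_conv mu nu (f : M -> \bar R) :
  measurable_fun setT f -> (forall x, 0 <= f x)%E ->
  (\int[convolve mu nu]_z f z = \int[mu]_x \int[nu]_y f (x + y)%R)%E.
Proof.
move=> mf f0; rewrite ge0_integral_distribution//.
rewrite (fubini_tonelli1 (f \o sum_pair))//.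
- by apply: measurableT_comp => //; exact: measurable_sum_pair.
- by move=> z; exact: f0.
Qed.

Lemma integrable_of_le mu f g : measurable_fun [set: M] f ->
  mu.-integrable setT (EFin \o g) -> (forall x, `|f x| <= g x) ->
  mu.-integrable setT (EFin \o f).
Proof.
move=> mf ig fg; apply: le_integrable ig => //; first exact/measurable_EFinP.
by move=> x _; rewrite /= lee_fin (le_trans (fg x))// ler_norm.
Qed.

Lemma integrable_bounded mu f K : measurable_fun [set: M] f ->
  (forall x, `|f x| <= K) -> mu.-integrable setT (EFin \o f).
Proof.
move=> mf fK; apply: integrable_of_le mf _ fK.
by apply: finite_measure_integrable_cst.
Qed.

Lemma integrable_axpy mu f g k :
  mu.-integrable setT (EFin \o f) -> mu.-integrable setT (EFin \o g) ->
  mu.-integrable setT (EFin \o (fun x => f x + k * g x)) /\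
  \int[mu]_x (f x + k * g x) = \int[mu]_x f x + k * \int[mu]_x g x.
Proof.
move=> jf jg; have jkg := integrableZl measurableT k jg; split.
  by have := integrableD measurableT jf jkg; apply: eq_integrable.
by rewrite RintegralD// RintegralZl.
Qed.

Lemma Rintegral_probability_cst mu k : \int[mu]_x k = k.
Proof.
rewrite Rintegral_cst// (_ : fine _ = 1) ?mulr1//.
by rewrite -[RHS]/(fine 1%E); congr fine; exact: probability_setT.
Qed.

Lemma measurable_shift f w : measurable_fun [set: M] f ->
  measurable_fun [set: M] (fun x => f (w + x)).
Proof. by move=> mf; apply: measurableT_comp => //; exact: measurable_funD. Qed.

Lemma Rintegral_conv mu nu f : measurable_fun [set: M] f ->
  (forall x, 0 <= f x <= 1) ->
  \int[convolve mu nu]_z f z = \int[mu]_x \int[nu]_y f (x + y) /\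
  measurable_fun [set: M] (fun x => \int[nu]_y f (x + y)).
Proof.
move=> mf f01.
have h x : (\int[nu]_y (f (x + y))%:E = (\int[nu]_y f (x + y))%:E)%E.
  rewrite fineK//; apply: integrable_fin_num => //.
  apply: (@integrable_bounded _ _ 1); first exact: measurable_shift.
  by move=> y; have /andP[? ?] := f01 (x + y); rewrite ger0_norm.
split.
  rewrite /Rintegral; congr fine; rewrite ge0_integral_conv.
  - by apply: eq_integral => x _; exact: h.
  - exact/measurable_EFinP.
  - by move=> x; rewrite lee_fin; case/andP: (f01 x).
apply/measurable_EFinP.
under [X in measurable_fun _ X]funext => x do rewrite /= -h.
apply: (measurable_fun_fubini_tonelli_F (fun z => (f (sum_pair z))%:E)).
- apply/measurable_EFinP; apply: measurableT_comp => //; exact: measurable_sum_pair.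
- by move=> z; rewrite lee_fin; case/andP: (f01 (sum_pair z)).
Qed.

Lemma integral_conv_expR mu nu h :
  (\int[convolve mu nu]_x (expR (h * x))%:E =
   (\int[mu]_x (expR (h * x))%:E) * (\int[nu]_x (expR (h * x))%:E))%E.
Proof.
have mE : measurable_fun [set: M] (fun x : M => expR (h * x)).
  by apply: measurableT_comp => //; exact: measurable_funM.
rewrite ge0_integral_conv; [|exact/measurable_EFinP|by move=> x; rewrite lee_fin expR_ge0].
under eq_integral => x _.
  under eq_integral => y _ do rewrite mulrDr expRD EFinM.
  rewrite ge0_integralZl//; last exact/measurable_EFinP.
  over.
rewrite ge0_integralZr//; first exact/measurable_EFinP.
by apply: integral_ge0 => x _; rewrite lee_fin expR_ge0.
Qed.

Lemma measurable_heat t v : 0 < v -> measurable_fun [set: M] (heat t v).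
Proof.
move=> v0; apply: continuous_measurable_fun => x.
by apply/differentiable_continuous/derivable1_diffP; have := is_derive_heat t x v0.
Qed.

Lemma heat_itv01 t v x : 0 <= heat t v x <= 1.
Proof. by rewrite gtail_ge0 gtail_le1. Qed.

(** What one replacement uses of the law nu of a step: A bounds the fourth order
remainders under the weight e^{h|x|}. *)
Record step_moments (h : R) nu (s A : R) : Prop := StepMoments {
  step_int1 : nu.-integrable setT (EFin \o (fun x : M => x : R));
  step_int2 : nu.-integrable setT (EFin \o (fun x : M => x ^+ 2));
  step_int3 : nu.-integrable setT (EFin \o (fun x : M => x ^+ 3));
  step_int4 : nu.-integrable setT (EFin \o (fun x : M => x ^+ 4 * expR (h * `|x|)));
  step_mean : \int[nu]_x (x : R) = 0;
  step_var : \int[nu]_x (x ^+ 2) = s;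
  step_skew : \int[nu]_x (x ^+ 3) = 0;
  step_kurt : \int[nu]_x (x ^+ 4 * expR (h * `|x|)) = A
}.

Section Step.
Variables (h : R) (nu : probability M R) (s A : R).
Hypotheses (h0 : 0 <= h) (st : step_moments h nu s A).

Lemma step_var_ge0 : 0 <= s.
Proof. by rewrite -(step_var st); apply: Rintegral_ge0 => x _; exact: sqr_ge0. Qed.

Lemma le_expR_step x : expR (h * x) <=
  1 + h * x + h ^+ 2 / 2 * x ^+ 2 + h ^+ 3 / 6 * x ^+ 3 +
  h ^+ 4 * (x ^+ 4 * expR (h * `|x|)).
Proof.
have := expR_taylor4 (h * x); rewrite normrM (ger0_norm h0); set E := expR (_ * `|x|).
rewrite !exprMn; lra.
Qed.

Lemma step_poly k1 k2 k3 k4 k5 :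
  let p x := k1 + k2 * x + k3 * x ^+ 2 + k4 * x ^+ 3 + k5 * (x ^+ 4 * expR (h * `|x|)) in
  nu.-integrable setT (EFin \o p) /\ \int[nu]_x p x = k1 + k3 * s + k5 * A.
Proof.
have icst : nu.-integrable setT (EFin \o (fun _ : M => k1)).
  exact: finite_measure_integrable_cst.
have [j1 e1] := integrable_axpy k2 icst (step_int1 st).
have [j2 e2] := integrable_axpy k3 j1 (step_int2 st).
have [j3 e3] := integrable_axpy k4 j2 (step_int3 st).
have [j4 e4] := integrable_axpy k5 j3 (step_int4 st).
split; first exact: j4.
rewrite e4 e3 e2 e1 (step_kurt st) (step_skew st) (step_var st) (step_mean st).
by rewrite Rintegral_probability_cst !mulr0 !addr0.
Qed.

(** Lets A absorb the s^2 of the Gaussian side of a replacement. *)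
Lemma step_kurt_ge : s ^+ 2 <= A.
Proof.
have i2 := step_int2 st; have i4 := step_int4 st.
have icst : nu.-integrable setT (EFin \o (fun _ : M => s ^+ 2)).
  exact: finite_measure_integrable_cst.
have [jp ep] := step_poly (s ^+ 2) 0 (- 2 * s) 0 1.
suff : 0 <= s ^+ 2 + - 2 * s * s + 1 * A by rewrite expr2; lra.
rewrite -ep; apply: Rintegral_ge0 => x _.
have e1 : 1 <= expR (h * `|x|) by rewrite -expR0 ler_expR mulr_ge0.
have x4 : 0 <= x ^+ 4 by rewrite exprn_even_ge0.
have := sqr_ge0 (x ^+ 2 - s); have : x ^+ 4 = x ^+ 2 * x ^+ 2 by rewrite -exprD.
by nra.
Qed.

(** As the third moment vanishes, the tilt by h costs e^{h^2 s/2} up to an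
exponent of order h^4. *)
Lemma step_mgf :
  (\int[nu]_x (expR (h * x))%:E <= (expR (h ^+ 2 * s / 2 + h ^+ 4 * A))%:E)%E.
Proof.
have [jp ep] := step_poly 1 h (h ^+ 2 / 2) (h ^+ 3 / 6) (h ^+ 4).
have : (\int[nu]_x (expR (h * x))%:E <= (1 + h ^+ 2 / 2 * s + h ^+ 4 * A)%:E)%E.
  rewrite -ep /Rintegral fineK ?integrable_fin_num//.
  apply: ge0_le_integral => //.
  - apply/measurable_EFinP; apply: measurableT_comp => //; exact: measurable_funM.
  - by case/integrableP: jp.
  - by move=> x _; rewrite lee_fin le_expR_step.
move=> /le_trans; apply; rewrite lee_fin.
by apply: le_trans (expR_ge1Dx _); lra.
Qed.

(** One step of Lindeberg's replacement: the local error carries the weight e^{hw}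
of the position w reached so far, whose mean under L is
at most K. *)
Lemma conv_heat_swap L t v K : 0 < v ->
  (\int[L]_x (expR (h * x))%:E <= K%:E)%E ->
  `|\int[convolve L nu]_x heat t v x - \int[L]_x heat t (v + s) x| <=
  80 * expR (h ^+ 2 * (v + s) / 2 - h * t) * heat4_bound h v * A * K.
Proof.
move=> v0 hK.
have s0 := step_var_ge0; have sA := step_kurt_ge.
have A0 : 0 <= A by apply: le_trans sA; exact: sqr_ge0.
have vs0 : 0 < v + s by lra.
have [-> mG] := Rintegral_conv L nu (measurable_heat t v0) (heat_itv01 t v).
set B := heat4_bound h v; have B0 : 0 <= B by exact: heat4_bound_ge0.
set c := 80 * expR (h ^+ 2 * (v + s) / 2 - h * t) * B * A.
have c0 : 0 <= c by rewrite !mulr_ge0// expR_ge0.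
have int_heat u mu (u0 : 0 < u) : mu.-integrable setT (EFin \o heat t u).
  apply: (@integrable_bounded _ _ 1); first exact: measurable_heat.
  by move=> x; have /andP[? ?] := heat_itv01 t u x; rewrite ger0_norm.
have int_shift w : nu.-integrable setT (EFin \o (fun x => heat t v (w + x))).
  apply: (@integrable_bounded _ _ 1); first by apply: measurable_shift; exact: measurable_heat.
  by move=> x; have /andP[? ?] := heat_itv01 t v (w + x); rewrite ger0_norm.
(* The expansion with respect to the last step, at a fixed position w. *)
have inner w : `|\int[nu]_x heat t v (w + x) - heat t (v + s) w| <= c * expR (h * w).
  have [j1 e1] := step_poly (heat t (v + s) w - heat2 t v w * s / 2) (heat1 t v w)
    (heat2 t v w / 2) (heat3 t v w / 6) 0.
  have -> : heat t (v + s) w = \int[nu]_x (heat t (v + s) w - heat2 t v w * s / 2 + heat1 t v w * x +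
     heat2 t v w / 2 * x ^+ 2 + heat3 t v w / 6 * x ^+ 3 + 0 * (x ^+ 4 * expR (h * `|x|))).
    by rewrite e1; field.
  rewrite -RintegralB//.
  set c1 := 40 * expR (h * (w - t) + h ^+ 2 * (v + s) / 2) * B.
  have [j2 e2] := step_poly (c1 * s ^+ 2) 0 0 0 c1.
  apply: le_trans (le_normr_Rintegral _ _) _ => //.
    by have := integrableB measurableT (int_shift w) j1; apply: eq_integrable.
  apply: (@le_trans _ _ (\int[nu]_x (c1 * s ^+ 2 + 0 * x + 0 * x ^+ 2 + 0 * x ^+ 3 + c1 * (x ^+ 4 * expR (h * `|x|))))).
    apply: le_Rintegral => //.
      have := integrableB measurableT (int_shift w) j1 => /integrable_abse.
      exact: eq_integrable.
    move=> x _; have := heat_swap t w x v0 h0 s0; rewrite -/B -/c1.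
    set u := heat t v (w + x); set u' := heat t (v + s) w.
    rewrite !(mul0r, addr0) => /(le_trans _); rewrite -mulrDr (addrC (s ^+ 2)); apply.
    by rewrite le_eqVlt; apply/orP; left; apply/eqP; congr (`|_|); field.
  rewrite e2 mul0r addr0 -mulrDr.
  have -> : c * expR (h * w) = c1 * (A + A).
    rewrite /c /c1 (_ : h * (w - t) + h ^+ 2 * (v + s) / 2 = (h ^+ 2 * (v + s) / 2 - h * t) + h * w); last by ring.
    by rewrite (expRD (_ - _) (h * w)); ring.
  by rewrite ler_wpM2l ?lerD2r// !mulr_ge0// expR_ge0.
have iE : L.-integrable setT (EFin \o (fun x => expR (h * x))).
  apply/integrableP; split.
    apply/measurable_EFinP; apply: measurableT_comp => //; exact: measurable_funM.
  apply: le_lt_trans (ltry K); apply: le_trans hK.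
  by apply: ge0_le_integral => //; do ?[by move=> x _; rewrite /= ger0_norm ?expR_ge0];
   apply/measurable_EFinP; do ?apply: measurableT_comp => //; exact: measurable_funM.
have iG : L.-integrable setT (EFin \o (fun w => \int[nu]_x heat t v (w + x))).
  apply: (@integrable_bounded _ _ 1) mG _ => w.
  rewrite ger0_norm; last by apply: Rintegral_ge0 => x _; case/andP: (heat_itv01 t v (w + x)).
  have -> : 1 = \int[nu]_x (1 : R) by rewrite Rintegral_probability_cst.
  apply: le_Rintegral => //; first exact: finite_measure_integrable_cst.
  by move=> x _; case/andP: (heat_itv01 t v (w + x)).
rewrite -RintegralB//; last exact: int_heat.
have iD := integrableB measurableT iG (int_heat _ L vs0).
apply: le_trans (le_normr_Rintegral _ iD) _ => //.
apply: (@le_trans _ _ (\int[L]_x (c * expR (h * x)))).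
  apply: le_Rintegral => //.
  - by have := integrable_abse iD; apply: eq_integrable.
  - by have := integrableZl measurableT c iE; apply: eq_integrable.
rewrite RintegralZl// ler_wpM2l//.
by rewrite -lee_fin /Rintegral fineK// integrable_fin_num.
Qed.

End Step.

End Convolution.

(** * Replacing all the steps of a walk *)

Lemma sum_ord_split (V : zmodType) (F : nat -> V) (k n : nat) : (k <= n)%N ->
  \sum_(i < n) F i = \sum_(i < k) F i + \sum_(k <= i < n) F i.
Proof.
move=> kn; rewrite -(big_mkord xpredT F) (big_cat_nat (n := k))//=.
by rewrite big_mkord.
Qed.

Section Walk.
Context {R : realType}.
Local Notation M := (measurableTypeR R).
Variables (n : nat) (nu : nat -> probability M R) (s A : nat -> R) (h : R).
Hypotheses (h0 : 0 <= h)
  (st : forall k, (k < n)%N -> step_moments h (nu k) (s k) (A k)).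

Lemma convn_mgf k : (k <= n)%N ->
  (\int[convn nu k]_x (expR (h * x))%:E <=
   (expR (h ^+ 2 / 2 * (\sum_(i < k) s i) + h ^+ 4 * \sum_(i < k) A i))%:E)%E.
Proof.
elim: k => [_|k IH kn].
  rewrite /= integral_dirac//; last first.
    by apply/measurable_EFinP; apply: measurableT_comp => //; exact: measurable_funM.
  by rewrite diracT mul1e !big_ord0 !mulr0 addr0.
rewrite integral_conv_expR !big_ord_recr /=.
rewrite (_ : h ^+ 2 / 2 * _ + _ = (h ^+ 2 / 2 * (\sum_(i < k) s i) + h ^+ 4 * \sum_(i < k) A i)
  + (h ^+ 2 * s k / 2 + h ^+ 4 * A k)); last by field.
rewrite expRD EFinM; apply: lee_pmul; last 2 first.
- by apply: IH; exact: ltnW.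
- exact: step_mgf (st kn).
- by apply: integral_ge0 => x _; rewrite lee_fin expR_ge0.
- by apply: integral_ge0 => x _; rewrite lee_fin expR_ge0.
Qed.

Lemma Rintegral_convn0 (f : R -> R) : measurable_fun [set: M] f ->
  \int[convn nu 0]_x f x = f 0.
Proof.
move=> mf; rewrite /Rintegral.
rewrite (_ : (\int[convn nu 0]_x (f x)%:E)%E = (f 0)%:E)//.
rewrite /=; rewrite integral_dirac//; first by rewrite diracT mul1e.
exact/measurable_EFinP.
Qed.

Variable e : R.
Hypothesis e0 : 0 < e.

(** The variance still to be replaced after k steps, increased by the smoothing e;
it is the time for which the heat has flowed. *)
Definition rest_var k := e + \sum_(k <= i < n) s i.

Lemma rest_varS k : (k < n)%N -> rest_var k = rest_var k.+1 + s k.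
Proof. by move=> kn; rewrite /rest_var big_ltn// [s k + _]addrC addrA. Qed.

Lemma rest_var_ge k : e <= rest_var k.
Proof.
rewrite /rest_var lerDl big_nat_cond sumr_ge0// => i /andP[/andP[_ /st]] sti _.
exact: step_var_ge0 sti.
Qed.

Lemma rest_var_gt0 k : 0 < rest_var k.
Proof. exact: lt_le_trans (rest_var_ge k). Qed.

(** Telescoping over k the integral of heat t (rest_var k) against the law of the
first k steps, from the Gaussian tail (k = 0) to the smoothed tail of the walk
(k = n). The weights of the past, e^{h^2 (s_0 + .. + s_(k-1))/2}, and of the
future, e^{h^2 rest_var k/2}, multiply to a factor that does not depend on k. *)
Lemma convn_heat_bound t :
  `|\int[convn nu n]_x heat t e x - gtail (t / Num.sqrt (rest_var 0))| <=
  80 * expR (h ^+ 2 * rest_var 0 / 2 + h ^+ 4 * (\sum_(i < n) A i) - h * t) *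
  \sum_(k < n) heat4_bound h (rest_var k.+1) * A k.
Proof.
set Q := expR _.
pose a k := \int[convn nu k]_x heat t (rest_var k) x.
have an : a n = \int[convn nu n]_x heat t e x.
  by rewrite /a (_ : rest_var n = e)// /rest_var big_geq ?addr0.
have a0 : a 0 = gtail (t / Num.sqrt (rest_var 0)).
  rewrite /a Rintegral_convn0; first by rewrite /heat subr0.
  by apply: measurable_heat; exact: rest_var_gt0.
rewrite -an -a0.
have st0 i : (i < n)%N -> 0 <= s i by move=> /st; exact: step_var_ge0.
have A0 i : (i < n)%N -> 0 <= A i.
  by move=> /st /(step_kurt_ge h0); apply: le_trans; exact: sqr_ge0.
have step k : (k < n)%N -> `|a k.+1 - a k| <= 80 * Q * (heat4_bound h (rest_var k.+1) * A k).
  move=> kn; have := conv_heat_swap h0 (st kn) t (rest_var_gt0 k.+1) (convn_mgf (ltnW kn)).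
  rewrite -(rest_varS kn) => /le_trans; apply.
  set E1 := expR _; set E2 := expR _; set B := heat4_bound _ _.
  rewrite (_ : 80 * E1 * B * A k * E2 = 80 * (B * A k) * (E1 * E2)); last by ring.
  rewrite (_ : 80 * Q * (B * A k) = 80 * (B * A k) * Q); last by ring.
  have B0 : 0 <= B by exact: heat4_bound_ge0 (rest_var_gt0 _) h0.
  have c0 : 0 <= 80 * (B * A k) by exact: mulr_ge0 (ler0n _ _) (mulr_ge0 B0 (A0 _ kn)).
  apply: (ler_wpM2l c0).
  rewrite /E1 /E2 -expRD.
  rewrite /Q ler_expR.
  have e1 : \sum_(i < n) A i = \sum_(i < k) A i + \sum_(k <= i < n) A i.
    by apply: sum_ord_split; exact: ltnW.
  have e2 : rest_var 0 = \sum_(i < k) s i + rest_var k.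
    rewrite /rest_var big_mkord (sum_ord_split s (ltnW kn)) addrCA; reflexivity.
  have p1 : 0 <= \sum_(k <= i < n) A i.
    by rewrite big_nat_cond; apply: sumr_ge0 => i /andP[/andP[_ iln] _]; exact: A0.
  rewrite e1.
  rewrite e2.
  rewrite -subr_ge0.
  rewrite [X in 0 <= X](_ : _ = h ^+ 4 * \sum_(k <= i < n) A i); last first.
    by field.
  exact: mulr_ge0 (exprn_ge0 4 h0) p1.
have tele k : (k <= n)%N -> `|a k - a 0| <= 80 * Q * \sum_(i < k) heat4_bound h (rest_var i.+1) * A i.
  elim: k => [_|k IH kn]; first (rewrite subrr normr0 big_ord0 mulr0; exact: lexx).
  rewrite big_ord_recr mulrDr (_ : a k.+1 - a 0 = (a k - a 0) + (a k.+1 - a k)); last by ring.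
  exact: le_trans (ler_normD _ _) (lerD (IH (ltnW kn)) (step k kn)).
exact: (tele n (leqnn n)).
Qed.

End Walk.

(** * Summing the local errors *)

Section WeightedSums.
Context {R : realType}.

(** For s <= e <= V one has s/V^2 <= 2 (1/V - 1/(V+s)), which telescopes. *)
Lemma weight_sq (A s G V lam e : R) : 0 < e -> e <= V -> 0 <= s <= e -> 0 < lam ->
  0 <= G -> A <= lam * s + G / lam ^+ 2 ->
  V ^- 2 * A <= 2 * lam * (V^-1 - (V + s)^-1) + G / (lam ^+ 2 * e ^+ 2).
Proof.
move=> e0 eV /andP[s0 se] l0 G0 hA.
have V0 : 0 < V by exact: lt_le_trans eV.
have V20 : 0 < V ^- 2 by rewrite invr_gt0 exprn_gt0.
apply: (@le_trans _ _ (V ^- 2 * (lam * s + G / lam ^+ 2))).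
  by rewrite ler_pM2l.
rewrite mulrDr; apply: lerD.
  have -> : V^-1 - (V + s)^-1 = s / (V * (V + s)).
    by field; rewrite !gt_eqF//; lra.
  rewrite -subr_ge0.
  have -> : 2 * lam * (s / (V * (V + s))) - V ^- 2 * (lam * s) = lam * s * (V - s) / (V ^+ 2 * (V + s)).
    by field; rewrite !gt_eqF//; lra.
  apply: divr_ge0; first by rewrite !mulr_ge0//; lra.
  by rewrite mulr_ge0 ?exprn_ge0//; lra.
rewrite (_ : G / (lam ^+ 2 * e ^+ 2) = e ^- 2 * (G / lam ^+ 2)); last first.
  by field; rewrite !gt_eqF.
rewrite ler_wpM2r//; first by rewrite divr_ge0 ?exprn_ge0// ltW.
by rewrite lef_pV2 ?posrE ?exprn_gt0//; nra.
Qed.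

(** The bound on A is used with a parameter rho proportional to V^{-1/4}: then
V^{-1/2} rho s is of the order of the increment of V^{1/4}, which telescopes to
a bounded sum, while the term in G loses its dependence on V. *)
Lemma weight_sqrt (A s G V N : R) : 0 < N -> 0 < V -> 0 <= s <= V ->
  (forall rho, 0 < rho -> A <= rho * s + G / rho ^+ 2) ->
  (Num.sqrt V)^-1 * A <=
  16 / N * (Num.sqrt (Num.sqrt (V + s)) - Num.sqrt (Num.sqrt V)) + N ^+ 2 * G.
Proof.
move=> N0 V0 /andP[s0 sV] hA.
set p := Num.sqrt (Num.sqrt (V + s)); set q := Num.sqrt (Num.sqrt V).
have q0 : 0 < q by rewrite !sqrtr_gt0.
have p0 : 0 < p by rewrite !sqrtr_gt0; lra.
have q2 : Num.sqrt V = q ^+ 2 by rewrite sqr_sqrtr ?sqrtr_ge0.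
have q4 : V = q ^+ 4 by rewrite (_ : 4%N = (2 * 2)%N)// exprM -q2 sqr_sqrtr// ltW.
have p4 : V + s = p ^+ 4.
  by rewrite (_ : 4%N = (2 * 2)%N)// exprM sqr_sqrtr ?sqrtr_ge0// sqr_sqrtr//; lra.
have rho0 : 0 < (q * N)^-1 by rewrite invr_gt0 mulr_gt0.
have q20 : 0 <= q ^- 2 by rewrite invr_ge0 exprn_ge0// ltW.
have /(ler_wpM2l q20) := hA _ rho0; rewrite q2 => /le_trans; apply.
have -> : q ^- 2 * ((q * N)^-1 * s + G / (q * N)^-1 ^+ 2) = (s / q ^+ 3) / N + N ^+ 2 * G.
  by field; rewrite !gt_eqF.
rewrite lerD2r (_ : 16 / N * (p - q) = 16 * (p - q) / N); last by ring.
rewrite ler_pM2r ?invr_gt0// ler_pdivrMr ?exprn_gt0//.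
have -> : s = p ^+ 4 - q ^+ 4 by rewrite -p4 -q4; ring.
have qp : q <= p by rewrite !ler_wsqrtr//; lra.
have p2q : p <= 2 * q.
  rewrite -(@ler_pXn2r _ 4) ?nnegrE ?ltW ?mulr_gt0// exprMn -p4 -q4.
  have -> : (2 : R) ^+ 4 = 16 by ring.
  by lra.
have -> : p ^+ 4 - q ^+ 4 = (p - q) * (p ^+ 3 + p ^+ 2 * q + p * q ^+ 2 + q ^+ 3) by ring.
rewrite (_ : 16 * (p - q) * q ^+ 3 = (p - q) * (16 * q ^+ 3)); last by ring.
rewrite ler_wpM2l ?subr_ge0//.
have h2 : p ^+ 2 <= 4 * q ^+ 2 by rewrite expr2; nra.
have h3 : p ^+ 3 <= 8 * q ^+ 3 by rewrite exprS (exprS q); have := exprn_ge0 2 (ltW q0); nra.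
have qq0 := exprn_ge0 2 (ltW q0).
have h4 : p ^+ 2 * q <= 4 * q ^+ 3 by rewrite (exprSr q) ; nra.
have h5 : p * q ^+ 2 <= 2 * q ^+ 3 by rewrite (exprS q 2); nra.
have := exprn_ge0 3 (ltW q0); lra.
Qed.

(** Summation of the local errors of Lindeberg's replacement. The fourth
moments A k are only known by interpolation between the variances s k and the G k, whose sums are controlled; the parts proportional to s k telescope
along the remaining variances V k, for both weights of heat4_bound. *)
Lemma heat4_weight_sum (n : nat) (s A G : nat -> R) (e N C lam h : R) :
  0 < e <= 1 -> 0 < N -> 0 < lam -> 0 <= h ->
  (forall k, (k < n)%N -> [/\ 0 <= s k <= e, 0 <= G k &
     forall rho, 0 < rho -> A k <= rho * s k + G k / rho ^+ 2]) ->
  \sum_(k < n) s k = 1 -> \sum_(k < n) G k <= C / N ^+ 3 ->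
  \sum_(k < n) heat4_bound h (rest_var n s e k.+1) * A k <=
    2 * lam / e + C / (lam ^+ 2 * e ^+ 2 * N ^+ 3) + h ^+ 3 * ((32 + C) / N).
Proof.
move=> /andP[e0 e1] N0 l0 h0 H S1 SG.
pose V k := rest_var n s e k.
have VS k : (k < n)%N -> V k = V k.+1 + s k by exact: rest_varS.
have Ve k : e <= V k.
  rewrite /V /rest_var lerDl big_nat_cond; apply: sumr_ge0 => i /andP[/andP[_ iln] _].
  by have [/andP[]] := H i iln.
have V0 : V 0 = e + 1 by rewrite /V /rest_var big_mkord S1.
have Vn : V n = e by rewrite /V /rest_var big_geq ?addr0.
(* The two potentials whose increments dominate the parts in s k. *)
pose f k := 2 * lam * (V k)^-1 - h ^+ 3 * (16 / N * Num.sqrt (Num.sqrt (V k))).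
pose c := (lam ^+ 2 * e ^+ 2)^-1 + h ^+ 3 * N ^+ 2.
have h30 : 0 <= h ^+ 3 by rewrite exprn_ge0.
have step k : (k < n)%N -> heat4_bound h (V k.+1) * A k <= (f k.+1 - f k) + c * G k.
  move=> kn; have [sk Gk hA] := H k kn.
  have Vk0 : 0 < V k.+1 by exact: lt_le_trans (Ve _).
  have w1 := weight_sq e0 (Ve k.+1) sk l0 Gk (hA _ l0).
  have sk' : 0 <= s k <= V k.+1.
    by case/andP: sk => -> /le_trans -> //; exact: Ve.
  have /(ler_wpM2l h30) w2 := weight_sqrt N0 Vk0 sk' hA.
  rewrite /heat4_bound mulrDl -(mulrA (h ^+ 3)); apply: le_trans (lerD w1 w2) _.
  rewrite -(VS k kn) /f /c le_eqVlt; apply/orP; left; apply/eqP.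
  move: (Num.sqrt _) (Num.sqrt _) => x y; rewrite mulrDl; ring.
apply: (@le_trans _ _ (\sum_(k < n) ((f k.+1 - f k) + c * G k))).
  by apply: ler_sum => k _; exact: step.
rewrite big_split/= -mulr_sumr.
rewrite -(big_mkord xpredT (fun k => f k.+1 - f k)) telescope_sumr//.
have c0 : 0 <= c.
  apply: addr_ge0; last by rewrite mulr_ge0// exprn_ge0// ltW.
  by rewrite invr_ge0 mulr_ge0// exprn_ge0// ltW.
have := ler_wpM2l c0 SG.
have -> : c * (C / N ^+ 3) = C / (lam ^+ 2 * e ^+ 2 * N ^+ 3) + h ^+ 3 * (C / N).
  by rewrite /c; field; rewrite !gt_eqF.
have q0 : Num.sqrt (Num.sqrt (V 0)) <= 2.
  have -> : 2 = Num.sqrt (Num.sqrt ((2 ^+ 2) ^+ 2)) :> R.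
    by rewrite sqrtr_sqr (ger0_norm (sqr_ge0 _)) sqrtr_sqr ger0_norm.
  by rewrite !ler_wsqrtr// V0; lra.
have fn : f n <= 2 * lam / e.
  rewrite /f Vn gerBl mulr_ge0// mulr_ge0 ?sqrtr_ge0// divr_ge0// ltW//.
have f0 : - f 0 <= h ^+ 3 * (32 / N).
  rewrite /f opprB lerBlDr; apply: (@le_trans _ _ (h ^+ 3 * (32 / N))).
    rewrite ler_wpM2l// mulrAC ler_wpM2r ?invr_ge0 ?(ltW N0)//; lra.
  by rewrite lerDl !mulr_ge0 ?invr_ge0 ?(ltW l0)// (le_trans _ (Ve 0))// ltW.
have -> : (32 + C) / N = 32 / N + C / N by rewrite mulrDl.
by lra.
Qed.

Lemma kurtosis_sum (n : nat) (s A G : nat -> R) (N C : R) : 0 < N ->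
  (forall k, (k < n)%N -> forall rho, 0 < rho -> A k <= rho * s k + G k / rho ^+ 2) ->
  \sum_(k < n) s k = 1 -> \sum_(k < n) G k <= C / N ^+ 3 ->
  \sum_(k < n) A k <= (1 + C) / N.
Proof.
move=> N0 hA S1 SG; have iN : 0 < N^-1 by rewrite invr_gt0.
apply: (@le_trans _ _ (\sum_(k < n) (N^-1 * s k + G k / N^-1 ^+ 2))).
  by apply: ler_sum => k _; exact: hA.
rewrite big_split/= -mulr_sumr -mulr_suml S1 mulr1.
have -> : (1 + C) / N = N^-1 + C / N ^+ 3 / N^-1 ^+ 2 by field; rewrite gt_eqF.
by rewrite lerD2l ler_wpM2r// invr_ge0 exprn_ge0// ltW.
Qed.

End WeightedSums.

(** * Steps with a weighted eighth moment *)

Section StepEighth.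
Context {R : realType}.
Local Notation M := (measurableTypeR R).

(** The eighth moment G bounds the fourth one by interpolation with the variance;
the factor 3 comes from x^4 e^{h|x|} = (x^2)^{2/3} (x^8 e^{3h|x|})^{1/3}. *)
Record tame_step (h : R) (nu : probability M R) (s G : R) : Prop := TameStep {
  tame_int2 : nu.-integrable setT (EFin \o (fun x : M => x ^+ 2));
  tame_int8 : nu.-integrable setT (EFin \o (fun x : M => x ^+ 8 * expR (3 * h * `|x|)));
  tame_mean : \int[nu]_x (x : R) = 0;
  tame_var : \int[nu]_x (x ^+ 2) = s;
  tame_skew : \int[nu]_x (x ^+ 3) = 0;
  tame_eighth : \int[nu]_x (x ^+ 8 * expR (3 * h * `|x|)) = G
}.

Definition kurt h (nu : probability M R) : R := \int[nu]_x (x ^+ 4 * expR (h * `|x|)).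

Lemma measurable_monomial_expR (k : nat) (c : R) :
  measurable_fun [set: M] (fun x : M => x ^+ k * expR (c * `|x|)).
Proof.
apply: measurable_funM; first exact: measurable_funX.
by apply: measurableT_comp => //; apply: measurable_funM => //; exact: measurableT_comp.
Qed.

Lemma young (x e rho : R) : 0 < rho -> 0 < e ->
  x ^+ 4 * e <= rho * x ^+ 2 + x ^+ 8 * e ^+ 3 / rho ^+ 2.
Proof.
move=> r0 e0; have y0 : 0 <= x ^+ 2 by exact: sqr_ge0.
have -> : x ^+ 4 = (x ^+ 2) ^+ 2 by rewrite -exprM.
have -> : x ^+ 8 = (x ^+ 2) ^+ 4 by rewrite -exprM.
move: (x ^+ 2) y0 => y y0.
have [h|h] := leP (y * e) rho.
  apply: (@le_trans _ _ (rho * y)); first by rewrite expr2; nra.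
  rewrite lerDl.
  exact: divr_ge0 (mulr_ge0 (exprn_ge0 4 y0) (exprn_ge0 3 (ltW e0))) (exprn_ge0 2 (ltW r0)).
apply: (@le_trans _ _ (y ^+ 4 * e ^+ 3 / rho ^+ 2)); last first.
  by rewrite lerDr mulr_ge0// ltW.
rewrite ler_pdivlMr ?exprn_gt0//.
have -> : y ^+ 4 * e ^+ 3 = (y ^+ 2 * e) * (y * e) ^+ 2 by ring.
rewrite ler_wpM2l ?mulr_ge0 ?exprn_ge0 ?(ltW e0)//.
by rewrite !expr2; nra.
Qed.

Lemma young_sq (x e rho : R) : 0 < rho -> 1 <= e ->
  x ^+ 2 <= rho + x ^+ 8 * e / rho ^+ 3.
Proof.
move=> r0 e1; have y0 : 0 <= x ^+ 2 by exact: sqr_ge0.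
have -> : x ^+ 8 = (x ^+ 2) ^+ 4 by rewrite -exprM.
move: (x ^+ 2) y0 => y y0.
have p0 : 0 <= y ^+ 4 * e / rho ^+ 3.
  have e0 : 0 <= e by lra.
  exact: divr_ge0 (mulr_ge0 (exprn_ge0 4 y0) e0) (exprn_ge0 3 (ltW r0)).
have [h|h] := leP y rho; first by lra.
apply: (@le_trans _ _ (y ^+ 4 * e / rho ^+ 3)); last by lra.
rewrite ler_pdivlMr ?exprn_gt0//.
have h3 : rho ^+ 3 <= y ^+ 3 by apply: lerXn2r; rewrite ?nnegrE//; exact: ltW.
have : 0 <= y ^+ 4 by rewrite exprn_ge0.
have -> : y ^+ 4 = y * y ^+ 3 by rewrite exprS.
nra.
Qed.

Section Tame.
Variables (h : R) (nu : probability M R) (s G : R).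
Hypotheses (h0 : 0 <= h) (st : tame_step h nu s G).

Let e1 (x : R) : 1 <= expR (h * `|x|).
Proof. by rewrite -expR0 ler_expR mulr_ge0. Qed.

Let e3E (x : R) : expR (3 * h * `|x|) = expR (h * `|x|) ^+ 3.
Proof. by rewrite -expRM_natl; congr expR; ring. Qed.

Let int28 (a b : R) :
  nu.-integrable setT (EFin \o (fun x : M => a * x ^+ 2 + b * (x ^+ 8 * expR (3 * h * `|x|)))) /\
  \int[nu]_x (a * x ^+ 2 + b * (x ^+ 8 * expR (3 * h * `|x|))) = a * s + b * G.
Proof.
have ia : nu.-integrable setT (EFin \o (fun x : M => a * x ^+ 2)).
  by have := integrableZl measurableT a (tame_int2 st); apply: eq_integrable.
have [j1 ->] := integrable_axpy b ia (tame_int8 st); split => //.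
by rewrite (tame_eighth st) RintegralZl ?(tame_var st)//; exact: tame_int2 st.
Qed.

Lemma tame_step_moments : step_moments h nu s (kurt h nu).
Proof.
have icst k : nu.-integrable setT (EFin \o (fun _ : M => k)).
  exact: finite_measure_integrable_cst.
have [j11 _] := int28 1 1.
have i4 : nu.-integrable setT (EFin \o (fun x : M => x ^+ 4 * expR (h * `|x|))).
  apply: (integrable_of_le _ j11); first exact: measurable_monomial_expR.
  move=> x; rewrite (ger0_norm (mulr_ge0 (exprn_even_ge0 x (isT : ~~ odd 4)) (expR_ge0 _))).
  by rewrite e3E !mul1r; have := @young x _ 1 ltr01 (expR_gt0 (h * `|x|)); rewrite expr1n divr1 mul1r.
have [j2 _] := integrable_axpy 1 (icst 1) (tame_int2 st).
have [j4 _] := integrable_axpy 1 (tame_int2 st) i4.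
split=> //.
- apply: (integrable_of_le _ j2) => // x.
  by rewrite mul1r; have := sqr_ge0 (`|x| - 1); rewrite sqrrB real_normK ?num_real//; have := sqr_ge0 x; lra.
- exact: tame_int2 st.
- apply: (integrable_of_le _ j4); first exact: measurable_funX.
  move=> x; rewrite mul1r normrX.
  have x2 : x ^+ 2 = `|x| ^+ 2 by rewrite real_normK ?num_real.
  have x4 : x ^+ 4 = `|x| ^+ 4 by rewrite -normrX ger0_norm ?exprn_even_ge0.
  rewrite x2 x4; have := normr_ge0 x; move: `|x| (e1 x) => y; move: (expR _) => E E1 y0.
  have : y ^+ 3 <= y ^+ 2 + y ^+ 4 by have := sqr_ge0 (y - 1); have := sqr_ge0 (y * (y - 1)); rewrite !exprS expr0; nra.
  have : 0 <= y ^+ 4 by rewrite exprn_ge0.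
  nra.
- exact: tame_mean st.
- exact: tame_var st.
- exact: tame_skew st.
Qed.

Lemma tame_young rho : 0 < rho -> kurt h nu <= rho * s + G / rho ^+ 2.
Proof.
move=> r0; have [j e] := int28 rho (rho ^- 2); rewrite (mulrC G) -{}e.
apply: le_Rintegral => //; first exact: step_int4 tame_step_moments.
by move=> x _; rewrite e3E (mulrC (rho ^- 2)); apply: young => //; exact: expR_gt0.
Qed.

Lemma tame_eighth_ge0 : 0 <= G.
Proof.
rewrite -(tame_eighth st); apply: Rintegral_ge0 => x _.
exact: mulr_ge0 (exprn_even_ge0 x (isT : ~~ odd 8)) (expR_ge0 _).
Qed.

(** Controls the largest variance of a step by the sum of the eighth moments. *)
Lemma tame_var_le rho : 0 < rho -> s <= rho + G / rho ^+ 3.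
Proof.
move=> r0.
have icst : nu.-integrable setT (EFin \o (fun _ : M => rho)).
  exact: finite_measure_integrable_cst.
have [j e] := integrable_axpy (rho ^- 3) icst (tame_int8 st).
rewrite -(tame_var st) -(tame_eighth st) (mulrC _ (rho ^- 3)).
rewrite -{1}(Rintegral_probability_cst nu rho) -{}e.
apply: le_Rintegral => //; first exact: tame_int2 st.
move=> x _; rewrite (mulrC (rho ^- 3)); apply: young_sq => //.
by rewrite -expR0 ler_expR !mulr_ge0.
Qed.

End Tame.

(** The replacement bound for a walk of total variance 1, in terms of the sum of
the eighth moments alone. The hypothesis on e^4 makes each variance at most e,
as weight_sq requires. *)
Lemma lindeberg_error (n : nat) (nu : nat -> probability M R) (s G : nat -> R)
    (h e N C lam t : R) :
  0 <= h -> 0 < e <= 1 -> 0 < N -> 0 < lam ->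
  (forall k, (k < n)%N -> tame_step h (nu k) (s k) (G k)) ->
  \sum_(k < n) s k = 1 -> \sum_(k < n) G k <= C / N ^+ 3 ->
  16 * C / N ^+ 3 <= e ^+ 4 ->
  `|\int[convn nu n]_x heat t e x - gtail (t / Num.sqrt (1 + e))| <=
  80 * expR (h ^+ 2 * (1 + e) / 2 + h ^+ 4 * ((1 + C) / N) - h * t) *
  (2 * lam / e + C / (lam ^+ 2 * e ^+ 2 * N ^+ 3) + h ^+ 3 * ((32 + C) / N)).
Proof.
move=> h0 e01 N0 l0 H S1 SG Ce; have /andP[e0 e1] := e01.
have sm k : (k < n)%N -> step_moments h (nu k) (s k) (kurt h (nu k)).
  by move=> /H; exact: tame_step_moments.
have G0 k : (k < n)%N -> 0 <= G k by move=> /H; exact: tame_eighth_ge0.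
have hA k : (k < n)%N -> forall rho, 0 < rho -> kurt h (nu k) <= rho * s k + G k / rho ^+ 2.
  by move=> /H; exact: tame_young.
have se k : (k < n)%N -> 0 <= s k <= e.
  move=> kn; rewrite (step_var_ge0 (sm k kn))/=.
  (* Interpolation at rho = e/2: either half of the bound is at most e/2. *)
  have e20 : 0 < e / 2 by lra.
  apply: le_trans (tame_var_le h0 (H k kn) e20) _.
  have GkS : G k <= \sum_(i < n) G i.
    rewrite (bigD1 (Ordinal kn))//= lerDl; apply: sumr_ge0 => i _; exact: G0.
  have Gk : G k <= e ^+ 4 / 16 by move: Ce; rewrite -mulrA; lra.
  have : G k / (e / 2) ^+ 3 <= e / 2.
    rewrite ler_pdivrMr ?exprn_gt0//; apply: le_trans Gk _.
    by rewrite le_eqVlt; apply/orP; left; apply/eqP; field.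
  lra.
have r0 : rest_var n s e 0 = 1 + e by rewrite /rest_var big_mkord S1 addrC.
have := convn_heat_bound h0 sm e0 t; rewrite r0 => /le_trans; apply.
have W0 := heat4_weight_sum e01 N0 l0 h0 (fun k kn => And3 (se k kn) (G0 k kn) (hA k kn)) S1 SG.
have K0 := kurtosis_sum N0 hA S1 SG.
apply: ler_pM => //.
- apply: sumr_ge0 => k _; apply: mulr_ge0.
    by apply: heat4_bound_ge0 => //; exact: (rest_var_gt0 sm e0).
  by have := step_kurt_ge h0 (sm k (ltn_ord k)); apply: le_trans; exact: sqr_ge0.
rewrite ler_wpM2l// ler_expR lerD2r lerD2l; apply: ler_wpM2l => //.
exact: exprn_ge0.
Qed.

End StepEighth.

(** * From smoothed to sharp tails *)

Section Desmoothing.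
Context {R : realType}.
Local Notation M := (measurableTypeR R).
Implicit Types t x k D : R.

Lemma integrable_indic (L : probability M R) (A : set M) : measurable A ->
  L.-integrable setT (EFin \o (\1_A : M -> R)) /\ \int[L]_x (\1_A x : R) = fine (L A).
Proof.
move=> mA; split.
  apply: (@integrable_bounded _ _ _ 1); first exact: measurable_indic.
  by move=> x; rewrite indicE; case: (_ \in _); rewrite ?normr1 ?normr0.
by rewrite /Rintegral integral_indic// setIT.
Qed.

Lemma integrable_heat (L : probability M R) (e : R) t : 0 < e -> L.-integrable setT (EFin \o heat t e).
Proof.
move=> e0; apply: (@integrable_bounded _ _ _ 1); first exact: measurable_heat.
by move=> x; have /andP[? ?] := heat_itv01 t e x; rewrite ger0_norm.
Qed.

(** Above t the smoothed indicator at the lowered level t - m sqrt e is at least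
P(N > -m). *)
Lemma tail_le_heat (L : probability M R) (e m : R) t : 0 < e -> 0 <= m ->
  (1 - expR (- (m ^+ 2 / 2))) * fine (L `[t, +oo[%classic) <=
  \int[L]_x heat (t - m * Num.sqrt e) e x.
Proof.
move=> e0 m0; set k := expR _; have r0 : 0 < Num.sqrt e by rewrite sqrtr_gt0.
have [j1 <-] := integrable_indic L (measurable_itv `[t, +oo[).
rewrite -RintegralZl//; apply: le_Rintegral => //.
- by have := integrableZl measurableT (1 - k) j1; apply: eq_integrable.
- exact: integrable_heat.
move=> x _; rewrite indicE; case: (boolP (x \in _)) => [|_].
  rewrite inE/= in_itv/= andbT => tx; rewrite mulr1.
  have h : gtail m <= k by exact: gtail_le_expR.
  apply: (@le_trans _ _ (gtail (- m))); first by rewrite gtailN; lra.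
  apply: gtail_nincr; rewrite ler_pdivrMr//; nra.
by rewrite mulr0; case/andP: (heat_itv01 (t - m * Num.sqrt e) e x).
Qed.

(** At or below t the smoothed indicator at the raised level is a factor
e^{-m^2/2} smaller than at level t; keeping this factor relative, and not merely
an additive error P(N > m), is what allows m to depend on eps only. *)
Lemma heat_le_tail (L : probability M R) (e m : R) t : 0 < e -> 0 <= m ->
  \int[L]_x heat (t + m * Num.sqrt e) e x <=
  fine (L `]t, +oo[%classic) + expR (- (m ^+ 2 / 2)) * \int[L]_x heat t e x.
Proof.
move=> e0 m0; set k := expR _; have r0 : 0 < Num.sqrt e by rewrite sqrtr_gt0.
have [j1 <-] := integrable_indic L (measurable_itv `]t, +oo[).
have [j2 <-] := integrable_axpy k j1 (integrable_heat L t e0).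
apply: le_Rintegral => //; first exact: integrable_heat.
move=> x _; rewrite indicE; case: (boolP (x \in _)) => [_|].
  apply: (@le_trans _ _ 1); first by case/andP: (heat_itv01 (t + m * Num.sqrt e) e x).
  by rewrite lerDl mulr_ge0 ?expR_ge0//; case/andP: (heat_itv01 t e x).
rewrite notin_setE/= in_itv/= andbT => /negP; rewrite -leNgt => xt.
rewrite add0r /heat (_ : (t + m * Num.sqrt e - x) / Num.sqrt e = (t - x) / Num.sqrt e + m); last first.
  by field; rewrite gt_eqF.
by apply: gtail_shift => //; rewrite divr_ge0 ?subr_ge0// ltW.
Qed.

(** As sqrt (1 + e) <= 1 + e/2, the added variance e moves the level t by at most
te/2, and in the favourable direction for the raised level. *)
Lemma gtail_heat_shift (e m : R) t : 0 < e -> 0 <= m -> 0 <= t ->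
  gtail ((t - m * Num.sqrt e) / Num.sqrt (1 + e)) <= gtail (t - (m * Num.sqrt e + t * e / 2)) /\
  gtail (t + m * Num.sqrt e) <= gtail ((t + m * Num.sqrt e) / Num.sqrt (1 + e)).
Proof.
move=> e0 m0 t0; have r0 : 0 < Num.sqrt e by rewrite sqrtr_gt0.
set a := m * Num.sqrt e.
have a0 : 0 <= a by rewrite mulr_ge0// ltW.
have p0 : 0 < Num.sqrt (1 + e) by rewrite sqrtr_gt0; lra.
have p2 : Num.sqrt (1 + e) ^+ 2 = 1 + e by rewrite sqr_sqrtr//; lra.
have p1 : 1 <= Num.sqrt (1 + e) by rewrite -[leLHS]sqrtr1 ler_wsqrtr//; lra.
have pe : Num.sqrt (1 + e) <= 1 + e / 2.
  rewrite -(@ler_pXn2r _ 2) ?nnegrE ?(ltW p0)//; last by lra.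
  by rewrite p2; have := sqr_ge0 e; rewrite !expr2; lra.
move: (Num.sqrt (1 + e)) p0 p2 p1 pe => p p0 p2 p1 pe.
split; apply: gtail_nincr; last by rewrite ler_pdivrMr//; nra.
rewrite ler_pdivlMr//.
have q0 : 0 <= t * e / 2 by rewrite divr_ge0// mulr_ge0// ltW.
have q1 : 0 <= t * e / 2 * (p - 1) by rewrite mulr_ge0// subr_ge0.
have [h|h] := leP 0 (t - a).
  have h1 : (t - a) * (p - 1) <= t * (e / 2) by apply: ler_pM => //; lra.
  lra.
have h1 : (t - a) * (p - 1) <= 0 by rewrite mulr_le0_ge0//; lra.
lra.
Qed.

(** The bookkeeping of relative_tail_error. Here g is the Gaussian tail, p and q the
open and closed tails of the walk, am, a0, ap its smoothed tails at the
lowered, central and raised levels, and hm, h0, hp their Gaussian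
counterparts. *)
Lemma tail_arith (g k F D p q am hm a0 h0 ap hp : R) :
  0 <= g -> 0 < k -> k <= 1 / 2 -> 0 <= F -> 0 <= D -> F + D <= 1 -> p <= q ->
  `|am - hm| <= D * g -> hm <= (1 + F) * g ->
  `|a0 - h0| <= D * g -> h0 <= (1 + F) * g ->
  `|ap - hp| <= D * g -> (1 - F) * g <= hp ->
  (1 - k) * q <= am -> ap <= p + k * a0 ->
  `|q - g| <= 4 * (k + F + D) * g /\ `|p - g| <= 4 * (k + F + D) * g.
Proof.
move=> g0 k0 k2 F0 D0 FD pq /ler_normlP[_ H1] u1 /ler_normlP[_ H2] u2 /ler_normlP[H3 _] u3 U Lo.
(* The lower bound on the open tail, the upper one on the closed tail. *)
have Lo' : (1 - F - D) * g - k * ((1 + F + D) * g) <= p.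
  have h : a0 <= (1 + F + D) * g by lra.
  have := ler_wpM2l (ltW k0) h; lra.
have kg : 0 <= k * g by rewrite mulr_ge0// ltW.
have Fg : 0 <= (F + D) * g by rewrite mulr_ge0// addr_ge0.
have kFg : k * (F + D) * g <= k * g.
  by rewrite ler_wpM2r// ler_piMr// ltW.
have hp' : - (4 * (k + F + D) * g) <= p - g by lra.
have hq : q - g <= 4 * (k + F + D) * g.
  suff : (1 - k) * q <= (1 - k) * ((1 + 4 * (k + F + D)) * g).
    by rewrite ler_pM2l; lra.
  apply: (le_trans U).
  have k2g : k * (4 * k * g) <= 1 / 2 * (4 * k * g).
    by rewrite ler_wpM2r//; lra.
  have kFg' : k * (4 * (F + D) * g) <= 1 / 2 * (4 * (F + D) * g).
    by rewrite ler_wpM2r//; lra.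
  lra.
by rewrite !ler_norml; split; apply/andP; split; lra.
Qed.

Lemma gtail_sub_rel t s : 0 <= t -> 0 <= s ->
  gtail (t - s) <= (1 + 6 * s * (1 + t) * expR (t * s)) * gtail t.
Proof.
move=> t0 s0; apply: le_trans (gtail_sub t0 s0) _.
have h : s * expR (t * s) * gpdf t <= s * expR (t * s) * (6 * (1 + t) * gtail t).
  by apply: ler_wpM2l; [rewrite mulr_ge0// expR_ge0|exact: gpdf_le_gtail].
by move: (expR _) h => E h; lra.
Qed.

Lemma gtail_add_rel t s : 0 <= t -> 0 <= s ->
  (1 - 6 * s * (1 + t) * expR (t * s)) * gtail t <= gtail (t + s).
Proof.
move=> t0 s0; apply: le_trans (gtail_add t0 s0).
have h : s * gpdf t <= s * (6 * (1 + t) * gtail t).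
  by apply: ler_wpM2l => //; exact: gpdf_le_gtail.
have E1 : 1 <= expR (t * s) by rewrite -expR0 ler_expR mulr_ge0.
have : 0 <= 6 * s * (1 + t) * gtail t.
  by apply: mulr_ge0; [apply: mulr_ge0; [apply: mulr_ge0|lra]|exact: gtail_ge0].
by move: (expR _) E1 h => E E1 h; nra.
Qed.

(** Sandwiching the tail of L between smoothed tails at the levels t - m sqrt e and
t + m sqrt e. The three errors are the mass k of the smoothing beyond m standard
deviations, the relative change F of the Gaussian tail under the shift, and the
error D on the smoothed tails. *)
Lemma relative_tail_error (L : probability M R) (e m s k F : R) t D :
  0 < e -> 0 <= m -> 0 <= t -> 0 <= D ->
  s = m * Num.sqrt e + t * e / 2 -> k = expR (- (m ^+ 2 / 2)) ->
  F = 6 * s * (1 + t) * expR (t * s) -> k <= 1 / 2 -> F + D <= 1 ->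
  (forall t', `|t' - t| <= m * Num.sqrt e ->
    `|\int[L]_x heat t' e x - gtail (t' / Num.sqrt (1 + e))| <= D * gtail t) ->
  `|fine (L `[t, +oo[%classic) - gtail t| <= 4 * (k + F + D) * gtail t /\
  `|fine (L `]t, +oo[%classic) - gtail t| <= 4 * (k + F + D) * gtail t.
Proof.
move=> e0 m0 t0 D0 sE kE FE k2 FD herr.
have a0 : 0 <= m * Num.sqrt e by rewrite mulr_ge0// sqrtr_ge0.
have te0 : 0 <= t * e / 2 by rewrite divr_ge0// mulr_ge0// ltW.
have s0 : 0 <= s by rewrite sE addr_ge0.
have as_ : m * Num.sqrt e <= s by rewrite sE lerDl.
have F0 : 0 <= F.
  by rewrite FE; apply: mulr_ge0; [apply: mulr_ge0; [exact: mulr_ge0|lra]|exact: expR_ge0].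
have k0 : 0 < k by rewrite kE expR_gt0.
have up1 := gtail_sub_rel t0 s0; have lo1 := gtail_add_rel t0 s0.
rewrite -FE in up1 lo1.
have [h1 h2] := gtail_heat_shift e0 m0 t0.
rewrite -sE in h1.
have d1 : `|t - m * Num.sqrt e - t| <= m * Num.sqrt e.
  by rewrite addrAC subrr add0r normrN ger0_norm.
have d2 : `|t - t| <= m * Num.sqrt e by rewrite subrr normr0.
have d3 : `|t + m * Num.sqrt e - t| <= m * Num.sqrt e.
  by rewrite addrAC subrr add0r ger0_norm.
have mono : fine (L `]t, +oo[%classic) <= fine (L `[t, +oo[%classic).
  apply: fine_le; rewrite ?fin_num_measure//.
  by apply: le_measure; rewrite ?inE//; apply: subset_itvr; rewrite bnd_simp.
have i0 : 0 < (Num.sqrt (1 + e))^-1 by rewrite invr_gt0 sqrtr_gt0 ltr_wpDl.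
have h0 : gtail (t / Num.sqrt (1 + e)) <= (1 + F) * gtail t.
  apply: (le_trans _ up1); apply: (le_trans _ h1); apply: gtail_nincr.
  by rewrite ler_pM2r// gerBl.
have U := tail_le_heat L t e0 m0; have Lo := heat_le_tail L t e0 m0.
rewrite -kE in U Lo.
apply: (tail_arith (gtail_ge0 t) k0 k2 F0 D0 FD mono (herr _ d1) (le_trans h1 up1)
  (herr _ d2) h0 (herr _ d3) _ U Lo).
apply: (le_trans lo1); apply: (le_trans _ h2); apply: gtail_nincr.
by rewrite lerD2l.
Qed.

End Desmoothing.

(** * Moderate deviations *)

Section ModerateDeviation.
Context {R : realType}.
Local Notation M := (measurableTypeR R).

(** The rescaled steps of a walk with N steps of comparable size: then each eighth
moment is of order N^{-4} and their sum of order N^{-3}. Only the sum is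
constrained. The tilt h goes up to T, the highest level at which the tail is
wanted. *)
Definition tame_walk (n : nat) (nu : nat -> probability M R) (N C T : R) : Prop :=
  forall h, 0 <= h <= T -> exists s G : nat -> R,
    [/\ forall k, (k < n)%N -> tame_step h (nu k) (s k) (G k),
        \sum_(k < n) s k = 1 & \sum_(k < n) G k <= C / N ^+ 3].

Lemma expRN_le (x : R) : 0 < x -> expR (- x) <= x^-1.
Proof.
move=> x0; rewrite expRN lef_pV2 ?posrE ?expR_gt0//.
by have := expR_ge1Dx x; lra.
Qed.

(** The parameters, with r^4 the number of steps and a level t at most
2 sqrt eps r. A smoothing of m = 2/eps standard deviations leaves a mass below
eps^2; its width sqrt e = dl/r is such that the shift m sqrt e = eps^2/(2r)
changes the Gaussian tail at t by a factor 1 + O(eps^2); lam makes the first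
error of heat4_weight_sum equal to eps^2/(3r), to be multiplied by 1 + t <= 3r.
The other errors vanish as r grows, or are of order t^4/r^4 = O(eps^2). *)
Lemma parameter_bounds (C eps r t m dl e kap lam s : R) :
  m = 2 / eps -> dl = eps ^+ 3 / 4 -> e = (dl / r) ^+ 2 ->
  kap = dl ^+ 2 * eps ^+ 2 / 6 -> lam = kap / r ^+ 3 ->
  s = m * Num.sqrt e + t * e / 2 ->
  0 <= C -> 0 < eps -> eps <= 1 -> 1 <= r -> 0 <= t ->
  t ^+ 4 <= 16 * eps ^+ 2 * r ^+ 4 -> t <= 2 * r ->
  1 + eps ^- 2 + 16 * C / dl ^+ 8 + 3 * C / (kap ^+ 2 * dl ^+ 4 * eps ^+ 2) <= r ->
  [/\ 0 < e, e <= 1, 0 < m, 0 < lam & 16 * C / (r ^+ 4) ^+ 3 <= e ^+ 4] /\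
  [/\ m * Num.sqrt e = eps ^+ 2 / (2 * r),
      expR (- (m ^+ 2 / 2)) <= eps ^+ 2,
      6 * s * (1 + t) * expR (t * s) <= 18 * expR 2 * eps ^+ 2,
      t ^+ 2 * e / 2 + t ^+ 4 * ((1 + C) / r ^+ 4) + t * (m * Num.sqrt e) <= 18 + 16 * C &
      (1 + t) * (2 * lam / e + C / (lam ^+ 2 * e ^+ 2 * (r ^+ 4) ^+ 3) + t ^+ 3 * ((32 + C) / r ^+ 4))
        <= (2 + 33 * (32 + C)) * eps ^+ 2].
Proof.
move=> mE dlE eE kapE lamE sE C0 eps0 eps1 r1 t0 t4 tr rbig.
have r0 : 0 < r by lra.
have dl0 : 0 < dl by rewrite dlE divr_gt0// exprn_gt0.
have e2 : 0 < eps ^+ 2 by rewrite exprn_gt0.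
have e21 : eps ^+ 2 <= 1 by rewrite exprn_ile1// ltW.
have dle : dl <= eps ^+ 2 / 4 by rewrite dlE exprS ler_pM2r// ler_piMl// ltW.
have kap0 : 0 < kap by rewrite kapE divr_gt0// mulr_gt0// exprn_gt0.
have e0 : 0 < e by rewrite eE exprn_gt0// divr_gt0.
have se : Num.sqrt e = dl / r by rewrite eE sqrtr_sqr ger0_norm// divr_ge0// ltW.
have m0 : 0 < m by rewrite mE divr_gt0.
have lam0 : 0 < lam by rewrite lamE divr_gt0// exprn_gt0.
have mse : m * Num.sqrt e = eps ^+ 2 / (2 * r).
  by rewrite se mE dlE; field; rewrite !gt_eqF.
have p1 : 0 <= eps ^- 2 by rewrite invr_ge0 ltW.
have p2 : 0 <= 16 * C / dl ^+ 8 by rewrite divr_ge0 ?exprn_ge0 ?(ltW dl0)// mulr_ge0.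
have p3 : 0 <= 3 * C / (kap ^+ 2 * dl ^+ 4 * eps ^+ 2).
  exact: divr_ge0 (mulr_ge0 (ler0n _ 3) C0)
    (mulr_ge0 (mulr_ge0 (exprn_ge0 2 (ltW kap0)) (exprn_ge0 4 (ltW dl0))) (ltW e2)).
have r4 : r <= r ^+ 4 by rewrite exprS ler_peMr ?exprn_ege1// ltW.
have r40 : 0 < r ^+ 4 by rewrite exprn_gt0.
split; split => //.
- have q : dl / r <= 1 by rewrite ler_pdivrMr// mul1r; lra.
  have q0 : 0 <= dl / r by exact: divr_ge0 (ltW dl0) (ltW r0).
  by rewrite eE exprn_ile1.
- have -> : e ^+ 4 = dl ^+ 8 / r ^+ 8 by rewrite eE -exprM expr_div_n.
  have -> : 16 * C / (r ^+ 4) ^+ 3 = 16 * C / r ^+ 4 / r ^+ 8 by field; rewrite gt_eqF.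
  rewrite ler_pM2r ?invr_gt0 ?exprn_gt0// ler_pdivrMr//.
  rewrite [leRHS]mulrC -ler_pdivrMr ?exprn_gt0//; lra.
- rewrite (_ : m ^+ 2 / 2 = 2 / eps ^+ 2); last by rewrite mE; field; rewrite gt_eqF.
  apply: le_trans (expRN_le _) _; first by rewrite divr_gt0.
  by rewrite invf_div; lra.
- have sb : s <= eps ^+ 2 / r.
    rewrite sE mse.
    have : t * e / 2 <= eps ^+ 2 / (2 * r).
      rewrite eE expr_div_n.
      have -> : t * (dl ^+ 2 / r ^+ 2) / 2 = (t / (2 * r)) * (dl ^+ 2 / r).
        by field; rewrite gt_eqF.
      have -> : eps ^+ 2 / (2 * r) = 1 * (eps ^+ 2 / 2 / r) by field; rewrite gt_eqF.
      apply: ler_pM.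
      + by rewrite divr_ge0 ?mulr_ge0// ltW.
      + by rewrite divr_ge0 ?exprn_ge0// ltW.
      + by rewrite ler_pdivrMr ?mulr_gt0// mul1r.
      + by rewrite ler_pM2r ?invr_gt0// expr2; nra.
    have -> : eps ^+ 2 / r = eps ^+ 2 / (2 * r) + eps ^+ 2 / (2 * r) by field; rewrite gt_eqF.
    lra.
  have s0 : 0 <= s by rewrite sE addr_ge0 ?mulr_ge0 ?sqrtr_ge0 ?(ltW m0) ?(ltW e0) ?invr_ge0.
  have ts : t * s <= 2.
    apply: (@le_trans _ _ (2 * r * (eps ^+ 2 / r))); first exact: ler_pM.
    have -> : 2 * r * (eps ^+ 2 / r) = 2 * eps ^+ 2 by field; rewrite gt_eqF.
    lra.
  apply: (@le_trans _ _ (6 * (eps ^+ 2 / r) * (3 * r) * expR 2)).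
    apply: ler_pM; [|exact: expR_ge0| |by rewrite ler_expR].
      by rewrite !mulr_ge0//; lra.
    by apply: ler_pM => //; [rewrite mulr_ge0|lra|rewrite ler_wpM2l|lra].
  by rewrite le_eqVlt; apply/orP; left; apply/eqP; field; rewrite gt_eqF.
- have h1 : t ^+ 2 * e / 2 <= 1.
    rewrite eE expr_div_n.
    have -> : t ^+ 2 * (dl ^+ 2 / r ^+ 2) / 2 = (t / (2 * r)) ^+ 2 * (2 * dl ^+ 2).
      by field; rewrite gt_eqF.
    have q1 : (t / (2 * r)) ^+ 2 <= 1.
      by rewrite exprn_ile1 ?divr_ge0 ?mulr_ge0 ?(ltW r0)// ler_pdivrMr ?mulr_gt0// mul1r.
    have q2 : 2 * dl ^+ 2 <= 1 by rewrite expr2; nra.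
    by have := sqr_ge0 (t / (2 * r)); have := sqr_ge0 dl; nra.
  have h2 : t ^+ 4 * ((1 + C) / r ^+ 4) <= 16 + 16 * C.
    rewrite mulrA ler_pdivrMr//.
    have : t ^+ 4 * (1 + C) <= 16 * eps ^+ 2 * r ^+ 4 * (1 + C).
      by rewrite ler_wpM2r//; lra.
    have : eps ^+ 2 * (r ^+ 4 * (1 + C)) <= 1 * (r ^+ 4 * (1 + C)).
      by rewrite ler_wpM2r// mulr_ge0 ?(ltW r40)//; lra.
    lra.
  have h3 : t * (m * Num.sqrt e) <= 1.
    rewrite mse mulrA ler_pdivrMr ?mulr_gt0// mul1r.
    by apply: le_trans tr; rewrite ler_piMr.
  lra.
- have t1 : 1 + t <= 3 * r by lra.
  have h1 : (1 + t) * (2 * lam / e) <= eps ^+ 2.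
    have -> : 2 * lam / e = eps ^+ 2 / (3 * r).
      by rewrite lamE kapE eE; field; rewrite !gt_eqF.
    rewrite mulrA ler_pdivrMr ?mulr_gt0// mulrC ler_wpM2l//; exact: ltW.
  have h2 : (1 + t) * (C / (lam ^+ 2 * e ^+ 2 * (r ^+ 4) ^+ 3)) <= eps ^+ 2.
    have -> : C / (lam ^+ 2 * e ^+ 2 * (r ^+ 4) ^+ 3) = C / (kap ^+ 2 * dl ^+ 4) / r ^+ 2.
      by rewrite lamE eE; field; rewrite !gt_eqF.
    apply: (@le_trans _ _ (3 * r * (C / (kap ^+ 2 * dl ^+ 4) / r ^+ 2))).
      apply: ler_wpM2r => //; apply: divr_ge0; last exact: exprn_ge0 (ltW r0).
      by apply: divr_ge0 => //; apply: mulr_ge0; apply: exprn_ge0; exact: ltW.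
    have -> : 3 * r * (C / (kap ^+ 2 * dl ^+ 4) / r ^+ 2) =
        eps ^+ 2 * (3 * C / (kap ^+ 2 * dl ^+ 4 * eps ^+ 2)) / r.
      by field; rewrite !gt_eqF.
    rewrite ler_pdivrMr// ler_wpM2l ?(ltW e2)//; lra.
  have h3 : (1 + t) * (t ^+ 3 * ((32 + C) / r ^+ 4)) <= 33 * (32 + C) * eps ^+ 2.
    rewrite !mulrA ler_pdivrMr//.
    have q1 : (1 + t) * t ^+ 3 <= 1 + 2 * t ^+ 4.
      have -> : t ^+ 4 = t * t ^+ 3 by rewrite exprS.
      have [h|h] := leP t 1.
        have : t ^+ 3 <= 1 by rewrite exprn_ile1.
        have : 0 <= t * t ^+ 3 by rewrite mulr_ge0// exprn_ge0.
        lra.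
      have : t ^+ 3 <= t * t ^+ 3 by rewrite ler_peMl ?exprn_ge0// ltW.
      lra.
    have q2 : 1 <= eps ^+ 2 * r ^+ 4.
      apply: (@le_trans _ _ (eps ^+ 2 * eps ^- 2)); first by rewrite mulfV// gt_eqF.
      rewrite ler_wpM2l ?(ltW e2)//; lra.
    apply: (@le_trans _ _ ((1 + 2 * t ^+ 4) * (32 + C))).
      by rewrite ler_wpM2r//; lra.
    apply: (@le_trans _ _ (33 * (eps ^+ 2 * r ^+ 4) * (32 + C))).
      by rewrite ler_wpM2r//; lra.
    by rewrite le_eqVlt; apply/orP; left; apply/eqP; ring.
  lra.
Qed.

(** Let N = r^4. The tilt h is the level t itself: the replacement error then carries
e^{t^2/2 - t^2} = e^{-t^2/2}, which is at most 18 (1 + t) times the Gaussian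
tail. Levels up to order N^{1/4} are reached because the third moments vanish:
the exponent t^4/N left over is of order eps^2. *)
Lemma moderate_deviation (C : R) : 0 <= C ->
  exists2 K, 1 <= K & forall eps, 0 < eps -> K * eps ^+ 2 <= 1 ->
  exists r0, forall n nu r, r0 <= r ->
    tame_walk n nu (r ^+ 4) C (2 * Num.sqrt eps * r) ->
    forall t, 0 <= t <= 2 * Num.sqrt eps * r ->
      `|fine (convn nu n `[t, +oo[%classic) - gtail t| <= K * eps ^+ 2 * gtail t /\
      `|fine (convn nu n `]t, +oo[%classic) - gtail t| <= K * eps ^+ 2 * gtail t.
Proof.
move=> C0.
have [KF KFE KF0] : exists2 KF : R, KF = 18 * expR 2 & 0 <= KF.
  by exists (18 * expR 2) => //; exact: mulr_ge0 (ler0n _ 18) (expR_ge0 _).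
have [KD KDE KD0] : exists2 KD : R,
    KD = 1440 * expR (18 + 16 * C) * (2 + 33 * (32 + C)) & 0 <= KD.
  eexists; first by [].
  by apply: mulr_ge0; [exact: mulr_ge0 (ler0n _ 1440) (expR_ge0 _)|lra].
(* The mass of the smoothing contributes 1, the shift of the level KF and the
   replacement error KD. *)
exists (4 * (1 + KF + KD)); first by lra.
move=> eps eps0 Keps.
have e20 : 0 < eps ^+ 2 by rewrite exprn_gt0.
have p1 := mulr_ge0 KF0 (ltW e20); have p2 := mulr_ge0 KD0 (ltW e20).
have eps1 : eps <= 1.
  rewrite -(@ler_pXn2r _ 2) ?nnegrE ?(ltW eps0)// expr1n; lra.
have [m mE] : exists m, m = 2 / eps by exists (2 / eps).
have [dl dlE] : exists dl, dl = eps ^+ 3 / 4 by exists (eps ^+ 3 / 4).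
have [kap kapE] : exists kap, kap = dl ^+ 2 * eps ^+ 2 / 6 by exists (dl ^+ 2 * eps ^+ 2 / 6).
exists (1 + (1 + eps ^- 2 + 16 * C / dl ^+ 8 + 3 * C / (kap ^+ 2 * dl ^+ 4 * eps ^+ 2))).
move=> n nu r rbig walk t t0T; have /andP[t0 tT] := t0T.
have q0 : 0 <= 1 + eps ^- 2 + 16 * C / dl ^+ 8 + 3 * C / (kap ^+ 2 * dl ^+ 4 * eps ^+ 2).
  apply: addr_ge0; [apply: addr_ge0; [apply: addr_ge0 => //|]|].
  - by rewrite invr_ge0 ltW.
  - by apply: divr_ge0; [exact: mulr_ge0 (ler0n _ 16) C0|rewrite dlE; apply/exprn_ge0/divr_ge0 => //; exact: exprn_ge0 (ltW eps0)].
  - apply: divr_ge0; first exact: mulr_ge0 (ler0n _ 3) C0.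
    by apply: mulr_ge0; [apply: mulr_ge0; exact: exprn_even_ge0|exact: ltW].
have r1 : 1 <= r by lra.
have r0 : 0 < r by lra.
have se1 : Num.sqrt eps <= 1 by rewrite -[leRHS]sqrtr1 ler_wsqrtr.
have t4 : t ^+ 4 <= 16 * eps ^+ 2 * r ^+ 4.
  have -> : 16 * eps ^+ 2 * r ^+ 4 = (2 * Num.sqrt eps * r) ^+ 4.
    rewrite !exprMn (_ : Num.sqrt eps ^+ 4 = eps ^+ 2); last first.
      by rewrite (_ : 4%N = (2 * 2)%N)// exprM sqr_sqrtr// ltW.
    by ring.
  by apply: lerXn2r; rewrite ?nnegrE//; apply: le_trans tT.
have tr : t <= 2 * r.
  apply: le_trans tT _; rewrite ler_wpM2r ?(ltW r0)//; lra.
have [e eE] : exists e, e = (dl / r) ^+ 2 by exists ((dl / r) ^+ 2).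
have [lam lamE] : exists lam, lam = kap / r ^+ 3 by exists (kap / r ^+ 3).
have [s sE] : exists s, s = m * Num.sqrt e + t * e / 2 by exists (m * Num.sqrt e + t * e / 2).
have rbig' : 1 + eps ^- 2 + 16 * C / dl ^+ 8 + 3 * C / (kap ^+ 2 * dl ^+ 4 * eps ^+ 2) <= r.
  by apply: le_trans rbig; rewrite lerDr.
have [[e0 e1 m0 lam0 Ce] [mse hk hF hX hW]] :=
  parameter_bounds mE dlE eE kapE lamE sE C0 eps0 eps1 r1 t0 t4 tr rbig'.
have [sg [G [H S1 SG]]] := walk t t0T.
have N0 : 0 < r ^+ 4 by rewrite exprn_gt0.
have e01 : 0 < e <= 1 by rewrite e0.
have [k kE] : exists k, k = expR (- (m ^+ 2 / 2)) by eexists.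
have [F FE] : exists F, F = 6 * s * (1 + t) * expR (t * s) by eexists.
rewrite -kE in hk; rewrite -FE -KFE in hF.
have [W WE] : exists W, W = 2 * lam / e + C / (lam ^+ 2 * e ^+ 2 * (r ^+ 4) ^+ 3) + t ^+ 3 * ((32 + C) / r ^+ 4) by eexists.
rewrite -WE in hW.
have W0 : 0 <= W.
  rewrite WE; apply: addr_ge0; [apply: addr_ge0|].
  - by apply: divr_ge0; [apply: mulr_ge0 => //|]; exact: ltW.
  - apply: divr_ge0 => //; apply: mulr_ge0; [apply: mulr_ge0|]; apply: exprn_ge0 => //; exact: ltW.
  - by apply: mulr_ge0; [exact: exprn_ge0|apply: divr_ge0; [lra|exact: ltW]].
have g0 := gtail_ge0 t.
have herr t' : `|t' - t| <= m * Num.sqrt e ->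
    `|\int[convn nu n]_x heat t' e x - gtail (t' / Num.sqrt (1 + e))| <= KD * eps ^+ 2 * gtail t.
  move=> tt'; apply: (le_trans (lindeberg_error t' t0 e01 N0 lam0 H S1 SG Ce)).
  rewrite -WE.
  have hE : expR (t ^+ 2 * (1 + e) / 2 + t ^+ 4 * ((1 + C) / r ^+ 4) - t * t') <=
      expR (18 + 16 * C) * (18 * (1 + t) * gtail t).
    apply: (@le_trans _ _ (expR (18 + 16 * C) * expR (- (t ^+ 2 / 2)))).
      rewrite -expRD ler_expR.
      have : t * (t - t') <= t * (m * Num.sqrt e).
        apply: ler_wpM2l => //; apply: le_trans tt'.
        by rewrite distrC; exact: ler_norm.
      lra.
    by apply: ler_wpM2l; [exact: expR_ge0|exact: expR_le_gtail].
  have := ler_wpM2r (mulr_ge0 (ler0n _ 80) W0) hE.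
  have := ler_wpM2l (mulr_ge0 (mulr_ge0 (ler0n _ 1440) (expR_ge0 (18 + 16 * C))) g0) hW.
  rewrite KDE; move: (expR _) (expR _) => E2 E1 h1 h2.
  apply: (@le_trans _ _ (1440 * E1 * gtail t * ((1 + t) * W))); last first.
    by apply: le_trans h1 _; rewrite le_eqVlt; apply/orP; left; apply/eqP; ring.
  apply: le_trans (_ : E2 * (80 * W) <= _); first by rewrite le_eqVlt; apply/orP; left; apply/eqP; ring.
  by apply: le_trans h2 _; rewrite le_eqVlt; apply/orP; left; apply/eqP; ring.
have D0 : 0 <= KD * eps ^+ 2 by [].
have k2 : k <= 1 / 2 by lra.
have FD : F + KD * eps ^+ 2 <= 1 by lra.
have [A1 A2] := relative_tail_error e0 (ltW m0) t0 D0 sE kE FE k2 FD herr.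
have fin : 4 * (k + F + KD * eps ^+ 2) * gtail t <= 4 * (1 + KF + KD) * eps ^+ 2 * gtail t.
  by rewrite ler_wpM2r//; lra.
by split; [exact: le_trans A1 fin|exact: le_trans A2 fin].
Qed.

End ModerateDeviation.

(** * Products of probabilities *)

Section Products.
Context {R : realType}.

(** The condition 1 <= 2 g_j makes up for the factor missing in each term of the
telescoping sum. *)
Lemma prod_telescope (n : nat) (u w g : 'I_n -> R) :
  (forall j, [/\ 0 <= u j, u j <= g j, 0 <= w j, w j <= g j & 1 <= 2 * g j]) ->
  `|\prod_j u j - \prod_j w j| <= 2 * (\prod_j g j) * \sum_j `|u j - w j|.
Proof.
elim: n u w g => [|n IH] u w g H.
  by rewrite !big_ord0 subrr normr0 mulr0.
rewrite !big_ord_recl/=.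
have [u0 ug w0 wg g1] := H ord0.
have /IH {IH} : forall j : 'I_n, [/\ 0 <= u (lift ord0 j), u (lift ord0 j) <= g (lift ord0 j),
  0 <= w (lift ord0 j), w (lift ord0 j) <= g (lift ord0 j) & 1 <= 2 * g (lift ord0 j)].
  by move=> j; exact: H.
have WG : \prod_(i < n) w (lift ord0 i) <= \prod_(i < n) g (lift ord0 i).
  by apply: ler_prod => i _; have [_ _ -> ->] := H (lift ord0 i).
have W0 : 0 <= \prod_(i < n) w (lift ord0 i).
  by apply: prodr_ge0 => i _; have [] := H (lift ord0 i).
have S0 : 0 <= \sum_(i < n) `|u (lift ord0 i) - w (lift ord0 i)|.
  by apply: sumr_ge0.
move: WG W0 S0; move: (\prod_(i < n) u _) (\prod_(i < n) w _) (\prod_(i < n) g _) (\sum_(i < n) _) => U W G S WG W0 S0 IH.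
rewrite (_ : u ord0 * U - w ord0 * W = u ord0 * (U - W) + (u ord0 - w ord0) * W); last by ring.
apply: le_trans (ler_normD _ _) _; rewrite !normrM (ger0_norm u0) (ger0_norm W0).
have G0 : 0 <= G by exact: le_trans WG.
have g00 : 0 <= g ord0 by exact: le_trans ug.
have h1 : u ord0 * `|U - W| <= g ord0 * (2 * G * S) by apply: ler_pM.
have h2 : `|u ord0 - w ord0| * W <= `|u ord0 - w ord0| * (2 * g ord0 * G).
  by apply: ler_wpM2l => //; apply: (le_trans WG); rewrite ler_peMl.
lra.
Qed.

(** Both products are at most e^{-S/2 + nz}, with S the sum of the 1 - w_j, while
the sum of the |u_j - w_j| is at most dlt S + nz. As S e^{-S/2} is bounded,
the number of factors enters through nz only. *)
Lemma prod_compare (n : nat) (u w : 'I_n -> R) (dlt z : R) :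
  0 <= dlt -> dlt <= 1 / 2 -> 0 <= z -> n%:R * z <= 1 / 2 ->
  (forall j, [/\ 0 <= u j <= 1, 0 <= w j <= 1 & `|u j - w j| <= dlt * (1 - w j) + z]) ->
  `|\prod_j u j - \prod_j w j| <= 4 * (2 * dlt + n%:R * z).
Proof.
move=> d0 d2 z0 nz H.
(* As dlt <= 1/2, both u_j and w_j are at most 1 - (1 - w_j)/2 + z. *)
pose g j := expR (- ((1 - w j) / 2) + z).
have gE j : [/\ 0 <= u j, u j <= g j, 0 <= w j, w j <= g j & 1 <= 2 * g j].
  have [/andP[u0 u1] /andP[w0 w1] /ler_normlP[_ h]] := H j.
  have h1 := expR_ge1Dx (- ((1 - w j) / 2) + z).
  have dw : dlt * (1 - w j) <= 1 / 2 * (1 - w j) by rewrite ler_wpM2r//; lra.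
  by split=> //; rewrite /g; lra.
have gP : \prod_j g j = expR (- ((\sum_j (1 - w j)) / 2) + n%:R * z).
  rewrite /g -expR_sum big_split/= sumrN -mulr_suml; congr (expR (_ + _)).
  by rewrite sumr_const card_ord mulr_natl.
have w0 : 0 <= \sum_j (1 - w j).
  by apply: sumr_ge0 => j _; have [_ /andP[_ ?] _] := H j; rewrite subr_ge0.
have sumle : \sum_j `|u j - w j| <= dlt * (\sum_j (1 - w j)) + n%:R * z.
  apply: (@le_trans _ _ (\sum_j (dlt * (1 - w j) + z))).
    by apply: ler_sum => j _; have [] := H j.
  by rewrite big_split/= -mulr_sumr sumr_const card_ord mulr_natl.
apply: le_trans (prod_telescope gE) _; rewrite gP expRD.
move: (\sum_j (1 - w j)) (\sum_j `|u j - w j|) w0 sumle => S V S0 VS.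
have nz0 : 0 <= n%:R * z by rewrite mulr_ge0.
move: (n%:R * z) nz nz0 VS => y y2 y0 VS.
have ey : expR y <= 2.
  have : expR (- y) >= 1 / 2 by have := expR_ge1Dx (- y); lra.
  have : expR y * expR (- y) = 1 by rewrite -expRD subrr expR0.
  have := expR_gt0 y; nra.
have eS : expR (- (S / 2)) * S <= 2.
  have : expR (- (S / 2)) * expR (S / 2) = 1 by rewrite -expRD addNr expR0.
  have := expR_ge1Dx (S / 2); have := expR_gt0 (- (S / 2)); nra.
have e1 : expR (- (S / 2)) <= 1 by rewrite -expR0 ler_expR oppr_le0 divr_ge0.
have e0 := expR_ge0 (- (S / 2)); have ey0 := expR_ge0 y.
move: (expR (- _)) (expR y) ey eS e1 e0 ey0 => E Y Y2 ES E1 E0 Y0.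
apply: (@le_trans _ _ (2 * (E * Y) * (dlt * S + y))).
  by apply: ler_wpM2l => //; apply: mulr_ge0 => //; exact: mulr_ge0.
have h : E * (dlt * S + y) <= 2 * dlt + y.
  have := ler_wpM2l d0 ES; have : E * y <= y by rewrite ler_piMl.
  lra.
have h0 : 0 <= E * (dlt * S + y) by rewrite mulr_ge0// addr_ge0// mulr_ge0.
rewrite (_ : 2 * (E * Y) * (dlt * S + y) = 2 * (Y * (E * (dlt * S + y)))); last by ring.
have : Y * (E * (dlt * S + y)) <= 2 * (2 * dlt + y) by apply: ler_pM.
lra.
Qed.

End Products.

(** * Lower tails and intervals *)

Section Reflection.
Context {R : realType}.
Local Notation M := (measurableTypeR R).
Implicit Types (mu nu L : probability M R).

Definition negate (x : M) : M := - x.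

Lemma measurable_negate : measurable_fun [set: M] negate.
Proof. exact: oppr_measurable. Qed.

HB.instance Definition _ := @isMeasurableFun.Build _ _ _ _ negate measurable_negate.

Definition reflect nu : probability M R := distribution nu negate.

Lemma ge0_integral_reflect nu (f : M -> \bar R) : measurable_fun setT f ->
  (forall x, 0 <= f x)%E -> (\int[reflect nu]_x f x = \int[nu]_x f (- x)%R)%E.
Proof. by move=> mf f0; rewrite ge0_integral_distribution. Qed.

Lemma integral_convn_reflect (nu : nat -> probability M R) n (f : M -> \bar R) :
  measurable_fun setT f -> (forall x, 0 <= f x)%E ->
  (\int[convn (fun k => reflect (nu k)) n]_x f x = \int[convn nu n]_x f (- x)%R)%E.
Proof.
elim: n f => [|n IH] f mf f0.
  rewrite /= !integral_dirac//; first by rewrite oppr0.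
  by apply: measurableT_comp => //; exact: measurable_negate.
have mfn : measurable_fun [set: M] (fun x : M => f (- x)).
  exact: (measurableT_comp mf measurable_negate).
have mfx x : measurable_fun [set: M] (fun y : M => f (x + y)).
  by apply: measurableT_comp => //; exact: measurable_funD.
rewrite /= !ge0_integral_conv//.
rewrite (eq_integral (fun x : M => \int[nu n]_y f (x - y)%R)%E); last first.
  by move=> x _; rewrite (ge0_integral_reflect _ (mfx x)).
rewrite IH.
- apply: eq_integral => x _; apply: eq_integral => y _.
  by rewrite opprD.
- apply: (measurable_fun_fubini_tonelli_F (fun z : M * M => f (z.1 - z.2)%R)).
  + apply: measurableT_comp => //; apply: measurable_funB.
      exact: measurable_fst.
    exact: measurable_snd.
  + by move=> z; exact: f0.
- by move=> x; apply: integral_ge0.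
Qed.

(** Lower tails of a walk are upper tails of the reflected walk. *)
Lemma convn_reflect (nu : nat -> probability M R) n (A : set M) : measurable A ->
  convn (fun k => reflect (nu k)) n A = convn nu n (negate @^-1` A).
Proof.
move=> mA; have mI : measurable_fun [set: M] (fun x : M => (\1_A x)%:E : \bar R).
  by apply/measurable_EFinP; exact: measurable_indic.
have := integral_convn_reflect nu n mI (fun x => _).
rewrite integral_indic// setIT => -> //.
have mnA : measurable (negate @^-1` A).
  by rewrite -[X in measurable X]setTI; exact: measurable_negate.
transitivity (\int[convn nu n]_x (\1_(negate @^-1` A) x)%:E)%E.
  by apply: eq_integral => x _; rewrite !indicE.
by rewrite integral_indic// setIT.
Qed.

Lemma reflect_rintegral nu (f : R -> R) : measurable_fun [set: M] f ->
  nu.-integrable setT (EFin \o (fun x : M => f (- x))) ->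
  (reflect nu).-integrable setT (EFin \o f) /\
  \int[reflect nu]_x f x = \int[nu]_x f (- x).
Proof.
move=> mf intf; have mEf : measurable_fun [set: M] (EFin \o f) by exact/measurable_EFinP.
split; first by apply: (integrable_pushforward measurable_negate mEf).
by rewrite /Rintegral /reflect integral_distribution.
Qed.

Lemma tame_step_reflect h nu s G : 0 <= h ->
  tame_step h nu s G -> tame_step h (reflect nu) s G.
Proof.
move=> h0 st; have sm := tame_step_moments h0 st.
have e8 (x : R) : (- x) ^+ 8 = x ^+ 8 by rewrite (_ : 8%N = (2 * 4)%N)// !exprM sqrrN.
have R2 := @reflect_rintegral nu (fun x => x ^+ 2) (measurable_funX 2 (@measurable_id _ _ setT)).
have R1 := @reflect_rintegral nu (fun x => x) (@measurable_id _ _ setT).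
have R3 := @reflect_rintegral nu (fun x => x ^+ 3) (measurable_funX 3 (@measurable_id _ _ setT)).
have R8 := @reflect_rintegral nu (fun x => x ^+ 8 * expR (3 * h * `|x|))
  (measurable_monomial_expR 8 (3 * h)).
have [i2 E2] : (reflect nu).-integrable setT (EFin \o (fun x : M => x ^+ 2)) /\
  \int[reflect nu]_x x ^+ 2 = s.
  have [|i ->] := R2; first by apply: eq_integrable (tame_int2 st) => // x _; rewrite /= sqrrN.
  by split=> //; rewrite -(tame_var st); apply: eq_Rintegral => x _; rewrite sqrrN.
have [i8 E8] : (reflect nu).-integrable setT (EFin \o (fun x : M => x ^+ 8 * expR (3 * h * `|x|))) /\
  \int[reflect nu]_x (x ^+ 8 * expR (3 * h * `|x|)) = G.
  have [|i ->] := R8.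
    by apply: eq_integrable (tame_int8 st) => // x _; rewrite /= normrN e8.
  split=> //; rewrite -(tame_eighth st); apply: eq_Rintegral => x _.
  by rewrite normrN e8.
split => //.
- have i1 := integrableZl measurableT (-1) (step_int1 sm).
  have [|_ ->] := R1; first by apply: eq_integrable i1 => // x _; rewrite /= -EFinM mulN1r.
  rewrite -[RHS](mulr0 (-1)) -(tame_mean st) -RintegralZl//; last exact: step_int1 sm.
  by apply: eq_Rintegral => x _; rewrite mulN1r.
- have i1 := integrableZl measurableT (-1) (step_int3 sm).
  have e3 (x : R) : (- x) ^+ 3 = -1 * x ^+ 3 by rewrite exprNn -signr_odd expr1.
  have [|_ ->] := R3; first by apply: eq_integrable i1 => // x _; rewrite /= -EFinM e3.
  rewrite -[RHS](mulr0 (-1)) -(tame_skew st) -RintegralZl//; last exact: step_int3 sm.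
  by apply: eq_Rintegral => x _; rewrite e3.
Qed.

Lemma tame_walk_reflect n (nu : nat -> probability M R) N C T : tame_walk n nu N C T ->
  tame_walk n (fun k => reflect (nu k)) N C T.
Proof.
move=> walk h hT; have [s [G [H S1 SG]]] := walk h hT.
exists s, G; split=> // k kn; apply: tame_step_reflect (H k kn).
by case/andP: hT.
Qed.

End Reflection.

Section Intervals.
Context {R : realType}.
Local Notation M := (measurableTypeR R).
Local Notation N01 := (normal_prob (0 : R) 1).

Definition above (b : \bar R) : set M := [set x : M | (b < (x : R)%:E)%E].
Definition below (a : \bar R) : set M := [set x : M | ((x : R)%:E < a)%E].
Definition between (a b : \bar R) : set M := [set x : M | (a <= (x : R)%:E <= b)%E].

Lemma above_fin (t : R) : above t%:E = `]t, +oo[%classic.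
Proof. by apply/seteqP; split=> x; rewrite /above /= in_itv/= andbT lte_fin. Qed.

Lemma below_fin (t : R) : below t%:E = `]-oo, t[%classic.
Proof. by apply/seteqP; split=> x; rewrite /below /= in_itv/= lte_fin. Qed.

Lemma above_y : above +oo%E = set0.
Proof. by apply/seteqP; split=> x //=; rewrite /above/= ltNge leey. Qed.

Lemma above_Ny : above -oo%E = setT.
Proof. by apply/seteqP; split=> x //= _; rewrite /above/= ltNyr. Qed.

Lemma below_y : below +oo%E = setT.
Proof. by apply/seteqP; split=> x //= _; rewrite /below/= ltry. Qed.

Lemma below_Ny : below -oo%E = set0.
Proof. by apply/seteqP; split=> x //=; rewrite /below/= ltNge leNye. Qed.

Lemma measurable_above b : measurable (above b).
Proof.
by case: b => [t||]; rewrite ?above_fin ?above_y ?above_Ny//; exact: measurable_itv.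
Qed.

Lemma measurable_below a : measurable (below a).
Proof.
by case: a => [t||]; rewrite ?below_fin ?below_y ?below_Ny//; exact: measurable_itv.
Qed.

Lemma between_setC a b : between a b = ~` (below a `|` above b).
Proof.
apply/seteqP; split => x; rewrite /between /below /above /=.
  by move=> /andP[ax xb] []; apply/negP; rewrite -leNgt.
by move=> h; apply/andP; split; rewrite leNgt; apply/negP => h'; apply: h; [left|right].
Qed.

Lemma measurable_between a b : measurable (between a b).
Proof.
rewrite between_setC; apply: measurableC; apply: measurableU.
  exact: measurable_below.
exact: measurable_above.
Qed.

Lemma prob_between (L : probability M R) a b : (a <= b)%E ->
  fine (L (between a b)) = 1 - (fine (L (below a)) + fine (L (above b))).
Proof.
move=> ab; have mb := measurable_below a; have ma := measurable_above b.
rewrite between_setC probability_setC; last exact: measurableU.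
rewrite measureU//; last first.
  apply/seteqP; split=> // x [/= xa bx]; have := lt_trans (lt_trans bx xa) (lt_le_trans _ _).
  by move: (lt_le_trans (lt_trans bx xa) ab); rewrite ltxx.
by rewrite fineB ?fineD ?fin_numD ?fin_num_measure.
Qed.

Lemma negate_above a : negate @^-1` (above (- a)%E) = below a.
Proof.
by apply/seteqP; split=> x; rewrite /above /below /negate /= EFinN lteN2.
Qed.

Lemma N01_below a : N01 (below a) = N01 (above (- a)%E).
Proof.
case: a => [t||].
- by rewrite below_fin -EFinN above_fin N01_Nyo N01_itv gtailN.
- by rewrite below_y /= above_Ny.
- by rewrite below_Ny /= above_y.
Qed.

(** The relative error on the tails above levels in [0, X] controls the error on
all half-lines: beyond X both tails are at most 2 P(N > X), and below 0 one
passes to the complement. *)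
Lemma one_sided_error (L L' : probability M R) (d X : R) (b : \bar R) :
  0 <= d -> d <= 1 -> 0 <= X ->
  (forall A, measurable A -> L' A = L (negate @^-1` A)) ->
  (forall t, 0 <= t <= X -> `|fine (L `]t, +oo[%classic) - gtail t| <= d * gtail t) ->
  (forall t, 0 <= t <= X -> `|fine (L' `[t, +oo[%classic) - gtail t| <= d * gtail t) ->
  `|fine (L (above b)) - fine (N01 (above b))| <= d * fine (N01 (above b)) + 2 * gtail X.
Proof.
move=> d0 d1 X0 LL' H H'.
have gX := gtail_ge0 X.
have XX : 0 <= X <= X by rewrite X0 lexx.
have far (p q t : R) : X < t -> 0 <= p -> p <= q -> `|q - gtail X| <= d * gtail X ->
    `|p - gtail t| <= d * gtail t + 2 * gtail X.
  move=> Xt p0 pq /ler_normlP[_ h].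
  have gt := gtail_ge0 t; have gtX := gtail_nincr (ltW Xt).
  have dg : d * gtail X <= gtail X by rewrite ler_piMl.
  have dt : 0 <= d * gtail t by rewrite mulr_ge0.
  by rewrite ler_norml; apply/andP; split; lra.
have pos t : 0 <= t -> `|fine (L `]t, +oo[%classic) - gtail t| <= d * gtail t + 2 * gtail X.
  move=> t0; have [tX|Xt] := leP t X.
    by apply: le_trans (H t _) _; [rewrite t0|lra].
  apply: (far _ _ _ Xt _ _ (H X XX)); first exact: fine_ge0.
  apply: fine_le; rewrite ?fin_num_measure//.
  by apply: le_measure; rewrite ?inE//; apply: subset_itvr; rewrite bnd_simp; exact: ltW.
have pos' t : 0 <= t -> `|fine (L' `[t, +oo[%classic) - gtail t| <= d * gtail t + 2 * gtail X.
  move=> t0; have [tX|Xt] := leP t X.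
    by apply: le_trans (H' t _) _; [rewrite t0|lra].
  apply: (far _ _ _ Xt _ _ (H' X XX)); first exact: fine_ge0.
  apply: fine_le; rewrite ?fin_num_measure//.
  by apply: le_measure; rewrite ?inE//; apply: subset_itvr; rewrite bnd_simp; exact: ltW.
case: b => [t||].
- rewrite above_fin N01_itv /=; have [t0|t0] := leP 0 t; first exact: pos.
  have nt : 0 <= - t by lra.
  have := pos' _ nt; rewrite LL'//.
  have -> : negate @^-1` `[(- t), +oo[%classic = ~` (`]t, +oo[%classic : set M).
    apply/seteqP; split=> x; rewrite /negate /= !in_itv/= !andbT lerN2.
      by move=> xt; apply/negP; rewrite -leNgt.
    by move=> /negP; rewrite -leNgt.
  rewrite probability_setC// gtailN.
  rewrite fineB ?fin_num_measure//= (_ : forall x y : R, 1 - x - (1 - y) = - (x - y)); last by move=> x y; ring.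
  rewrite normrN.
  move=> /le_trans; apply; rewrite lerD2r ler_wpM2l//.
  have := gtail_nincr (ltW t0); rewrite gtail0; lra.
- by rewrite above_y !measure0/= subrr normr0 mulr0 add0r mulr_ge0.
- rewrite above_Ny (_ : fine (L setT) = 1); last by rewrite probability_setT.
  rewrite (_ : fine (N01 setT) = 1); last by rewrite probability_setT.
  by rewrite subrr normr0 mulr1 addr_ge0// mulr_ge0.
Qed.

(** The complement of an interval is a union of two half-lines, so that the error is
relative to the complement, as prod_compare requires. *)
Lemma between_error (n : nat) (nu : nat -> probability M R) (d X : R) (a b : \bar R) :
  0 <= d -> d <= 1 -> 0 <= X -> (a <= b)%E ->
  (forall nu', nu' = nu \/ nu' = (fun k => reflect (nu k)) ->
   forall t, 0 <= t <= X ->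
   `|fine (convn nu' n `[t, +oo[%classic) - gtail t| <= d * gtail t /\
   `|fine (convn nu' n `]t, +oo[%classic) - gtail t| <= d * gtail t) ->
  `|fine (convn nu n (between a b)) - fine (N01 (between a b))| <=
    d * (1 - fine (N01 (between a b))) + 4 * gtail X.
Proof.
move=> d0 d1 X0 ab H.
pose nu' := fun k => reflect (nu k).
have r1 A : measurable A -> convn nu' n A = convn nu n (negate @^-1` A) by exact: convn_reflect.
have r2 A : measurable A -> convn nu n A = convn nu' n (negate @^-1` A).
  move=> mA; rewrite r1; first by congr (convn nu n _); apply/seteqP; split=> x; rewrite /negate/= opprK.
  by rewrite -[X in measurable X]setTI; exact: measurable_negate.
have E1 := one_sided_error b d0 d1 X0 r1 (fun t ht => (H nu (or_introl erefl) t ht).2)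
  (fun t ht => (H nu' (or_intror erefl) t ht).1).
have E2 := one_sided_error (- a)%E d0 d1 X0 r2 (fun t ht => (H nu' (or_intror erefl) t ht).2)
  (fun t ht => (H nu (or_introl erefl) t ht).1).
rewrite r1 in E2; last exact: measurable_above.
rewrite negate_above -N01_below in E2.
rewrite !prob_between//.
move: (fine (convn nu n (above b))) (fine (convn nu n (below a))) (fine (N01 _)) (fine (N01 _)) E1 E2
  => p q u v /ler_normlP[e1 e2] /ler_normlP[e3 e4].
by rewrite ler_norml; apply/andP; split; lra.
Qed.

End Intervals.

(** * Sums over arrays of independent variables *)

Section Independence.
Context {R : realType}.
Local Notation M := (measurableTypeR R).
Local Open Scope ereal_scope.

Lemma measurable_preimageT d (T : measurableType d) d' (T' : measurableType d') (f : T -> T') (A : set T') :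
  measurable_fun setT f -> measurable A -> measurable (f @^-1` A).
Proof. by move=> mf mA; rewrite -[X in measurable X]setTI; exact: mf. Qed.

Section Conditional.
Context d (T : measurableType d) (P : probability T R).

(** Under P conditioned on E, the pair (U, V) has the product law. *)
Lemma indep_sum (E : set T) (U V : T -> M) (L1 L2 : probability M R) :
  measurable E -> measurable_fun setT U -> measurable_fun setT V ->
  (forall B C, measurable B -> measurable C ->
    P (E `&` (U @^-1` B `&` V @^-1` C)) = P E * (L1 B * L2 C)) ->
  forall D : set M, measurable D ->
    P (E `&` [set w | D (U w + V w)%R]) = P E * convolve L1 L2 D.
Proof.
move=> mE mU mV H D mD.
have mUV : measurable_fun setT (fun w => (U w, V w)) by exact: measurable_fun_pair.
have mS : measurable [set w | D (U w + V w)%R].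
  have := measurable_preimageT (measurableT_comp measurable_sum_pair mUV) mD.
  by [].
have [PE0|PE0] := eqVneq (P E) 0.
  rewrite PE0 mul0e; apply/eqP; rewrite eq_le measure_ge0 andbT -PE0.
  by apply: le_measure; rewrite ?inE//; exact: measurableI.
have PEfin : P E \is a fin_num by exact: fin_num_measure.
pose c := fine (P E).
have cE : P E = c%:E by rewrite fineK.
have c0 : (c != 0)%R by rewrite -eqe -cE.
pose Pc : probability T R := mnormalize (mrestr P mE) P.
have PcE A : Pc A = P (A `&` E) * (c^-1)%:E.
  have evE : (mrestr P mE : {measure set T -> \bar R}) setT = P E.
    by rewrite -[LHS]/(P (setT `&` E)) setTI.
  rewrite /Pc/= /mnormalize. by rewrite evE (negbTE PE0) cE.
have K A : P (E `&` A) = P E * Pc A.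
  by rewrite setIC PcE muleC -muleA cE -EFinM mulVf// mule1.
pose uv : {mfun T >-> (M * M)%type} := mfun_Sub (mem_set mUV).
rewrite K; congr (_ * _).
transitivity (distribution Pc uv (sum_pair @^-1` D)); first by [].
transitivity ((L1 \x L2) (sum_pair @^-1` D)); last by [].
apply/esym/product_measure_unique; last first.
  exact: measurable_preimageT measurable_sum_pair mD.
move=> B C mB mC.
transitivity (Pc (U @^-1` B `&` V @^-1` C)); first by [].
by rewrite PcE setIC H// muleC muleA cE -EFinM mulVf// mul1e.
Qed.

(** Conditionally on an event, the sum of independent variables has the law of the
convolution; the event carries the other coordinates. *)
Lemma indep_sum_convn n (Y : nat -> T -> M) (nu : nat -> probability M R) (E : set T) :
  measurable E -> (forall i, measurable_fun setT (Y i)) ->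
  (forall B : nat -> set M, (forall i, measurable (B i)) ->
    P (E `&` [set w | forall i, (i < n)%N -> B i (Y i w)]) =
    P E * \prod_(0 <= i < n) nu i (B i)) ->
  forall D : set M, measurable D ->
    P (E `&` [set w | D (\sum_(0 <= i < n) Y i w)%R]) = P E * convn nu n D.
Proof.
move=> mE mY H.
have mrest k m B : (forall i, measurable (B i)) ->
    measurable [set w | forall i, (k <= i < m)%N -> B i (Y i w)].
  move=> mB; rewrite (_ : [set w | _] = \bigcap_(i in [set i | (k <= i < m)%N]) (Y i @^-1` B i)).
    by apply: bigcap_measurableType => i _; exact: measurable_preimageT.
  by apply/seteqP; split=> w h i; exact: h.
have mW k : measurable_fun setT (fun w => \sum_(0 <= i < k) Y i w)%R.
  by apply: measurable_sum.
suff S k : (k <= n)%N -> forall (D : set M) B, measurable D -> (forall i, measurable (B i)) ->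
    P (E `&` ([set w | D (\sum_(0 <= i < k) Y i w)%R] `&`
       [set w | forall i, (k <= i < n)%N -> B i (Y i w)])) =
    P E * (convn nu k D * \prod_(k <= i < n) nu i (B i)).
  move=> D mD; have := S n (leqnn n) D (fun=> setT) mD (fun=> measurableT).
  rewrite big_geq// mule1 => <-; congr (P (_ `&` _)).
  by apply/seteqP; split=> w //= h; case: h.
elim: k => [_ D B mD mB|k IH kn D B mD mB].
  pose o : M := (0 : R)%R.
  have -> : [set w | D (\sum_(0 <= i < 0) Y i w)%R] = if o \in D then setT else set0.
    apply/seteqP; split=> w /=; rewrite big_geq//; case: ifPn => //.
      by rewrite notin_setE => /[apply].
    by rewrite inE.
  rewrite (_ : convn nu 0 D = \d_o D)// diracE; case: (boolP (o \in D)) => h0.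
    by rewrite setTI mul1e -H.
  by rewrite set0I setI0 measure0 (_ : (false%:R)%:E = 0 :> \bar R)// mul0e mule0.
pose rest := [set w | forall i, (k.+1 <= i < n)%N -> B i (Y i w)].
have mrestk : measurable rest by exact: mrest.
have mE' : measurable (E `&` rest) by exact: measurableI.
pose Q := \prod_(k.+1 <= i < n) nu i (B i).
have HC (B1 C1 : set M) : measurable B1 -> measurable C1 ->
    P ((E `&` rest) `&` ((fun w => \sum_(0 <= i < k) Y i w)%R @^-1` B1 `&` Y k @^-1` C1)) =
    P E * (convn nu k B1 * (nu k C1 * Q)).
  move=> mB1 mC1; pose B' i := if i == k then C1 else B i.
  have mB' i : measurable (B' i) by rewrite /B'; case: ifP.
  have := IH (ltnW kn) B1 B' mB1 mB'.
  rewrite big_ltn// {2}/B' eqxx.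
  have -> : \prod_(k.+1 <= i < n) nu i (B' i) = Q.
    by apply: eq_big_nat => i /andP[ki _]; rewrite /B' gtn_eqF.
  move=> <-; rewrite -setIA; congr (P (_ `&` _)); apply/seteqP; split=> w /=.
    move=> [h [hB hC]]; split=> // i /andP[ki iln]; rewrite /B'.
    by case: eqP => [->//|/eqP ik]; apply: h; rewrite iln ltn_neqAle eq_sym ik ki.
  move=> [hB h]; split; last first.
    by split=> //; have := h k; rewrite /B' eqxx leqnn kn; exact.
  by move=> i /andP[ki iln]; have := h i; rewrite /B' gtn_eqF// iln (ltnW ki); exact.
have PE' : P (E `&` rest) = P E * Q.
  have := HC _ _ measurableT measurableT.
  by rewrite !preimage_setT !setIT !probability_setT !mul1e.
have -> : [set w | D (\sum_(0 <= i < k.+1) Y i w)%R] `&` rest =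
    rest `&` [set w | D ((\sum_(0 <= i < k) Y i w) + Y k w)%R].
  by rewrite setIC; congr (_ `&` _); apply/seteqP; split=> w /=; rewrite big_nat_recr.
rewrite setIA (indep_sum (L1 := convn nu k) (L2 := nu k) mE' (mW k) (mY k) _ mD).
  by rewrite PE' -muleA (muleC Q).
move=> B1 C1 mB1 mC1; rewrite HC// PE' -muleA; congr (_ * _).
by rewrite muleA muleC.
Qed.

(** All columns at once: an array of independent variables whose (i, j) entry has a
law nu i that does not depend on j. By induction on the columns, the columns
already summed and those still to be summed being the event on which
indep_sum_convn is conditioned. *)
Lemma indep_array n p (Y : nat -> nat -> T -> M) (nu : nat -> probability M R) :
  (forall i j, measurable_fun setT (Y i j)) ->
  (forall B : nat -> nat -> set M, (forall i j, measurable (B i j)) ->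
    P [set w | forall i j, (i < n)%N -> (j < p)%N -> B i j (Y i j w)] =
    \prod_(0 <= j < p) \prod_(0 <= i < n) nu i (B i j)) ->
  forall D : nat -> set M, (forall j, measurable (D j)) ->
    P [set w | forall j, (j < p)%N -> D j (\sum_(0 <= i < n) Y i j w)%R] =
    \prod_(0 <= j < p) convn nu n (D j).
Proof.
move=> mY H D mD.
have mW j : measurable_fun setT (fun w => \sum_(0 <= i < n) Y i j w)%R.
  by apply: measurable_sum => i; exact: mY.
pose done_ q := [set w | forall j, (j < q)%N -> D j (\sum_(0 <= i < n) Y i j w)%R].
pose todo q (B : nat -> nat -> set M) :=
  [set w | forall i j, (i < n)%N -> (q <= j < p)%N -> B i j (Y i j w)].
have mdone q : measurable (done_ q).
  rewrite (_ : done_ q = \bigcap_(j in [set j | (j < q)%N]) ((fun w => \sum_(0 <= i < n) Y i j w)%R @^-1` D j)).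
    by apply: bigcap_measurableType => j _; exact: (measurable_preimageT (mW j) (mD j)).
  by apply/seteqP; split=> w h j; exact: h.
have mtodo q B : (forall i j, measurable (B i j)) -> measurable (todo q B).
  move=> mB; rewrite (_ : todo q B = \bigcap_(i in [set i | (i < n)%N])
      \bigcap_(j in [set j | (q <= j < p)%N]) (Y i j @^-1` B i j)).
    apply: bigcap_measurableType => i _; apply: bigcap_measurableType => j _.
    exact: (measurable_preimageT (mY i j) (mB i j)).
  by apply/seteqP; split=> w h i => [ii j jj|j]; [exact: h|move=> ii jj; exact: h].
suff S q : (q <= p)%N -> forall B, (forall i j, measurable (B i j)) ->
    P (done_ q `&` todo q B) = (\prod_(0 <= j < q) convn nu n (D j)) *
      \prod_(q <= j < p) \prod_(0 <= i < n) nu i (B i j).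
  have := S p (leqnn p) (fun _ _ => setT) (fun _ _ => measurableT).
  rewrite [X in _ * X]big_geq// mule1 => <-; congr (P _).
  by apply/seteqP; split=> w /= h; [split=> // i j _|case: h] => //; case/andP => /leq_ltn_trans h' /h'; rewrite ltnn.
elim: q => [_ B mB|q IH qp B mB].
  rewrite big_geq// mul1e -H//; congr (P _); apply/seteqP; split=> w /=.
    by move=> [_ h] i j ii jj; apply: h.
  by move=> h; split=> // i j ii jj; apply: h.
have HC (C : nat -> set M) : (forall i, measurable (C i)) ->
    P ((done_ q `&` todo q.+1 B) `&` [set w | forall i, (i < n)%N -> C i (Y i q w)]) =
    (\prod_(0 <= j < q) convn nu n (D j)) *
    ((\prod_(0 <= i < n) nu i (C i)) * \prod_(q.+1 <= j < p) \prod_(0 <= i < n) nu i (B i j)).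
  move=> mC; pose B' i j := if j == q then C i else B i j.
  have mB' i j : measurable (B' i j) by rewrite /B'; case: ifP.
  have := IH (ltnW qp) B' mB'; rewrite [X in _ * X]big_ltn//.
  have -> : \prod_(0 <= i < n) nu i (B' i q) = \prod_(0 <= i < n) nu i (C i).
    by apply: eq_bigr => i _; rewrite /B' eqxx.
  have -> : \prod_(q.+1 <= j < p) \prod_(0 <= i < n) nu i (B' i j) =
            \prod_(q.+1 <= j < p) \prod_(0 <= i < n) nu i (B i j).
    apply: eq_big_nat => j /andP[qj _]; apply: eq_bigr => i _.
    by rewrite /B' gtn_eqF.
  move=> <-; rewrite -setIA; congr (P (_ `&` _)); apply/seteqP; split=> w /=.
    move=> [hB hC] i j ii /andP[qj jp]; rewrite /B'.
    by case: eqP => [->|/eqP jq]; [exact: hC|apply: hB; rewrite // jp ltn_neqAle eq_sym jq qj].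
  move=> h; split=> [i j ii /andP[qj jp]|i ii].
    by have := h i j ii; rewrite /B' gtn_eqF// jp (ltnW qj); exact.
  by have := h i q ii; rewrite /B' eqxx leqnn qp; exact.
have mE : measurable (done_ q `&` todo q.+1 B) by apply: measurableI => //; exact: mtodo.
have PE : P (done_ q `&` todo q.+1 B) = (\prod_(0 <= j < q) convn nu n (D j)) *
    \prod_(q.+1 <= j < p) \prod_(0 <= i < n) nu i (B i j).
  have := HC (fun=> setT) (fun=> measurableT).
  rewrite (_ : [set w | _] = setT) ?setIT; last by apply/seteqP; split.
  rewrite (_ : \prod_(0 <= i < n) nu i setT = 1) ?mul1e//.
  by rewrite big1// => i _; exact: probability_setT.
have HS : P ((done_ q `&` todo q.+1 B) `&` [set w | D q (\sum_(0 <= i < n) Y i q w)%R]) =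
    P (done_ q `&` todo q.+1 B) * convn nu n (D q).
  apply: (indep_sum_convn mE (fun i => mY i q)) => // C mC.
  by rewrite HC// PE -muleA; congr (_ * _); exact: muleC.
rewrite (_ : done_ q.+1 `&` todo q.+1 B =
    (done_ q `&` todo q.+1 B) `&` [set w | D q (\sum_(0 <= i < n) Y i q w)%R]).
  rewrite HS PE big_nat_recr//= -!muleA; congr (_ * _); exact: muleC.
apply/seteqP; split=> w /=.
  move=> [h1 h2]; split; last exact: h1.
  by split=> // j jq; apply: h1; exact: ltnW.
move=> [[h1 h2] h3]; split=> // j; rewrite ltnS leq_eqVlt => /predU1P[->//|]; exact: h1.
Qed.

End Conditional.
End Independence.

(** * The standard Gaussian vector *)

Section GaussianVector.
Context {R : realType}.
Local Notation M := (measurableTypeR R).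
Local Notation N01 := (normal_prob (0 : R) 1).

Lemma lebesgue_integral_tuple_prod p (f : 'I_p -> R -> R) (I : 'I_p -> R) (c : R) :
  0 <= c -> (forall j, measurable_fun [set: M] (f j)) -> (forall j x, 0 <= f j x) ->
  (forall j, \int[@lebesgue_measure R]_x (f j x)%:E = (I j)%:E)%E ->
  lebesgue_integral_tuple (fun t : p.-tuple M => (c * \prod_j f j (tnth t j))%:E) =
  (c * \prod_j I j)%:E.
Proof.
elim: p f I c => [|p IH] f I c c0 mf f0 If /=; first by rewrite !big_ord0.
have I0 j : 0 <= I j by rewrite -lee_fin -If integral_ge0// => x _; rewrite lee_fin.
pose P := \prod_(j < p) I (lift ord0 j).
have P0 : 0 <= P by apply: prodr_ge0.
transitivity (\int[@lebesgue_measure R]_x ((c * P)%:E * (f ord0 x)%:E))%E.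
  apply: eq_integral => x _.
  rewrite -EFinM (_ : c * P * f ord0 x = (c * f ord0 x) * P); last by ring.
  rewrite -(IH (fun j => f (lift ord0 j)) (fun j => I (lift ord0 j)))//.
  - congr lebesgue_integral_tuple; apply/funext => t; congr EFin.
    rewrite big_ord_recl tnth0 mulrA; congr (_ * _); apply: eq_bigr => j _.
    by rewrite tnthS.
  - exact: mulr_ge0.
rewrite ge0_integralZl//.
- by rewrite If -EFinM big_ord_recl mulrAC mulrA.
- exact/measurable_EFinP.
- by move=> x _; rewrite lee_fin.
- by rewrite lee_fin mulr_ge0.
Qed.

Lemma gaussian_pdf_std p (t : p.-tuple M) :
  gaussian_pdf 0 1%:M (colv t) = \prod_(j < p) gpdf (tnth t j : R).
Proof.
rewrite /gaussian_pdf det1 mulr1 subr0 invmx1 /qform mulmx1 mxE.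
under [RHS]eq_bigr do rewrite gpdfE.
rewrite big_split/= prodr_const card_ord -expR_sum; congr (_ * expR _).
  have sqrtX (x : R) k : 0 <= x -> Num.sqrt (x ^+ k) = Num.sqrt x ^+ k.
    move=> x0; elim: k => [|k IH]; first by rewrite !expr0 sqrtr1.
    by rewrite !exprS sqrtrM// IH.
  rewrite /normal_peak expr1n mul1r exprVn mulr_natl sqrtX//.
  by rewrite mulrn_wge0// pi_ge0.
by rewrite sumrN -mulr_suml; congr (- (_ / _)); apply: eq_bigr => j _; rewrite !mxE expr2.
Qed.

(** The form in which the density occurs in the law of a Gaussian vector. *)
Lemma N01_indic (B : set M) : measurable B ->
  (N01 B = \int[@lebesgue_measure R]_x (\1_B x * gpdf x)%:E)%E.
Proof.
move=> mB; rewrite /normal_prob integral_mkcond; apply: eq_integral => x _.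
by rewrite patchE indicE; case: ifPn => _; rewrite ?mul1r ?mul0r.
Qed.

Lemma gaussian_box d (T : measurableType d) (Q : probability T R) p
    (Z : {RV Q >-> p.-tuple M}) (a b : 'I_p -> \bar R) :
  gaussian_vector Z 0 1%:M ->
  Q [set w | forall j, (a j <= (colv (Z w) j 0)%:E <= b j)%E] =
  (\prod_(j < p) N01 (between (a j) (b j)))%E.
Proof.
move=> [_ H].
pose A := [set t : p.-tuple M | forall j, between (a j) (b j) (tnth t j)].
have mA : measurable A.
  rewrite (_ : A = \bigcap_(j in [set: 'I_p]) ((fun t : p.-tuple M => tnth t j) @^-1` between (a j) (b j))).
    apply: fin_bigcap_measurable => // j _.
    exact: (measurable_preimageT (measurable_tnth j) (measurable_between _ _)).
  by apply/seteqP; split=> t h j; [move=> _|]; exact: h.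
transitivity (Q (Z @^-1` A)).
  congr (Q _); apply/seteqP; split=> w h j; have := h j; by rewrite /between /= mxE.
rewrite H//.
pose f (j : 'I_p) (x : R) := \1_(between (a j) (b j)) x * gpdf x.
transitivity (lebesgue_integral_tuple (fun t : p.-tuple M => (1 * \prod_j f j (tnth t j))%:E)).
  congr lebesgue_integral_tuple; apply/funext => t; congr EFin.
  rewrite gaussian_pdf_std mul1r /f big_split/=; congr (_ * _).
  rewrite indicE; case: (boolP (t \in A)) => [|tA].
    rewrite inE => tA; rewrite big1// => j _.
    by rewrite indicE mem_set//; exact: tA.
  have [j hj] : exists j, ~ between (a j) (b j) (tnth t j).
    by apply/existsNP; move/negP: tA => h h'; apply: h; rewrite inE.
  by rewrite (bigD1 j)//= indicE memNset// mul0r.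
rewrite (@lebesgue_integral_tuple_prod p f (fun j => fine (N01 (between (a j) (b j)))) 1)//.
- rewrite mul1r -prodEFin; apply: eq_bigr => j _.
  by rewrite fineK// fin_num_measure//; exact: measurable_between.
- move=> j; apply: measurable_funM; last exact: measurable_normal_pdf.
  by apply: measurable_indic; exact: measurable_between.
- by move=> j x; rewrite mulr_ge0 ?gpdf_ge0.
- move=> j; rewrite -N01_indic; last exact: measurable_between.
  by rewrite fineK// fin_num_measure//; exact: measurable_between.
Qed.

End GaussianVector.

(** * Square roots of scalar matrices *)

Section SquareRoot.
Context {R : realType}.

(** Uniqueness of the positive semidefinite root B: from (B + c)(B - c) = 0 and the
injectivity of B + c. *)
Lemma sqrtmx_scalar p (c : R) : 0 < c -> sqrtmx ((c ^+ 2)%:M : 'M[R]_p) = c%:M.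
Proof.
move=> c0; rewrite /sqrtmx.
have qs (v : 'cV[R]_p) : qform c%:M v = c * \sum_i (v i 0) ^+ 2.
  rewrite /qform mul_mx_scalar -scalemxAl !mxE; congr (_ * _).
  by apply: eq_bigr => i _; rewrite !mxE expr2.
have psd : possemidef (c%:M : 'M[R]_p).
  split; first by rewrite tr_scalar_mx.
  by move=> v; rewrite qs mulr_ge0 ?(ltW c0)// sumr_ge0// => i _; exact: sqr_ge0.
case: xgetP => [B BE [[_ Bpos] BB]|/(_ c%:M)[]]; last first.
  by split=> //; rewrite -scalar_mxM expr2.
have inj (v : 'cV[R]_p) : (B + c%:M) *m v = 0 -> v = 0.
  move=> h; have : qform (B + c%:M) v = 0 by rewrite /qform -mulmxA h mulmx0 mxE.
  rewrite /qform mulmxDr mulmxDl mxE -!/(qform _ _) qs => e.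
  have s0 : \sum_i (v i 0) ^+ 2 = 0.
    have := Bpos v; have : 0 <= \sum_i (v i 0) ^+ 2 by apply: sumr_ge0 => i _; exact: sqr_ge0.
    by move: (qform _ _) (\sum_i _) e => x y e y0 x0; nra.
  apply/matrixP => i j; rewrite ord1 mxE.
  move/eqP: s0; rewrite psumr_eq0; last by move=> k _; exact: sqr_ge0.
  by move/allP/(_ i (mem_index_enum i)) => /=; rewrite sqrf_eq0 => /eqP.
have h : (B + c%:M) *m (B - c%:M) = 0.
  rewrite mulmxDl !mulmxBr BB -scalar_mxM -expr2 mul_scalar_mx mul_mx_scalar.
  by rewrite addrA subrK subrr.
apply/eqP; rewrite -subr_eq0; apply/eqP/matrixP => i j.
have /inj /matrixP/(_ i 0) : (B + c%:M) *m col j (B - c%:M) = 0.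
  by rewrite colE mulmxA h mul0mx.
by rewrite !mxE.
Qed.

Lemma invsqrtmx_scalar p (c : R) : 0 < c ->
  invsqrtmx ((c ^+ 2)%:M : 'M[R]_p) = (c^-1)%:M.
Proof. by move=> c0; rewrite /invsqrtmx sqrtmx_scalar// invmx_scalar. Qed.

End SquareRoot.

(** * Second moments of the summands *)

Section RandomVectors.
Context {R : realType}.
Local Notation M := (measurableTypeR R).

(** The argument is typed in the Borel structure so that the image of a probability
by it can be formed. *)
Definition rescale (c : R) (x : M) : M := c * x.

Lemma measurable_rescale c : measurable_fun [set: M] (rescale c).
Proof. exact: measurable_funM. Qed.

HB.instance Definition _ c :=
  @isMeasurableFun.Build _ _ _ _ (rescale c) (measurable_rescale c).

Definition rescaled (c : R) (mu : probability M R) : probability M R :=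
  distribution mu (rescale c).

Section Law.
Context d (T : measurableType d) (P : probability T R) (Y : T -> M)
  (mu : probability M R).
Hypotheses (mY : measurable_fun setT Y) (lawY : has_distribution P Y mu).

Lemma ge0_integral_law (f : M -> \bar R) : measurable_fun setT f ->
  (forall x, 0 <= f x)%E -> (\int[P]_w f (Y w) = \int[mu]_x f x)%E.
Proof.
move=> mf f0; pose Ym : {mfun T >-> M} := mfun_Sub (mem_set mY).
rewrite -[LHS](@ge0_integral_distribution _ _ _ _ _ P Ym)//.
by apply: eq_measure_integral => A mA _; exact: lawY.
Qed.

End Law.

Section Columns.
Context d (T : measurableType d) (P : probability T R) (p : nat)
  (X : {RV P >-> p.-tuple M}) (mu : probability M R).

Let U (j : 'I_p) (w : T) : M := tnth (X w) j.

Lemma measurable_coord j : measurable_fun setT (U j).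
Proof. exact: measurableT_comp (measurable_tnth j) (measurable_funPT X). Qed.

Hypotheses (ind : mutually_independent P U)
  (law : forall j, has_distribution P (U j) mu)
  (i2 : mu.-integrable setT (EFin \o (fun x : M => x ^+ 2)))
  (i1 : mu.-integrable setT (EFin \o (fun x : M => x : R)))
  (m1 : \int[mu]_x (x : R) = 0).

Lemma second_moment_diag j :
  fine ('E_P[fun w => (tnth (X w) j * tnth (X w) j : R)%R])%E = \int[mu]_x (x ^+ 2).
Proof.
have e : (\int[P]_w ((U j w : R) ^+ 2)%:E = \int[mu]_x ((x : R) ^+ 2)%:E)%E.
  apply: (ge0_integral_law (measurable_coord j) (law j) (f := fun x : M => ((x : R) ^+ 2)%:E)).
    by apply/measurable_EFinP; exact: measurable_funX.
  by move=> x; rewrite lee_fin sqr_ge0.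
by rewrite unlock /Rintegral -e; congr fine.
Qed.

(** The product of two independent integrable variables has the product of the
means as its mean, by Fubini's theorem for the joint law. *)
Lemma second_moment_offdiag j k : j != k ->
  fine ('E_P[fun w => (tnth (X w) j * tnth (X w) k : R)%R])%E = 0.
Proof.
move=> jk; rewrite unlock.
have mUV : measurable_fun setT (fun w => (U j w, U k w)).
  by apply: measurable_fun_pair; exact: measurable_coord.
pose uv : {mfun T >-> (M * M)%type} := mfun_Sub (mem_set mUV).
pose g (z : M * M) : \bar R := ((z.1 : R) * (z.2 : R))%:E.
have mg : measurable_fun setT g.
  apply/measurable_EFinP; apply: measurable_funM; [exact: measurable_fst|exact: measurable_snd].
have lawUV A : measurable A -> distribution P uv A = (mu \x mu)%E A.
  move=> mA; apply/esym/product_measure_unique => // B C mB mC.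
  rewrite -[LHS]/(P ((fun w => (U j w, U k w)) @^-1` (B `*` C))).
  pose D (i : 'I_p) : set M := if i == j then B else if i == k then C else setT.
  have mD i : measurable (D i) by rewrite /D; case: ifP => // _; case: ifP.
  have := ind mD; rewrite (bigD1 j)//= (bigD1 k)//=; last by rewrite eq_sym.
  rewrite big1 ?mule1; last first.
    move=> i /andP[ij ik]; rewrite /D (negbTE ij) (negbTE ik) preimage_setT.
    exact: probability_setT.
  rewrite {2}/D eqxx {2}/D eq_sym (negbTE jk) eqxx !law// => <-; congr (P _).
  apply/seteqP; split=> w /=.
    move=> [h1 h2] i; rewrite /D; case: eqP => [->//|_]; by case: eqP => [->|].
  move=> h; split; first by have := h j; rewrite /D eqxx.
  by have := h k; rewrite /D eq_sym (negbTE jk) eqxx.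
have intU (i : 'I_p) : P.-integrable setT (fun w => ((U i w : R) ^+ 2)%:E).
  apply/integrableP; split.
    by apply/measurable_EFinP; apply: measurable_funX; exact: measurable_coord.
  rewrite (ge0_integral_law (measurable_coord i) (law i) (f := fun x => `|(x ^+ 2)%:E|%E))//.
    by case/integrableP: i2.
  by apply: measurableT_comp => //; apply/measurable_EFinP; exact: measurable_funX.
have intUV : P.-integrable setT (g \o uv).
  apply: (le_integrable measurableT _ _ (integrableD measurableT (intU j) (intU k))).
    exact: measurableT_comp mg mUV.
  move=> w _; rewrite /= lee_fin (ger0_norm (addr_ge0 (sqr_ge0 _) (sqr_ge0 _))).
  rewrite normrM; have := sqr_ge0 (`|U j w| - `|U k w|).
  rewrite sqrrB !real_normK ?num_real//.
  have := sqr_ge0 (U j w : R); have := sqr_ge0 (U k w : R); lra.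
have ig : (mu \x mu)%E.-integrable setT g.
  have := integrable_pushforward mUV mg intUV measurableT.
  move=> /integrableP[_ h]; apply/integrableP; split=> //.
  apply: le_lt_trans h; rewrite le_eqVlt; apply/orP; left; apply/eqP.
  by apply: eq_measure_integral => A mA _; first [exact: lawUV|apply: esym; exact: lawUV].
rewrite -[X in fine X]/(\int[P]_w (g \o uv) w)%E.
rewrite -(integral_distribution mg intUV).
rewrite (eq_measure_integral (mu \x mu)%E); last by move=> A mA _; exact: lawUV.
rewrite -integral12_prod_meas1//.
rewrite integral0_eq// => x _; rewrite /fubini_F /g /=.
under eq_integral do rewrite EFinM.
rewrite integralZl//.
have -> : (\int[mu]_y (y : R)%:E = 0)%E.
  by rewrite -(fineK (integrable_fin_num measurableT i1)) -/(Rintegral _ _ _) m1.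
by rewrite mule0.
Qed.

End Columns.

End RandomVectors.

(** * Exponential moments from even moments *)

Section EvenMoments.
Context {R : realType}.
Local Notation M := (measurableTypeR R).

Definition cosh_coeff (y : R) (m : nat) : R := 2 * y ^+ (2 * m) / (2 * m)`!%:R.

Lemma even_exp_ge0 (y : R) m : 0 <= y ^+ (2 * m).
Proof. by rewrite exprM exprn_ge0// sqr_ge0. Qed.

Lemma cosh_coeff_ge0 (y : R) m : 0 <= cosh_coeff y m.
Proof. exact: divr_ge0 (mulr_ge0 (ler0n _ 2) (even_exp_ge0 y m)) (ler0n _ _). Qed.

Lemma exp_coeff_pair (y : R) m :
  (exp_coeff y (2 * m) + exp_coeff (- y) (2 * m)) +
  (exp_coeff y (2 * m).+1 + exp_coeff (- y) (2 * m).+1) = cosh_coeff y m.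
Proof.
have e : (- y) ^+ (2 * m) = y ^+ (2 * m) by rewrite !exprM sqrrN.
rewrite /exp_coeff /cosh_coeff /= !exprS e.
by move: (_ `!%:R) => a; ring.
Qed.

Lemma partial_cosh_le (y : R) N :
  \sum_(0 <= k < N) (exp_coeff y k + exp_coeff (- y) k) <= \sum_(0 <= m < N) cosh_coeff y m.
Proof.
have pair2 K : \sum_(0 <= k < 2 * K) (exp_coeff y k + exp_coeff (- y) k) =
    \sum_(0 <= m < K) cosh_coeff y m.
  elim: K => [|K IH]; first by rewrite muln0 !big_geq.
  rewrite (_ : (2 * K.+1 = (2 * K).+2)%N); last by rewrite mulnS.
  by rewrite !big_nat_recr//= IH -addrA exp_coeff_pair.
rewrite -pair2 [leRHS](big_cat_nat (n := N))//=; last by rewrite leq_pmull.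
rewrite lerDl sumr_ge0// => k _; rewrite /exp_coeff /= -mulrDl divr_ge0//.
rewrite exprNn -signr_odd; case: (boolP (odd k)) => hk; first by rewrite expr1 mulN1r subrr.
rewrite expr0 mul1r -(odd_double_half k) (negbTE hk) add0n -mul2n.
by rewrite addr_ge0// even_exp_ge0.
Qed.

(** From e^{|y|} <= e^y + e^{-y}, whose power series has even terms only. *)
Lemma expR_abs_le_series (y : R) :
  ((expR `|y|)%:E <= \sum_(0 <= m <oo) (cosh_coeff y m)%:E)%E.
Proof.
apply: (@le_trans _ _ (expR y + expR (- y))%:E).
  by rewrite lee_fin; case: (ger0P y) => _; rewrite ?lerDl ?lerDr expR_ge0.
have S0 : (0 <= \sum_(0 <= m <oo) (cosh_coeff y m)%:E)%E.
  by apply: nneseries_ge0 => m _ _; rewrite lee_fin cosh_coeff_ge0.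
have partial N : ((\sum_(0 <= k < N) (exp_coeff y k + exp_coeff (- y) k))%:E <=
    \sum_(0 <= m <oo) (cosh_coeff y m)%:E)%E.
  apply: le_trans (nneseries_lim_ge N _); last by move=> m _ _; rewrite lee_fin cosh_coeff_ge0.
  by rewrite sumEFin lee_fin partial_cosh_le.
move: (\sum_(0 <= m <oo) _)%E S0 partial => -[S||]// S0 partial; last by rewrite leey.
rewrite lee_fin.
have cv : series (exp_coeff y) \+ series (exp_coeff (- y)) @ \oo --> expR y + expR (- y).
  by apply: cvgD; exact: is_cvg_series_exp_coeff.
rewrite -(cvg_lim _ cv)//; apply: limr_le; first by apply/cvg_ex; exists (expR y + expR (- y)).
near=> N; have := partial N; rewrite lee_fin; apply: le_trans.
by rewrite /series /= big_split.
Unshelve. all: by end_near. Qed.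

(** The even moments determine the exponential ones: e^{c|x|} is at most twice the
hyperbolic cosine. *)
Lemma exp_moment_series (nu : probability M R) (c : R) :
  (\int[nu]_x (x ^+ 8 * expR (c * `|x|))%:E <=
   \sum_(0 <= m <oo) (cosh_coeff c m)%:E * \int[nu]_x (x ^+ (2 * (m + 4)))%:E)%E.
Proof.
have me k : measurable_fun [set: M] (fun x : M => (x ^+ k)%:E : \bar R).
  by apply/measurable_EFinP; exact: measurable_funX.
have mterm m : measurable_fun [set: M] (fun x : M => (cosh_coeff c m)%:E * (x ^+ (2 * (m + 4)))%:E)%E.
  by apply: emeasurable_funM => //; exact: measurable_cst.
have mser : measurable_fun [set: M]
    (fun x : M => \sum_(0 <= m <oo) (cosh_coeff c m)%:E * (x ^+ (2 * (m + 4)))%:E)%E.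
  have term0 m (x : M) : setT x -> predT m -> (0 <= (cosh_coeff c m)%:E * (x ^+ (2 * (m + 4)))%:E)%E.
    by move=> _ _; rewrite mule_ge0// lee_fin ?cosh_coeff_ge0 ?even_exp_ge0.
  exact: (ge0_emeasurable_sum term0 (fun m _ => mterm m)).
apply: (@le_trans _ _ (\int[nu]_x \sum_(0 <= m <oo) (cosh_coeff c m)%:E * (x ^+ (2 * (m + 4)))%:E)%E).
  apply: ge0_le_integral => //.
  - by move=> x _; rewrite lee_fin mulr_ge0 ?expR_ge0 ?(even_exp_ge0 _ 4).
  - by apply/measurable_EFinP; exact: measurable_monomial_expR.
  move=> x _; rewrite (eq_eseriesr (g := fun m => (x ^+ 8)%:E * (cosh_coeff (c * x) m)%:E)%E).
    rewrite nneseriesZl; last by move=> m _; rewrite lee_fin cosh_coeff_ge0.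
    rewrite EFinM; apply: lee_wpmul2l; first by rewrite lee_fin (even_exp_ge0 _ 4).
    apply: le_trans (expR_abs_le_series _); rewrite lee_fin ler_expR normrM.
    by rewrite ler_wpM2r// ler_norm.
  move=> m _; rewrite -!EFinM /cosh_coeff mulnDr exprD exprMn; congr EFin.
  by move: (_ `!%:R) => a; ring.
rewrite integral_nneseries//; last first.
- by move=> m x _; rewrite mule_ge0// lee_fin ?cosh_coeff_ge0 ?even_exp_ge0.
apply: lee_nneseries => [m _ _|m _].
- by apply: integral_ge0 => x _; rewrite mule_ge0// lee_fin ?cosh_coeff_ge0 ?even_exp_ge0.
- rewrite ge0_integralZl_EFin ?cosh_coeff_ge0 ?lexx// => x _.
  by rewrite lee_fin even_exp_ge0.
Qed.

(** Consecutive ratios: (2m+10)(2m+9) <= 9 (2m+2)(2m+1)(m+5), with equality at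
m = 0. *)
Lemma factorial_ratio m : ((2 * (m + 4))`! <= 1680 * 9 ^ m * ((2 * m)`! * (m + 4)`!))%N.
Proof.
elim: m => [|m IH]; first by [].
rewrite (_ : (2 * (m.+1 + 4) = (2 * (m + 4)).+2)%N); last by rewrite !mulnDr mulnS; lia.
rewrite (_ : (2 * m.+1 = (2 * m).+2)%N); last by rewrite mulnS.
rewrite addSn !factS expnS.
have h : ((2 * (m + 4)).+2 * (2 * (m + 4)).+1 <= 9 * ((2 * m).+2 * (2 * m).+1 * (m + 4).+1))%N by nia.
move: (leq_mul h IH).
by move: (_ ^ m)%N (_ `!)%N ((2 * m) `!)%N ((m + 4) `!)%N => a b c e; lia.
Qed.

Lemma geometric_half N : \sum_(0 <= m < N) (1 / 2 : R) ^+ m <= 2.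
Proof.
suff -> : \sum_(0 <= m < N) (1 / 2 : R) ^+ m = 2 - 2 * (1 / 2) ^+ N.
  by rewrite gerBl mulr_ge0// exprn_ge0.
elim: N => [|N IH]; first by rewrite big_geq// expr0; ring.
by rewrite big_nat_recr//= IH exprS; field.
Qed.

(** The m-th term of the series of exponential moments, with u = n^m, v = n^3,
w = 2^m, z = 9^m, x = c^(2m), q = (2m+8)!, a = (2m)! and b = (m+4)!. *)
Lemma coefficient_bound (x : R) : 0 <= x -> forall u v w z a : R, 0 < a -> forall b : R, 0 < b ->
  forall q : R, 0 < v -> 0 < u -> 0 < w -> 0 < z -> z * w * x <= u ->
  q <= 1680 * z * (a * b) ->
  2 * x / a * ((u * v)^-1 * (q / b)) <= 3360 / v * (1 / w).
Proof.
move=> x0 u v w z a a0 b b0 q v0 u0 w0 z0 h1 h2.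
have -> : 2 * x / a * ((u * v)^-1 * (q / b)) = 2 * x * q / (a * b * (u * v)) by field; rewrite !gt_eqF.
rewrite ler_pdivrMr; last exact: mulr_gt0 (mulr_gt0 a0 b0) (mulr_gt0 u0 v0).
have ab := mulr_gt0 a0 b0.
apply: (@le_trans _ _ (2 * x * (1680 * z * (a * b)))).
  by apply: ler_wpM2l h2; exact: mulr_ge0.
have -> : 3360 / v * (1 / w) * (a * b * (u * v)) = 3360 / w * (a * b) * u by field; rewrite !gt_eqF.
have -> : 2 * x * (1680 * z * (a * b)) = 3360 / w * (a * b) * (z * w * x) by field; rewrite !gt_eqF.
apply: ler_wpM2l h1; exact: mulr_ge0 (divr_ge0 (ler0n _ 3360) (ltW w0)) (ltW ab).
Qed.

(** The moments of order 2m + 8 summed over i are at most n^{-(m+3)} (2m+8)!/(m+4)!,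
of which (2m)! is compensated by the series of the hyperbolic cosine: there
remains n^{-3} times a geometric series of ratio 9 c^2/n, at most 1/2. *)
Lemma sum_exp_moment n (nu : 'I_n -> probability M R) (c : R) : (0 < n)%N ->
  18 * c ^+ 2 <= n%:R ->
  (forall m, (1 <= m)%N ->
    (n%:R ^+ (m - 1))%:E * \sum_(i < n) \int[nu i]_x (x ^+ (2 * m))%:E <=
    ((2 * m)`!%:R / m`!%:R)%:E)%E ->
  (\sum_(i < n) \int[nu i]_x (x ^+ 8 * expR (c * `|x|))%:E <= (6720 / n%:R ^+ 3)%:E)%E.
Proof.
move=> n0 cn H; have N0 : 0 < n%:R :> R by rewrite ltr0n.
have i0 i m : (0 <= \int[nu i]_x (x ^+ (2 * (m + 4)))%:E)%E.
  by apply: integral_ge0 => x _; rewrite lee_fin even_exp_ge0.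
apply: (@le_trans _ _ (\sum_(0 <= m <oo) \sum_(i < n) (cosh_coeff c m)%:E * \int[nu i]_x (x ^+ (2 * (m + 4)))%:E)%E).
  rewrite nneseries_sum; last by move=> i m _; rewrite mule_ge0// lee_fin cosh_coeff_ge0.
  by apply: lee_sum => i _; exact: exp_moment_series.
apply: (@le_trans _ _ (\sum_(0 <= m <oo) (3360 / n%:R ^+ 3 * (1 / 2) ^+ m)%:E)%E).
  apply: lee_nneseries => [m _ _|m _].
    by rewrite sume_ge0// => i _; rewrite mule_ge0// lee_fin cosh_coeff_ge0.
  rewrite -ge0_sume_distrr; last by move=> i _; exact: i0.
  have := H (m + 4)%N (ltn_addl m (isT : (0 < 4)%N)).
  rewrite (_ : (m + 4 - 1)%N = (m + 3)%N); last by rewrite addnS subn1.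
  have Nm : 0 < n%:R ^+ (m + 3) :> R by exact: exprn_gt0.
  rewrite -lee_pdivlMl// => h.
  apply: le_trans (lee_wpmul2l _ h) _; first by rewrite lee_fin cosh_coeff_ge0.
  rewrite -!EFinM lee_fin /cosh_coeff.
  have a0 : 0 < (2 * m)`!%:R :> R by rewrite ltr0n fact_gt0.
  have b0 : 0 < (m + 4)`!%:R :> R by rewrite ltr0n fact_gt0.
  have : (2 * (m + 4))`!%:R <= 1680 * 9 ^+ m * ((2 * m)`!%:R * (m + 4)`!%:R) :> R.
    by rewrite -natrX -!natrM ler_nat factorial_ratio.
  have : (18 * c ^+ 2) ^+ m <= n%:R ^+ m.
    by apply: lerXn2r => //; rewrite nnegrE; [exact: mulr_ge0 (ler0n _ 18) (sqr_ge0 c)|exact: ltW].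
  rewrite exprMn -exprM (_ : (18 : R) ^+ m = 9 ^+ m * 2 ^+ m); last by rewrite -exprMn; congr (_ ^+ _); ring.
  rewrite exprD expr_div_n expr1n.
  have c0 := even_exp_ge0 c m.
  have : 0 < (9 : R) ^+ m by exact: exprn_gt0.
  have : 0 < (2 : R) ^+ m by exact: exprn_gt0.
  have : 0 < n%:R ^+ m :> R by exact: exprn_gt0.
  have : 0 < n%:R ^+ 3 :> R by exact: exprn_gt0.
  move: (c ^+ _) c0 (n%:R ^+ m) (n%:R ^+ 3) (2 ^+ m) (9 ^+ m) (_ `!%:R) a0 (_ `!%:R) b0 (_ `!%:R).
  exact: coefficient_bound.
have K0 m : 0 <= 3360 / n%:R ^+ 3 * (1 / 2 : R) ^+ m.
  exact: mulr_ge0 (divr_ge0 (ler0n _ 3360) (exprn_ge0 3 (ltW N0))) (exprn_ge0 m (divr_ge0 ler01 (ler0n _ 2))).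
apply: lime_le.
  by apply: is_cvg_nneseries => m _ _; rewrite lee_fin; exact: K0.
apply: nearW => N; rewrite sumEFin lee_fin -mulr_sumr.
apply: le_trans (ler_wpM2l _ (geometric_half N)) _.
  exact: divr_ge0 (ler0n _ 3360) (exprn_ge0 3 (ltW N0)).
by rewrite mulrAC -natrM.
Qed.

End EvenMoments.

(** * The law of the normalized sum *)

Section Standardized.
Context {R : realType}.
Local Notation M := (measurableTypeR R).

(** Extended by Dirac masses beyond n, so that the recursion of convn applies. *)
Definition steps n (mu : 'I_n -> probability M R) (s : R) (i : nat) : probability M R :=
  if insub i is Some i' then rescaled s^-1 (mu i') else \d_(0 : M).

Lemma stepsE n (mu : 'I_n -> probability M R) (s : R) (i : 'I_n) :
  steps mu s i = rescaled s^-1 (mu i).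
Proof. by rewrite /steps valK. Qed.

Section Box.
Context d (T : measurableType d) (P : probability T R) (n p : nat)
  (X : 'I_n -> {RV P >-> p.-tuple M}) (mu : 'I_n -> probability M R) (s : R).
Hypotheses (s0 : 0 < s)
  (hX : mutually_independent P (fun i : 'I_n => X i))
  (A1 : forall i : 'I_n,
     mutually_independent P (fun (j : 'I_p) w => tnth (X i w) j) /\
     forall j : 'I_p, has_distribution P (fun w => tnth (X i w) j) (mu i))
  (i1 : forall i, (mu i).-integrable setT (EFin \o (fun x : M => x : R)))
  (i2 : forall i, (mu i).-integrable setT (EFin \o (fun x : M => x ^+ 2)))
  (m1 : forall i, \int[mu i]_x (x : R) = 0)
  (v2 : \sum_i \int[mu i]_x (x ^+ 2) = s ^+ 2).

(** Independence and equidistribution of the components make the matrix that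
normalizes the sum a scalar one. *)
Lemma sum_second_momentE : sum_second_moment X = (s ^+ 2)%:M.
Proof.
rewrite -v2; apply/matrixP => j k.
rewrite /sum_second_moment summxE mxE -sumrMnl; apply: eq_bigr => i _; rewrite mxE.
have [ind law] := A1 i.
case: eqVneq => [->|jk]; first by rewrite (second_moment_diag law) mulr1n.
by rewrite (second_moment_offdiag ind law (i2 i) (i1 i) (m1 i) jk) mulr0n.
Qed.

Lemma normalized_sumE w j : normalized_sum X w j 0 = \sum_i s^-1 * tnth (X i w) j.
Proof.
rewrite /normalized_sum sum_second_momentE invsqrtmx_scalar// mul_scalar_mx mxE summxE.
by rewrite mulr_sumr; apply: eq_bigr => i _; rewrite mxE.
Qed.

Let Y (i j : nat) (w : T) : M :=
  if (insub i : option 'I_n) is Some i' then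
    if (insub j : option 'I_p) is Some j' then s^-1 * tnth (X i' w) j' else 0
  else 0.

Let YE (i : 'I_n) (j : 'I_p) w : Y i j w = s^-1 * tnth (X i w) j.
Proof. by rewrite /Y !valK. Qed.

Let mY i j : measurable_fun setT (Y i j).
Proof.
rewrite /Y; case: insubP => [i' _ _|_]; last exact: measurable_cst.
case: insubP => [j' _ _|_]; last exact: measurable_cst.
exact: measurableT_comp (measurable_rescale s^-1) (measurable_coord (X i') j').
Qed.

Let arrayY (B : nat -> nat -> set M) : (forall i j, measurable (B i j)) ->
  P [set w | forall i j, (i < n)%N -> (j < p)%N -> B i j (Y i j w)] =
  (\prod_(0 <= j < p) \prod_(0 <= i < n) steps mu s i (B i j))%E.
Proof.
move=> mB.
pose A (i : 'I_n) := [set t : p.-tuple M | forall j : 'I_p, (rescale s^-1 @^-1` B i j) (tnth t j)].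
have mRB i j : measurable (rescale s^-1 @^-1` B i j).
  exact: measurable_preimageT (measurable_rescale _) (mB i j).
have mA i : measurable (A i).
  rewrite (_ : A i = \bigcap_(j in [set: 'I_p])
      ((fun t : p.-tuple M => tnth t j) @^-1` (rescale s^-1 @^-1` B i j))).
    apply: fin_bigcap_measurable => // j _.
    exact: measurable_preimageT (measurable_tnth j) (mRB i j).
  by apply/seteqP; split=> t h j; [move=> _|]; exact: h.
transitivity (P [set w | forall i, A i (X i w)]).
  congr (P _); apply/seteqP; split=> w /=.
    by move=> h i j; have := h i j (ltn_ord i) (ltn_ord j); rewrite YE.
  move=> h i j ii jj; rewrite (YE (Ordinal ii) (Ordinal jj)); exact: (h (Ordinal ii) (Ordinal jj)).
rewrite hX// exchange_big/= big_mkord; apply: eq_bigr => i _.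
have [ind law] := A1 i.
have := ind (fun j : 'I_p => rescale s^-1 @^-1` B i j : set M) (fun j => mRB i j).
rewrite big_mkord => h; apply: etrans h _; apply: eq_bigr => j _.
by rewrite (law j)// stepsE.
Qed.

Lemma normalized_sum_box (a b : 'I_p -> \bar R) :
  P [set w | forall j, (a j <= (normalized_sum X w j 0)%:E <= b j)%E] =
  (\prod_(j < p) convn (steps mu s) n (between (a j) (b j)))%E.
Proof.
pose D (j : nat) : set M := if (insub j : option 'I_p) is Some j' then between (a j') (b j') else setT.
have DE (j : 'I_p) : D j = between (a j) (b j) by rewrite /D valK.
have mD j : measurable (D j).
  by rewrite /D; case: insubP => // j' _ _; exact: measurable_between.
have := indep_array mY arrayY mD; rewrite big_mkord.
under [X in _ = X]eq_bigr do rewrite DE.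
move=> <-; congr (P _); apply/seteqP; split=> w /=.
  move=> h j jp; have := h (Ordinal jp); rewrite normalized_sumE big_mkord.
  rewrite (DE (Ordinal jp)) /between /=.
  by under [X in _ -> (_ <= X%:E <= _)%E]eq_bigr do rewrite (YE _ (Ordinal jp)).
move=> h j; have := h j (ltn_ord j); rewrite normalized_sumE big_mkord DE /between /=.
by under [X in (_ <= X%:E <= _)%E -> _]eq_bigr do rewrite YE.
Qed.

End Box.
End Standardized.

(** * The moment conditions of one row *)

Section Moments.
Context {R : realType}.
Local Notation M := (measurableTypeR R).

(** Integrability is part of the statement since odd powers have no sign: the
change of variables in the integral depends on it. *)
Lemma rescaled_moment (c : R) (mu : probability M R) k :
  mu.-integrable setT (EFin \o (fun x : M => x ^+ k)) ->
  (rescaled c mu).-integrable setT (EFin \o (fun x : M => x ^+ k)) /\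
  \int[rescaled c mu]_x (x ^+ k) = c ^+ k * \int[mu]_x (x ^+ k).
Proof.
move=> ik.
have mk : measurable_fun [set: M] (EFin \o (fun x : M => x ^+ k)).
  by apply/measurable_EFinP; exact: measurable_funX.
have ik' : mu.-integrable setT ((EFin \o (fun x : M => x ^+ k)) \o rescale c).
  have := integrableZl measurableT (c ^+ k) ik; apply: eq_integrable => // x _.
  by rewrite /rescale /= -EFinM exprMn.
split; first exact: (integrable_pushforward (measurable_rescale c) mk).
rewrite /Rintegral /rescaled integral_distribution// -RintegralZl//.
by rewrite /Rintegral; congr fine; apply: eq_integral => x _; rewrite /rescale /= exprMn.
Qed.

Section Row.
Context (n : nat) (mu : 'I_n -> probability M R).
Let V := sum_variance mu.
Let s := Num.sqrt (fine V).
Hypotheses (n0 : (0 < n)%N)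
  (odd0 : forall (i : 'I_n) (m : nat), (1 <= m)%N ->
     ('E_(mu i)[fun x : R => (x ^+ (2 * m - 1))%R])%E = 0%E)
  (V0 : (0 < V)%E) (Vy : (V < +oo)%E)
  (even_le : forall m : nat, (1 <= m)%N ->
     ((n%:R ^+ (m - 1))%:E *
      \sum_(i < n) 'E_(mu i)[fun x : R => ((x / s) ^+ (2 * m))%R] <=
      ((2 * m)`!%:R / m`!%:R)%:E)%E).

Let mX k : measurable_fun [set: M] (EFin \o (fun x : M => x ^+ k)).
Proof. by apply/measurable_EFinP; exact: measurable_funX. Qed.

Lemma variance_second_moment i : 'V_(mu i)[idfun]%E = (\int[mu i]_x (x ^+ 2)%:E)%E.
Proof.
have e0 : ('E_(mu i)[idfun : M -> R] = 0)%E.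
  rewrite -(odd0 i (isT : (1 <= 1)%N)) !unlock.
  by apply: eq_integral => x _; rewrite expr1.
rewrite /variance covariance.unlock e0 /= unlock.
by apply: eq_integral => x _ /=; rewrite !fctE /= subr0 expr2.
Qed.

Lemma second_momentE : V = (\sum_i \int[mu i]_x (x ^+ 2)%:E)%E.
Proof. by apply: eq_bigr => i _; exact: variance_second_moment. Qed.

Lemma fine_V0 : 0 < fine V.
Proof. by rewrite fine_gt0// V0. Qed.

Lemma scale_gt0 : 0 < s.
Proof. by rewrite sqrtr_gt0 fine_V0. Qed.

Lemma scale_sq : s ^+ 2 = fine V.
Proof. by rewrite sqr_sqrtr// ltW// fine_V0. Qed.

(** The even moments are summands of a nonnegative sum that is bounded. *)
Lemma even_integrable i m : (1 <= m)%N ->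
  (mu i).-integrable setT (EFin \o (fun x : M => x ^+ (2 * m))).
Proof.
move=> m1; have s0 := scale_gt0.
have E0 j : (0 <= 'E_(mu j)[fun x : R => ((x / s) ^+ (2 * m))%R])%E.
  by rewrite unlock; apply: integral_ge0 => x _; rewrite lee_fin even_exp_ge0.
have Efin : ('E_(mu i)[fun x : R => ((x / s) ^+ (2 * m))%R] < +oo)%E.
  have := even_le m1; rewrite -lee_pdivlMl ?exprn_gt0 ?ltr0n// => h.
  apply: le_lt_trans (_ : _ <= _)%E (le_lt_trans h _); last by rewrite -EFinM ltry.
  by rewrite (bigD1 i)//= leeDl// sume_ge0.
have h : (mu i).-integrable setT (EFin \o (fun x : M => (x / s) ^+ (2 * m))).
  apply/integrableP; split.
    by apply/measurable_EFinP; apply: measurable_funX; exact: measurable_funM.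
  apply: le_lt_trans Efin; rewrite unlock le_eqVlt; apply/orP; left; apply/eqP.
  by apply: eq_integral => x _; rewrite /= ger0_norm// even_exp_ge0.
have := integrableZl measurableT (s ^+ (2 * m)) h; apply: eq_integrable => // x _.
by rewrite /= -EFinM -exprMn mulrCA mulfV ?gt_eqF// mulr1.
Qed.

Lemma square_integrable i : (mu i).-integrable setT (EFin \o (fun x : M => x ^+ 2)).
Proof. exact: (@even_integrable i 1 isT). Qed.

Lemma mean_integrable i : (mu i).-integrable setT (EFin \o (fun x : M => x : R)).
Proof.
have [i1 _] := integrable_axpy 1 (finite_measure_integrable_cst (mu i) 1 measurableT) (square_integrable i).
apply: integrable_of_le i1 _; first exact: measurable_id.
move=> x; rewrite mul1r -(real_normK (num_real x)) /cst.
by move: `|x| (normr_ge0 x) => y y0; have := sqr_ge0 (y - 1); nra.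
Qed.

Lemma cube_integrable i : (mu i).-integrable setT (EFin \o (fun x : M => x ^+ 3)).
Proof.
have [i1 _] := integrable_axpy 1 (square_integrable i) (@even_integrable i 2 isT).
apply: integrable_of_le i1 _; first exact: measurable_funX.
move=> x; rewrite mul1r normrX -(real_normK (num_real x)) (_ : (2 * 2 = 4)%N)//.
have -> : x ^+ 4 = `|x| ^+ 4 by rewrite -normrX ger0_norm// (even_exp_ge0 _ 2).
move: `|x| (normr_ge0 x) => y y0.
have -> : y ^+ 2 + y ^+ 4 = y ^+ 3 + (y ^+ 2 * ((y - 1 / 2) ^+ 2 + 3 / 4)) by field.
by rewrite lerDl mulr_ge0 ?sqr_ge0// addr_ge0 ?sqr_ge0.
Qed.

Lemma mean_zero i : \int[mu i]_x (x : R) = 0.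
Proof.
rewrite -[RHS](_ : fine 0%E = _)// -(odd0 i (isT : (1 <= 1)%N)) unlock /Rintegral.
by congr fine; apply: eq_integral => x _; rewrite expr1.
Qed.

Lemma cube_zero i : \int[mu i]_x (x ^+ 3) = 0.
Proof. by rewrite -[RHS](_ : fine 0%E = _)// -(odd0 i (isT : (1 <= 2)%N)) unlock. Qed.

Lemma sum_squares : \sum_i \int[mu i]_x (x ^+ 2) = s ^+ 2.
Proof.
rewrite scale_sq second_momentE sum_fine// => i _.
exact: integrable_fin_num (square_integrable i).
Qed.

(** The condition on T makes 18 (3h)^2 at most n for all tilts h <= T, which is what
sum_exp_moment asks for the weight e^{3h|x|}. *)
Lemma tame_walk_steps T : 0 <= T -> 162 * T ^+ 2 <= n%:R ->
  tame_walk n (steps mu s) n%:R 6720 T.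
Proof.
move=> T0 Tn h /andP[h0 hT]; have s0 := scale_gt0.
pose f x := x ^+ 8 * expR (3 * h * `|x|).
have H m : (1 <= m)%N ->
    ((n%:R ^+ (m - 1))%:E * \sum_(i < n) \int[steps mu s i]_x (x ^+ (2 * m))%:E <=
    ((2 * m)`!%:R / m`!%:R)%:E)%E.
  move=> /even_le; apply: le_trans; rewrite le_eqVlt; apply/orP; left; apply/eqP.
  congr (_ * _)%E; apply: eq_bigr => i _; rewrite stepsE unlock.
  rewrite ge0_integral_distribution//; last 2 first.
  - exact: mX.
  - by move=> x; rewrite lee_fin even_exp_ge0.
  by apply: eq_integral => x _; rewrite /rescale /= mulrC.
have h3 : 18 * (3 * h) ^+ 2 <= n%:R by apply: le_trans Tn; nra.
have SG := sum_exp_moment n0 h3 H.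
have f0 x : 0 <= f x by rewrite mulr_ge0 ?expR_ge0// (even_exp_ge0 _ 4).
have if0 k : (0 <= \int[steps mu s k]_x (f x)%:E)%E.
  by apply: integral_ge0 => x _; rewrite lee_fin.
have intf (i : 'I_n) : (steps mu s i).-integrable setT (EFin \o f).
  apply/integrableP; split; first by apply/measurable_EFinP; exact: measurable_monomial_expR.
  apply: le_lt_trans (_ : _ <= _)%E (le_lt_trans SG (ltry _)).
  rewrite (bigD1 i)//=; apply: (@le_trans _ _ (\int[steps mu s i]_x (f x)%:E)%E).
    rewrite le_eqVlt; apply/orP; left; apply/eqP.
    by apply: eq_integral => x _; rewrite /= ger0_norm.
  by rewrite leeDl// sume_ge0.
exists (fun k => \int[steps mu s k]_x (x ^+ 2)), (fun k => \int[steps mu s k]_x f x).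
split.
- move=> k kn; have -> : k = Ordinal kn by [].
  move: (Ordinal kn) => i; split => //.
  + by rewrite stepsE; exact: (rescaled_moment _ (square_integrable i)).1.
  + rewrite stepsE; have [_] := rescaled_moment s^-1 (k := 1) (mean_integrable i).
    by under eq_Rintegral do rewrite expr1; rewrite mean_zero mulr0.
  + rewrite stepsE; have [_ ->] := rescaled_moment s^-1 (cube_integrable i).
    by rewrite cube_zero mulr0.
- transitivity (\sum_i s ^- 2 * \int[mu i]_x (x ^+ 2)).
    apply: eq_bigr => i _; rewrite stepsE; have [_ ->] := rescaled_moment s^-1 (square_integrable i).
    by rewrite exprVn.
  by rewrite -mulr_sumr sum_squares mulVf// expf_neq0// gt_eqF.
- rewrite -lee_fin -sumEFin; apply: le_trans SG; rewrite le_eqVlt; apply/orP; left; apply/eqP.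
  by apply: eq_bigr => i _; rewrite /Rintegral fineK//; exact: integrable_fin_num (intf i).
Qed.

End Row.
End Moments.

(** * The distance to the Gaussian law on rectangles *)

Section Assembly.
Context {R : realType}.
Local Notation M := (measurableTypeR R).
Local Notation N01 := (normal_prob (0 : R) 1).

Lemma limn_esup_le_near (u : nat -> \bar R) (N : nat) (b : \bar R) :
  (forall n, (N <= n)%N -> (u n <= b)%E) -> (limn_esup u <= b)%E.
Proof.
move=> H; rewrite /limn_esup /limf_esup.
apply: le_trans (_ : ereal_sup (u @` [set n | (N <= n)%N]) <= b)%E.
  by apply: ereal_inf_lbound; exists [set n | (N <= n)%N] => //; exists N.
by apply: ge_ereal_sup => _ [n /= Nn <-]; exact: H.
Qed.

(** The probabilities of boxes are finite, so that the comparison of their products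
takes place among real numbers. *)
Lemma abse_sub_prod p (L L' : 'I_p -> probability M R) (A A' : 'I_p -> set M) :
  (forall j, measurable (A j)) -> (forall j, measurable (A' j)) ->
  `| \prod_j L j (A j) - \prod_j L' j (A' j) |%E =
  (`| \prod_j fine (L j (A j)) - \prod_j fine (L' j (A' j)) |)%:E.
Proof.
move=> mA mA'.
have E (Q : 'I_p -> probability M R) B : (forall j, measurable (B j)) ->
    (\prod_j Q j (B j))%E = (\prod_j fine (Q j (B j)))%:E.
  by move=> mB; rewrite -prodEFin; apply: eq_bigr => j _; rewrite fineK// fin_num_measure.
by rewrite !E.
Qed.

(** The threshold 1/(16K + 16) on eps leaves room for a factor 2 in the conclusion,
which turns the bound along the sequence into a strict one for its upper
limit. *)
Lemma parameter_choice (K eps r r0 : R) : 1 <= K -> 0 < eps ->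
  eps <= 1 / (16 * K + 16) -> 0 <= r0 -> r0 + 648 + 4 / eps ^+ 3 <= r ->
  [/\ K * eps ^+ 2 <= 1 / 2, eps ^+ 2 <= 1 / 2 &
    4 * (2 * (K * eps ^+ 2) + eps ^+ 2) <= eps / 2] /\
  [/\ 648 * eps <= r ^+ 2, 0 < r, r0 <= r & 4 / eps ^+ 3 <= r ^+ 2].
Proof.
move=> K1 e0 eK r00 rr.
have K16 : 0 < 16 * K + 16 by lra.
have eK' : eps * (16 * K + 16) <= 1 by rewrite -ler_pdivlMr.
have eK0 := mulr_ge0 (ltW e0) (le_trans ler01 K1).
have e16 : eps <= 1 / 16 by lra.
have K2 : 16 * (K * eps ^+ 2) + 16 * eps ^+ 2 <= eps.
  by have := ler_wpM2l (ltW e0) eK'; rewrite mulr1 expr2; lra.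
have e2 := sqr_ge0 eps.
have Ke2 := mulr_ge0 (le_trans ler01 K1) e2.
have e3 : 0 < 4 / eps ^+ 3 by rewrite divr_gt0// exprn_gt0.
move: (4 / eps ^+ 3) e3 rr => q q0 rr.
have r1 : r <= r ^+ 2 by rewrite expr2; nra.
by split; split; lra.
Qed.

Section Rho.
Context d (T : measurableType d) (P : probability T R)
  d' (T' : measurableType d') (Q : probability T' R) (n p : nat)
  (X : 'I_n -> {RV P >-> p.-tuple M}) (Z : {RV Q >-> p.-tuple M})
  (mu : 'I_n -> probability M R) (s : R).
Hypotheses (s0 : 0 < s)
  (gZ : gaussian_vector Z 0 1%:M)
  (hX : mutually_independent P (fun i : 'I_n => X i))
  (A1 : forall i : 'I_n,
     mutually_independent P (fun (j : 'I_p) w => tnth (X i w) j) /\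
     forall j : 'I_p, has_distribution P (fun w => tnth (X i w) j) (mu i))
  (i1 : forall i, (mu i).-integrable setT (EFin \o (fun x : M => x : R)))
  (i2 : forall i, (mu i).-integrable setT (EFin \o (fun x : M => x ^+ 2)))
  (m1 : forall i, \int[mu i]_x (x : R) = 0)
  (v2 : \sum_i \int[mu i]_x (x ^+ 2) = s ^+ 2).

(** Both probabilities of a box are products over the coordinates, to
which prod_compare applies. *)
Lemma rho_le (dlt z : R) : 0 <= dlt -> dlt <= 1 / 2 -> 0 <= z -> p%:R * z <= 1 / 2 ->
  (forall a b : \bar R, (a <= b)%E ->
    `|fine (convn (steps mu s) n (between a b)) - fine (N01 (between a b))| <=
    dlt * (1 - fine (N01 (between a b))) + z) ->
  (rho X Z <= (4 * (2 * dlt + p%:R * z))%:E)%E.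
Proof.
move=> d0 d1 z0 pz H; apply: ge_ereal_sup => _ [A [a [b [ab ->]]] <-].
rewrite (gaussian_box a b gZ) (normalized_sum_box s0 hX A1 i1 i2 m1 v2).
have mB j : measurable (between (a j) (b j)) by exact: measurable_between.
rewrite (abse_sub_prod (fun=> convn (steps mu s) n) (fun=> N01) mB mB) lee_fin.
have fine01 (L : probability M R) B : measurable B -> 0 <= fine (L B) <= 1.
  move=> mB'; rewrite fine_ge0//= -lee_fin fineK ?fin_num_measure//; exact: probability_le1.
by apply: prod_compare => // j; split; [exact: fine01|exact: fine01|exact: H].
Qed.

End Rho.

Section Row.
Context (n : nat) (mu : 'I_n -> probability M R).
Let V := sum_variance mu.
Let s := Num.sqrt (fine V).
Hypotheses (n0 : (0 < n)%N)
  (odd0 : forall (i : 'I_n) (m : nat), (1 <= m)%N ->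
     ('E_(mu i)[fun x : R => (x ^+ (2 * m - 1))%R])%E = 0%E)
  (V0 : (0 < V)%E) (Vy : (V < +oo)%E)
  (even_le : forall m : nat, (1 <= m)%N ->
     ((n%:R ^+ (m - 1))%:E *
      \sum_(i < n) 'E_(mu i)[fun x : R => ((x / s) ^+ (2 * m))%R] <=
      ((2 * m)`!%:R / m`!%:R)%:E)%E).

(** With p <= e^{eps sqrt n} coordinates and X = 2 sqrt eps n^{1/4}, one has
p P(N > X) <= e^{eps sqrt n - 2 eps sqrt n}, which tends to 0; the errors
K eps^2 relative to the tails remain. *)
Lemma rho_le_half d (T : measurableType d) (P : probability T R)
    d' (T' : measurableType d') (Q : probability T' R) (p : nat)
    (X : 'I_n -> {RV P >-> p.-tuple M}) (Z : {RV Q >-> p.-tuple M}) (K eps r r0 : R) :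
  gaussian_vector Z 0 1%:M ->
  mutually_independent P (fun i : 'I_n => X i) ->
  (forall i : 'I_n,
     mutually_independent P (fun (j : 'I_p) w => tnth (X i w) j) /\
     forall j : 'I_p, has_distribution P (fun w => tnth (X i w) j) (mu i)) ->
  (forall n nu r, r0 <= r -> tame_walk n nu (r ^+ 4) 6720 (2 * Num.sqrt eps * r) ->
    forall t, 0 <= t <= 2 * Num.sqrt eps * r ->
    `|fine (convn nu n `[t, +oo[%classic) - gtail t| <= K * eps ^+ 2 * gtail t /\
    `|fine (convn nu n `]t, +oo[%classic) - gtail t| <= K * eps ^+ 2 * gtail t) ->
  1 <= K -> 0 < eps -> eps <= 1 / (16 * K + 16) ->
  r ^+ 4 = n%:R -> r0 + 648 + 4 / eps ^+ 3 <= r -> 0 <= r0 ->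
  p%:R <= expR (eps * r ^+ 2) ->
  (rho X Z <= (eps / 2)%:E)%E.
Proof.
move=> gZ hX A1 MD K1 e0 eK rn rr r00 pe.
have [[D1 e2 fin] [r648 r1 r0r re3]] := parameter_choice K1 e0 eK r00 rr.
have D0 : 0 <= K * eps ^+ 2 by rewrite mulr_ge0 ?sqr_ge0// (le_trans ler01 K1).
have rp2 : 0 < r ^+ 2 by exact: exprn_gt0.
have [Y [Y0 YE]] : exists Y, 0 <= Y /\ Y = 2 * Num.sqrt eps * r.
  by eexists; split; last reflexivity; exact: mulr_ge0 (mulr_ge0 (ler0n _ 2) (sqrtr_ge0 _)) (ltW r1).
have Y2 : Y ^+ 2 = 4 * eps * r ^+ 2.
  by rewrite YE !exprMn sqr_sqrtr ?(ltW e0)// -natrX.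
have walk : tame_walk n (steps mu s) (r ^+ 4) 6720 Y.
  rewrite rn; apply: tame_walk_steps => //; rewrite Y2 -rn (exprD r 2 2).
  rewrite (_ : 162 * _ = 648 * eps * r ^+ 2); last by ring.
  by apply: ler_wpM2r => //; exact: ltW.
have pz : p%:R * (4 * gtail Y) <= eps ^+ 2.
  have h1 := gtail_le_expR Y0.
  apply: (@le_trans _ _ (expR (eps * r ^+ 2) * (4 * expR (- (Y ^+ 2 / 2))))).
    apply: ler_pM => //; first by rewrite mulr_ge0// gtail_ge0.
    by rewrite ler_wpM2l.
  rewrite Y2 mulrCA -expRD.
  have -> : eps * r ^+ 2 + - (4 * eps * r ^+ 2 / 2) = - (eps * r ^+ 2) by field.
  have er0 : 0 < eps * r ^+ 2 by exact: mulr_gt0.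
  apply: le_trans (ler_wpM2l (ler0n _ 4) (expRN_le er0)) _.
  rewrite ler_pdivrMr//.
  have -> : eps ^+ 2 * (eps * r ^+ 2) = r ^+ 2 * eps ^+ 3 by ring.
  by rewrite -ler_pdivrMr ?exprn_gt0.
have D1' : K * eps ^+ 2 <= 1 by apply: le_trans D1 _; rewrite ler_pdivrMr// mul1r ler1n.
have tails (a b : \bar R) : (a <= b)%E ->
    `|fine (convn (steps mu s) n (between a b)) - fine (N01 (between a b))| <=
    K * eps ^+ 2 * (1 - fine (N01 (between a b))) + 4 * gtail Y.
  move=> ab; apply: (between_error D0 D1' Y0 ab) => nu' nuE t tY.
  rewrite YE in walk tY; apply: (MD n nu' r r0r _ t tY).
  by case: nuE => ->//; exact: tame_walk_reflect.
have g0 : 0 <= 4 * gtail Y by rewrite mulr_ge0// gtail_ge0.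
have s0 : 0 < s by exact: scale_gt0.
apply: le_trans (rho_le s0 gZ hX A1 _ _ _ _ D0 D1 g0 (le_trans pz e2) tails) _.
- by move=> i; exact: mean_integrable.
- by move=> i; exact: square_integrable.
- by move=> i; exact: mean_zero.
- exact: sum_squares.
rewrite lee_fin; apply: le_trans fin.
by rewrite ler_wpM2l// lerD2l.
Qed.

End Row.
End Assembly.

Theorem theorem2 (R : realType) (l : R) (hl : 1 < l <= 2)
  (mu : forall n : nat, 'I_n -> probability (measurableTypeR R) R)
  (d : nat -> nat -> measure_display)
  (T : forall n p : nat, measurableType (d n p))
  (P : forall n p : nat, probability (T n p) R)
  (X : forall n p : nat, 'I_n -> {RV (P n p) >-> p.-tuple (measurableTypeR R)})
  (dZ : nat -> measure_display)
  (TZ : forall p : nat, measurableType (dZ p))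
  (Q : forall p : nat, probability (TZ p) R)
  (Z : forall p : nat, {RV (Q p) >-> p.-tuple (measurableTypeR R)})
  (hZ : forall p : nat, gaussian_vector (Z p) 0 1%:M)
  (hX : forall n p : nat, mutually_independent (P n p) (fun i : 'I_n => X n p i))
  (A1 : forall (n p : nat) (i : 'I_n),
     mutually_independent (P n p) (fun (j : 'I_p) w => tnth (X n p i w) j) /\
     forall j : 'I_p,
       has_distribution (P n p) (fun w => tnth (X n p i w) j) (mu n i))
  (A2 : forall (n : nat) (i : 'I_n) (m : nat), (1 <= m)%N ->
     ('E_(mu n i)[fun x : R => (x ^+ (2 * m - 1))%R])%E = 0%E)
  (A3 : (0%E < ereal_inf [set (n%:R^-1)%:E * sum_variance (mu n)
                         | n in [set n : nat | (1 <= n)%N]])%E /\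
        (ereal_sup [set (n%:R^-1)%:E * sum_variance (mu n)
                   | n in [set n : nat | (1 <= n)%N]] < +oo)%E)
  (A4 : forall m : nat, (1 <= m)%N ->
     (ereal_sup [set (n%:R ^+ (m - 1))%:E *
          \sum_(i < n) 'E_(mu n i)[fun x : R =>
             ((x / Num.sqrt (fine (sum_variance (mu n)))) ^+ (2 * m))%R]
        | n in [set n : nat | (1 <= n)%N]]
      <= (l ^- m * (2 * m)`!%:R / m`!%:R)%:E)%E) :
  exists c : R, 0 < c <= (1 - l^-1) ^+ 3 /\
    forall eps : R, 0 < eps < c ->
      (limn_esup (fun n : nat =>
         let p := Num.truncn (expR (eps * Num.sqrt n%:R)) in
         rho (X n p) (Z p)) < eps%:E)%E.
Proof.
have l1 : 1 < l by case/andP: hl.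
have [K K1 MD] := moderate_deviation (ler0n R 6720).
have c1 : 0 < (1 - l^-1) ^+ 3 by rewrite exprn_gt0// subr_gt0 invf_lt1// (lt_trans ltr01).
have c2 : 0 < 1 / (16 * K + 16) by rewrite divr_gt0//; lra.
exists (Num.min ((1 - l^-1) ^+ 3) (1 / (16 * K + 16))); split.
  by rewrite lt_min c1 c2/= ge_min lexx.
move=> eps /andP[e0]; rewrite lt_min => /andP[_ /ltW eK].
have K2 : K * eps ^+ 2 <= 1.
  have eK' : eps * (16 * K + 16) <= 1 by rewrite -ler_pdivlMr//; lra.
  have e1 : eps <= 1 by have := mulr_ge0 (ltW e0) (le_trans ler01 K1); lra.
  by rewrite expr2; have := mulr_ge0 (ltW e0) (le_trans ler01 K1); nra.
have [r0 H] := MD eps e0 K2.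
(* With r = n^(1/4), the bounds hold as soon as r >= B. *)
pose B := `|r0| + 648 + 4 / eps ^+ 3.
apply: (@le_lt_trans _ _ (eps / 2)%:E); last by rewrite lte_fin; lra.
apply: (limn_esup_le_near (N := (Num.truncn (B ^+ 4)).+1)) => n Bn /=.
have n0 : (0 < n)%N by exact: leq_ltn_trans Bn.
have row_in : [set n : nat | (1 <= n)%N] n by [].
have [V0 Vy] : (0 < sum_variance (mu n))%E /\ (sum_variance (mu n) < +oo)%E.
  have [A3l A3u] := A3; have ni : 0 < n%:R^-1 :> R by rewrite invr_gt0 ltr0n.
  have low : (0 < (n%:R^-1)%:E * sum_variance (mu n))%E.
    by apply: lt_le_trans A3l _; apply: ereal_inf_lbound; exists n.
  have up : ((n%:R^-1)%:E * sum_variance (mu n) < +oo)%E.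
    by apply: le_lt_trans A3u; apply: ereal_sup_ubound; exists n.
  move: low up; case: (sum_variance (mu n)) => [v||].
  - by rewrite -EFinM !lte_fin pmulr_rgt0// !ltry.
  - by rewrite gt0_muley ?lte_fin.
  - by rewrite gt0_muleNy ?lte_fin.
have [r rE] : exists r : R, r = Num.sqrt (Num.sqrt n%:R) by eexists.
have rge0 : 0 <= r by rewrite rE sqrtr_ge0.
have r2 : r ^+ 2 = Num.sqrt n%:R by rewrite rE sqr_sqrtr ?sqrtr_ge0.
have r4 : r ^+ 4 = n%:R by rewrite (exprM r 2 2) r2 sqr_sqrtr.
apply: (@rho_le_half _ n (mu n) n0 (A2 n) V0 Vy _ _ _ _ _ _ _ _ (X n _) (Z _) K eps r `|r0|) => //.
- move=> m m1; apply: le_trans (_ : _ <= (l ^- m * (2 * m)`!%:R / m`!%:R)%:E)%E _.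
    by apply: le_trans (A4 m m1); apply: ereal_sup_ubound; exists n.
  rewrite lee_fin -mulrA ler_piMl//.
  by rewrite invf_le1 ?exprn_gt0 ?exprn_ege1 ?(ltW l1) ?(lt_trans ltr01 l1).
- move=> n' nu r' r0r'; apply: H; exact: le_trans (ler_norm _) r0r'.
- rewrite -/B -(ler_pXn2r (n := 4)) ?nnegrE// ?r4.
    apply: ltW (lt_le_trans (truncnS_gt _) _); rewrite ler_nat; exact: Bn.
  exact: addr_ge0 (addr_ge0 (normr_ge0 r0) (ler0n _ 648)) (divr_ge0 (ler0n _ 4) (exprn_ge0 3 (ltW e0))).
- by rewrite r2 truncn_le expR_ge0.
Qed.
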